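(* Fix $x\in\mathscr X$, write $y_M=y_M(x)$, and let $\Delta_n(x)=|\hat y_{M0}(x)-y_M(x)|$. Assume: (i) $p(x,y)$ is four times continuously differentiable with all partial derivatives bounded in absolute value by a finite positive constant $C_p$; (ii) $K_1,K_2$ are even and $\int K_\ell(t)\,dt=1$ for $\ell=1,2$; (iii) $K_2$ is four times continuously differentiable with all derivatives bounded in absolute value, and $\int\{K_2^{(k)}(t)\}^2dt<\infty$, $\int t^2K_2^{(k)}(t)\,dt<\infty$ for $k=0,1,2$; (iv) $\sup_t|\phi_{K_1}(t)/\phi_U(t/h_1)|<\infty$ and $\int|\phi_{K_1}^{(k)}(t)/\phi_U(t/h_1)|\,dt<\infty$ for $k=0,1,2$; (v) $\sup_t|\phi_{K_1}(t)|<\infty$ and $\sup_t|\phi_{K_1}'(t)|<\infty$; (vi) $\int(|t|^b+|t|^{b-1})\{|\phi_{K_1}(t)|+|\phi_{K_1}'(t)|\}\,dt<\infty$ and $\int|t|^4|\phi_{K_1}(t)|\,dt<\infty$, where $b$ is the order of smoothness of $U$ below; (vii) $\phi_{K_1}$ is supported on $[-1,1]$; (viii) the class $\mathscr K_4$ of functions defined in the context is of VC type; (ix) $p_{yy}(x,y_M)$ and $\hat p_{yy}(x,y_M)$ are bounded away from zero. (a) If $U$ is ordinary smooth of order $b$, $\sup_t|\phi_U'(t)|<\infty$, $\phi_{K_1}$ is even and real, and $nh_1^{1+2b}h_2^3\to\infty$, then $$\Delta_n(x)=\frac{|p_{xxy}(x,y_M)\mu_2^{(1)}h_1^2+p_{yyy}(x,y_M)h_2^2|}{-2p_{yy}(x,y_M)}+O_P\left(\sqrt{\frac1{nh_1^{1+2b}h_2^3}}\right)+o(h_1^2+h_2^2).$$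 (b) If $U$ is super smooth of order $b$ (with constants $d_2$, $b_0$), $\phi_{K_1}^{(k)}$ is not identically $0$ for $k=0,1,2$, and $nh_1^{1-2b_2}h_2^3\exp(-2h_1^{-b}/d_2)\to\infty$ with $b_2=b_0I(b_0<0.5)$, then $$\Delta_n(x)=\frac{|p_{xxy}(x,y_M)\mu_2^{(1)}h_1^2+p_{yyy}(x,y_M)h_2^2|}{-2p_{yy}(x,y_M)}+O_P\left\{\frac{\exp(h_1^{-b}/d_2)}{\sqrt{nh_1^{1-2b_2}h_2^3}}\right\}+o(h_1^2+h_2^2).$$ Here $\mu_2^{(1)}=\int t^2K_1(t)\,dt$.
   Context: Data: $(X_j,Y_j)$, $j=1,\dots,n$, are independent pairs from a bivariate distribution with joint density $p(x,y)$; $\mathscr X,\mathscr Y$ are the supports of $X$ and $Y$. The $X_j$ are not observed; instead one observes $W_j=X_j+U_j$, where the $U_j$ are i.i.d. with known density $f_U$ and independent of the $X$'s and $Y$'s. $\phi_U$ is the characteristic function of $U$, assumed even and nowhere zero. Subscripts $x,y$ on $p$ and $\hat p$ denote partial derivatives. For each $x\in\mathscr X$ it is assumed that there is a unique $y_M(x)\in\mathscr Y$ (the conditional mode) with $p_y\{x,y_M(x)\}=0$ and $p_{yy}\{x,y_M(x)\}<0$. Smoothness of $U$: $U$ is ordinary smooth of order $b$ if $\lim_{t\to+\infty}t^b\phi_U(t)=c$ and $\lim_{t\to+\infty}t^{b+1}\phi_U'(t)=-cb$ for some positive constants $b,c$. $U$ is super smooth of order $b$ if $d_0|t|^{b_0}\exp(-|t|^b/d_2)\le|\phi_U(t)|\le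 d_1|t|^{b_1}\exp(-|t|^b/d_2)$ as $|t|\to\infty$ for some positive constants $d_0,d_1,d_2,b,b_0,b_1$. Kernels and bandwidths: $K_1$ is a kernel with Fourier transform $\phi_{K_1}(s)=\int e^{its}K_1(t)\,dt$ (superscript $(k)$ denotes $k$-th derivative); $K_2(t)=\exp(-t^2/2)/\sqrt{2\pi}$; bandwidths $h_1=h_1(n)>0$, $h_2=h_2(n)>0$ tend to $0$ as $n\to\infty$. All integrals are over the real line. The deconvoluting kernel is $$K_{U,0}(t)=\frac1{2\pi}\int e^{-its}\frac{\phi_{K_1}(s)}{\phi_U(s/h_1)}\,ds,$$ and $$\hat p(x,y)=\frac1{nh_1h_2}\sum_{j=1}^nK_{U,0}\left(\frac{W_j-x}{h_1}\right)K_2\left(\frac{Y_j-y}{h_2}\right),\qquad \hat p_y=\frac{\partial\hat p}{\partial y},\quad \hat p_{yy}=\frac{\partial^2\hat p}{\partial y^2}.$$ The local constant mode estimator $\hat y_{M0}(x)$ is the solution $y$ of $\hat p_y(x,y)=0$ (assumed to be a single estimated mode). VC-type class: $\mathscr K_4=\bigcup_{k=0}^4\{(v_1,v_2)\mapsto K_{U,0}\{(v_1-x)/h_1\}K_2^{(k)}\{(v_2-y)/h_2\}\}$, functions on $\mathbb R^2$ indexed by $(x,y)$. It is of VC type if there exist $A,v>0$ and a constant envelope $\tau$ such that $\sup_QN(\mathscr K_4,\mathscr L^2(Q),\tau\epsilon)\le(A/\epsilon)^v$ for $\epsilon\in(0,1)$, where $Q$ ranges over probability measures and $N(T,d,\epsilon)$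 is the $\epsilon$-covering number of the semi-metric space $(T,d)$. *)

(* Defs.v *)
From HB Require Import structures.
From mathcomp Require Import all_boot all_order all_algebra.
From mathcomp Require Import complex.
From mathcomp Require Import all_classical all_reals all_analysis.

Set Implicit Arguments.
Unset Strict Implicit.
Unset Printing Implicit Defensive.

Import Order.TTheory GRing.Theory Num.Theory.
Import numFieldNormedType.Exports.

Local Open Scope classical_set_scope.
Local Open Scope ring_scope.
Local Open Scope complex_scope.

Section ComplexValued.
Context {R : realType}.
Implicit Types (z : R -> R[i]) (K : R -> R).

Definition cabs (z : R[i]) : R := ComplexField.Normc.normc z.

Definition expi (t : R) : R[i] := cos t +i* sin t.

Definition cderiv z : R -> R[i] :=
  fun t => derive1 (fun s => complex.Re (z s)) t +i*
           derive1 (fun s => complex.Im (z s)) t.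

Definition cderivn (k : nat) z : R -> R[i] := iter k cderiv z.

Definition cderivable z : Prop := forall t : R,
  derivable (fun s => complex.Re (z s)) t 1 /\
  derivable (fun s => complex.Im (z s)) t 1.

Definition cintegral d (T : measurableType d) (mu : {measure set T -> \bar R})
    (f : T -> R[i]) : R[i] :=
  Rintegral mu setT (fun x => complex.Re (f x)) +i*
  Rintegral mu setT (fun x => complex.Im (f x)).

Definition fourier K : R -> R[i] :=
  fun s => cintegral (@lebesgue_measure R) (fun t => expi (t * s) * (K t)%:C).

Definition charfun d (T : measurableType d) (P : probability T R)
    (X : {RV P >-> R}) : R -> R[i] :=
  fun t => cintegral P (fun w => expi (t * X w)).

End ComplexValued.

Section Smoothness.
Context {R : realType}.
Implicit Types phi : R -> R[i].

Definition ordinary_smooth phi (b : R) : Prop :=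
  [/\ 0 < b, cderivable phi &
    exists2 c : R, 0 < c &
      cabs ((t `^ b)%:C * phi t - c%:C) @[t --> +oo] --> (0 : R) /\
      cabs ((t `^ (b + 1))%:C * cderiv phi t - (- (c * b))%:C)
        @[t --> +oo] --> (0 : R)].

Definition super_smooth phi (b d2 b0 : R) : Prop :=
  [/\ 0 < b, 0 < d2, 0 < b0 &
    exists d0 d1 b1 : R, [/\ 0 < d0, 0 < d1, 0 < b1 &
      exists T : R, forall t : R, T < `|t| ->
        d0 * `|t| `^ b0 * expR (- (`|t| `^ b / d2)) <= cabs (phi t) /\
        cabs (phi t) <= d1 * `|t| `^ b1 * expR (- (`|t| `^ b / d2))]].

End Smoothness.

Section PartialDerivatives.
Context {R : realType}.
Implicit Types f : R -> R -> R.

Definition dx f : R -> R -> R := fun x y => derive1 (fun u => f u y) x.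

Definition dy f : R -> R -> R := fun x y => derive1 (f x) y.

Fixpoint continuously_differentiable2 (k : nat) f : Prop :=
  if k is k'.+1 then
    [/\ forall x y : R, derivable (fun u => f u y) x 1 /\ derivable (f x) y 1,
        continuously_differentiable2 k' (dx f) &
        continuously_differentiable2 k' (dy f)]
  else continuous (fun z : R * R => f z.1 z.2).

(* Bounds the mixed partial derivatives of orders 1, ..., k, in every order of
   differentiation. *)
Fixpoint partials_bounded (k : nat) (C : R) f : Prop :=
  if k is k'.+1 then
    [/\ forall x y : R, `|dx f x y| <= C /\ `|dy f x y| <= C,
        partials_bounded k' C (dx f) &
        partials_bounded k' C (dy f)]
  else True.

End PartialDerivatives.

Section Probability.
Context {R : realType} d (T : measurableType d) (P : probability T R).

Definition has_density (X : {RV P >-> R}) (f : R -> R) : Prop :=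
  [/\ forall u, 0 <= f u, measurable_fun setT f &
      forall A : set R, measurable A ->
        P [set w | A (X w)] = (\int[lebesgue_measure]_(u in A) (f u)%:E)%E].

Definition has_joint_density (X Y : {RV P >-> R}) (p : R -> R -> R) : Prop :=
  [/\ forall x y, 0 <= p x y,
      measurable_fun setT (fun z : R * R => p z.1 z.2) &
      forall A : set (R * R), measurable A ->
        P [set w | A (X w, Y w)] =
        (\int[(@lebesgue_measure R \x @lebesgue_measure R)]_(z in A)
            (p z.1 z.2)%:E)%E].

Definition mutually_independent (I : eqType) (F : I -> set (set T)) : Prop :=
  forall (J : seq I) (A : I -> set T), uniq J ->
    (forall i, i \in J -> F i (A i)) ->
    P (\bigcap_(i in [set` J]) A i) = (\prod_(i <- J) P (A i))%E.

Definition sample_sigma_algebras (X Y U : nat -> {RV P >-> R})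
    (i : nat + nat) : set (set T) :=
  match i with
  | inl j => preimage_set_system setT (fun w => (X j w, Y j w)) measurable
  | inr j => preimage_set_system setT (U j) measurable
  end.

Definition contaminated_sample (X Y U : nat -> {RV P >-> R})
    (p : R -> R -> R) (fU : R -> R) : Prop :=
  [/\ forall j, has_joint_density (X j) (Y j) p,
      forall j, has_density (U j) fU &
      mutually_independent (sample_sigma_algebras X Y U)].

Definition stochastic_bigO (Z : nat -> T -> R) (r : nat -> R) : Prop :=
  forall e : R, 0 < e -> exists2 M : R, 0 < M &
    \forall n \near \oo, (P [set w | (M * `|r n| < `|Z n w|)%R] <= e%:E)%E.

Definition bounded_away_from_zero_in_probability (Z : nat -> T -> R) : Prop :=
  forall e : R, 0 < e -> exists2 delta : R, 0 < delta &
    \forall n \near \oo, (P [set w | (`|Z n w| < delta)%R] <= e%:E)%E.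

(* The inner event E n makes the notion meaningful for a possibly
   non-measurable A n. *)
Definition with_probability_tending_to_one (A : nat -> set T) : Prop :=
  exists E : nat -> set T,
    (forall n, measurable (E n) /\ E n `<=` A n) /\
    P (E n) @[n --> \oo] --> 1%E.

End Probability.

Section Supports.
Context {R : realType}.
Implicit Types p : R -> R -> R.

(* The support of an absolutely continuous variable is taken to be the set where
   its (marginal) density is positive.  The topological support would also
   contain boundary points x with p x y = 0 for all y, where no conditional mode
   can exist. *)
Definition supportX p : set R :=
  [set x | (0 < \int[lebesgue_measure]_y (p x y)%:E)%E].

Definition supportY p : set R :=
  [set y | (0 < \int[lebesgue_measure]_x (p x y)%:E)%E].

Definition is_conditional_mode p (x y : R) : Prop :=
  [/\ supportY p y, dy p x y = 0 & dy (dy p) x y < 0].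

Definition is_mode_function p (yM : R -> R) : Prop :=
  forall x, supportX p x ->
    is_conditional_mode p x (yM x) /\
    (forall y, is_conditional_mode p x y -> y = yM x).

End Supports.

Section Estimator.
Context {R : realType}.

Definition gaussian_kernel (t : R) : R :=
  expR (- (t ^+ 2 / 2)) / Num.sqrt (2 * pi).

(* phiK and phiU are the Fourier transform of the kernel and the characteristic
   function of the error.  The inverse Fourier integral is real whenever phiK and
   phiU are transforms of even functions, so that taking its real part only
   serves to land in R. *)
Definition deconvoluting_kernel (phiK phiU : R -> R[i]) (h t : R) : R :=
  complex.Re (((2 * pi)^-1)%:C *
    cintegral (@lebesgue_measure R)
      (fun s => expi (- (t * s)) * (phiK s / phiU (s / h)))).

Definition density_estimator (KU0 K2 : R -> R) (h1 h2 : R) (n : nat)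
    (W Y : nat -> R) : R -> R -> R :=
  fun x y => (n%:R * h1 * h2)^-1 *
    \sum_(j < n) KU0 ((W j - x) / h1) * K2 ((Y j - y) / h2).

(* Uniqueness is only asked within D, and g itself need not lie in D. *)
Definition is_single_mode_in (D : set R) (f : R -> R -> R) (x g : R) : Prop :=
  dy f x g = 0 /\ forall y, D y -> dy f x y = 0 -> y = g.

End Estimator.

Section VCType.
Context {R : realType} d (T : measurableType d).

Definition L2_dist (Q : probability T R) (f g : T -> R) : \bar R :=
  Lnorm Q 2%:E (fun z => (f z - g z)%:E).

Definition covering_number (F : set (T -> R)) (dist : (T -> R) -> (T -> R) -> \bar R)
    (e : R) : \bar R :=
  ereal_inf [set N | exists s : seq (T -> R),
    [/\ N = ((size s)%:R)%:E, [set` s] `<=` F &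
        forall f, F f -> exists2 g, g \in s & (dist f g <= e%:E)%E]].

Definition VC_type (F : set (T -> R)) : Prop :=
  exists A v tau : R,
    [/\ 0 < A, 0 < v, 0 < tau,
        forall f, F f -> forall z, `|f z| <= tau &
        forall e : R, 0 < e < 1 ->
          (ereal_sup [set covering_number F (L2_dist Q) (tau * e) |
             Q in [set: probability T R]] <= ((A / e) `^ v)%:E)%E].

End VCType.

Definition kernel_class4 {R : realType} (KU0 K2 : R -> R) (h1 h2 : R) :
    set (R * R -> R) :=
  [set f | exists (k : nat) (x y : R), (k <= 4)%N /\
     f = (fun z : R * R => KU0 ((z.1 - x) / h1) * derive1n k K2 ((z.2 - y) / h2))].

Definition dominating_bias {R : realType} (p : R -> R -> R) (mu2 x yM h1 h2 : R)
    : R :=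
  `|dy (dx (dx p)) x yM * mu2 * h1 ^+ 2 + dy (dy (dy p)) x yM * h2 ^+ 2| /
  (- 2 * dy (dy p) x yM).

(* Main.v *)
Require Import Defs.
From HB Require Import structures.
From mathcomp Require Import all_boot all_order all_algebra.
From mathcomp Require Import complex.
From mathcomp Require Import all_classical all_reals all_analysis.
From mathcomp Require Import measurable_realfun ring lra.

Set Implicit Arguments.
Unset Strict Implicit.
Unset Printing Implicit Defensive.

Import Order.TTheory GRing.Theory Num.Theory.
Import numFieldNormedType.Exports.

Local Open Scope classical_set_scope.
Local Open Scope ring_scope.

(* Since K1 and phi_U are even, all Fourier transforms are real cosine transforms.
   Taking the mean over the error undoes the deconvolution, so that the y-derivative
   of the density estimator at (x, y) has mean Q_n(y), the smoothing of p_y by the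
   two kernels; by Plancherel's inequality its variance is of order
   sup_{|s| <= 1} |phi_U(s / h1)|^-2 / (n h1 h2^3).  A second order Taylor expansion
   shows that Q_n has a zero y_M + t_n with
   t_n = - (p_xxy mu_2 h1^2 + p_yyy h2^2) / (2 p_yy) + o(h1^2 + h2^2), and that near
   it Q_n decreases with slope at most p_yy / 2 < 0.  By Chebyshev's inequality the
   y-derivative of the estimator therefore changes sign within O_P(r_n) of
   y_M + t_n, so it has a zero there, which by uniqueness is the estimated mode.  This
   argument does not involve the second derivative of the estimator. *)

(** * Integrals of real-valued functions *)

(** Centring at the zero y_M + t_n of the mean slope, rather than at y_M, separates bias from noise:
    the stochastic term is |yhat - y_M| - |t_n|, the deterministic remainder is |t_n| - |B_n| / l,
    where B_n is the leading bias of the slope and l = - p_yy. The tail bound is then needed only at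
    the two nonrandom points y_M + t_n - M r_n and y_M + t_n + M r_n, so nothing uniform in y
    enters. Three obstacles shape the analysis. [K1] is merely integrable, so Fourier inversion is
    proved after integration against a bounded continuous integrable function, the form in which the
    mean of the estimator uses it. The ratio of phi_K1 to phi_U is bounded with compact support, but
    square integrability of its transform has to be part of Plancherel's inequality; exponential
    damping serves both purposes. Only second moments of [K1] are available, so the remainder o(h1^2
    + h2^2) comes from dominated convergence and not from a third-order expansion. Finally, the
    assumed bounds concern derivatives only; that [p] itself is bounded follows from its unit
    mass. *)

Section RealIntegral.
Context d (T : measurableType d) (R : realType) (mu : {measure set T -> \bar R}).
Implicit Types f g : T -> R.

Local Notation intble f := (mu.-integrable setT (EFin \o f)).

Lemma intble_meas f : intble f -> measurable_fun setT f.
Proof. by move/measurable_int/measurable_EFinP. Qed.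

Lemma intble_le f g : measurable_fun setT f -> (forall x, `|f x| <= g x) ->
  intble g -> intble f.
Proof.
move=> mf fg; apply: le_integrable => //; first exact/measurable_EFinP.
by move=> x _; rewrite /= lee_fin (le_trans (fg x))// ler_norm.
Qed.

Lemma intble_eq f g : f =1 g -> intble f -> intble g.
Proof. by move=> /funext ->. Qed.

Lemma intbleD f g : intble f -> intble g -> intble (fun x => f x + g x).
Proof. by move=> fi gi; exact: (integrableD measurableT fi gi). Qed.

Lemma intbleB f g : intble f -> intble g -> intble (fun x => f x - g x).
Proof. by move=> fi gi; exact: (integrableB measurableT fi gi). Qed.

Lemma intbleZ k f : intble f -> intble (fun x => k * f x).
Proof. by move=> fi; exact: (integrableZl measurableT k fi). Qed.

Lemma intble_norm f : intble f -> intble (fun x => `|f x|).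
Proof. exact: integrable_norm. Qed.

Lemma intbleM f g M : intble f -> measurable_fun setT g ->
  (forall x, `|g x| <= M) -> intble (fun x => f x * g x).
Proof.
move=> fi mg gM; apply: (@intble_le _ (fun x => M * `|f x|)).
- by apply: measurable_funM => //; exact: intble_meas.
- by move=> x; rewrite normrM mulrC ler_wpM2r.
- exact/intbleZ/intble_norm.
Qed.

Lemma intble_ge0 f : measurable_fun setT f -> (forall x, 0 <= f x) ->
  (\int[mu]_x (f x)%:E < +oo)%E -> intble f.
Proof.
move=> mf f0 fy; apply/integrableP; split; first exact/measurable_EFinP.
by under eq_integral do rewrite gee0_abs ?lee_fin//.
Qed.

Lemma EFin_Rint f : intble f -> (\int[mu]_x f x)%:E = (\int[mu]_x (f x)%:E)%E.
Proof. by move=> fi; rewrite fineK//; exact: integrable_fin_num. Qed.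

Lemma RintegralN f : intble f -> \int[mu]_x (- f x) = - \int[mu]_x f x.
Proof.
move=> fi; rewrite -mulN1r -RintegralZl//.
by apply: eq_Rintegral => x _; rewrite mulN1r.
Qed.

Lemma Rint_le_norm f g : intble f -> intble g -> (forall x, `|f x| <= g x) ->
  `|\int[mu]_x f x| <= \int[mu]_x g x.
Proof.
move=> fi gi fg; apply: (le_trans (le_normr_Rintegral measurableT fi)).
by apply: le_Rintegral => //; exact: intble_norm.
Qed.

Lemma Rint_cvg (f_ : nat -> T -> R) f g :
  (forall n, measurable_fun setT (f_ n)) ->
  (forall x, f_ n x @[n --> \oo] --> f x) ->
  (forall n x, `|f_ n x| <= g x) -> intble g ->
  \int[mu]_x f_ n x @[n --> \oo] --> \int[mu]_x f x.
Proof.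
move=> mf_ cf fg gi.
have mf : measurable_fun setT f by apply: (measurable_fun_cvg mf_) => x _; exact: cf.
have fi : intble f.
  apply: (intble_le mf _ gi) => x.
  apply: (ler_cvg_to (cvg_norm (cf x)) (cvg_cst (g x))).
  by apply: nearW => n; exact: fg.
apply: fine_cvg; rewrite EFin_Rint//.
apply: (dominated_cvg measurableT (g := EFin \o g)) => //.
- by move=> n; exact/measurable_EFinP.
- by move=> x _; apply: cvg_EFin; [exact: nearW|exact: cf].
- by move=> n x _; rewrite /= lee_fin.
Qed.

End RealIntegral.

(** * Fubini's theorem for real-valued integrals *)

Section RealFubini.
Context d1 d2 (T1 : measurableType d1) (T2 : measurableType d2) (R : realType).
Context (m1 : {sigma_finite_measure set T1 -> \bar R}).
Context (m2 : {sigma_finite_measure set T2 -> \bar R}).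
Implicit Types F : T1 * T2 -> R.

(** Integrability of every section, not just of almost every one, makes the real inner integral
    agree everywhere with the extended one, so that no null set has to be carried along. *)
Lemma Rint_prod1 F : (m1 \x m2)%E.-integrable setT (EFin \o F) ->
  (forall x, m2.-integrable setT (EFin \o (fun y => F (x, y)))) ->
  m1.-integrable setT (EFin \o (fun x => \int[m2]_y F (x, y))) /\
  \int[m1]_x \int[m2]_y F (x, y) = \int[(m1 \x m2)%E]_z F z.
Proof.
move=> Fi Fs.
have E : EFin \o (fun x => \int[m2]_y F (x, y)) = fubini_F m2 (EFin \o F).
  by apply/funext => x /=; rewrite EFin_Rint.
split; first by rewrite E; exact: (integrable_fubini_F Fi).
rewrite /Rintegral -(integral12_prod_meas1 Fi); congr fine.
by apply: eq_integral => x _; rewrite -E.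
Qed.

Lemma Rint_prod2 F : (m1 \x m2)%E.-integrable setT (EFin \o F) ->
  (forall y, m1.-integrable setT (EFin \o (fun x => F (x, y)))) ->
  m2.-integrable setT (EFin \o (fun y => \int[m1]_x F (x, y))) /\
  \int[m2]_y \int[m1]_x F (x, y) = \int[(m1 \x m2)%E]_z F z.
Proof.
move=> Fi Fs.
have E : EFin \o (fun y => \int[m1]_x F (x, y)) = fubini_G m1 (EFin \o F).
  by apply/funext => x /=; rewrite EFin_Rint.
have mFi := measurable_int _ Fi.
split.
  apply/integrableP; split; first by rewrite E; exact: (measurable_fubini_G Fi).
  apply: le_lt_trans ((integrable21ltyP _ _ mFi).1 Fi).
  apply: ge0_le_integral => //.
  - by apply: measurableT_comp => //; rewrite E; exact: (measurable_fubini_G Fi).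
  - apply: (@measurable_fun_fubini_tonelli_G _ _ _ _ _ m1 (abse \o (EFin \o F))) => //.
    * exact: (measurableT_comp (@abse_measurable _ _) mFi).
    * by move=> z; exact: abse_ge0.
  - move=> y _; rewrite E; apply: le_abse_integral => //.
    exact: (measurable_int _ (Fs y)).
rewrite /Rintegral -(integral21_prod_meas1 Fi); congr fine.
by apply: eq_integral => x _; rewrite -E.
Qed.

Section dominated.
Context (F : T1 * T2 -> R) (g : T1 -> R) (h : T2 -> R).
Hypothesis mF : measurable_fun setT F.
Hypothesis Fgh : forall x y, `|F (x, y)| <= g x * h y.
Hypothesis gi : m1.-integrable setT (EFin \o g).
Hypothesis hi : m2.-integrable setT (EFin \o h).

(** Tonelli splits the integral of the bound into the product of the integrals of [g] and [h]. A
    bound of this shape also makes every section integrable, which is all that an interchange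
    needs. *)
Lemma intble_prod_dom : (m1 \x m2)%E.-integrable setT (EFin \o F).
Proof.
have mg := intble_meas gi; have mh := intble_meas hi.
apply: (@intble_le _ _ _ _ _ (fun z => g z.1 * h z.2)) => //.
  by move=> [x y]; exact: Fgh.
have mgh : measurable_fun setT (EFin \o (fun z : T1 * T2 => g z.1 * h z.2)).
  by apply/measurable_EFinP; apply: measurable_funM; apply: measurableT_comp.
apply/(integrable12ltyP _ _ mgh) => /=.
under eq_integral => x _.
  under eq_integral => y _ do rewrite normrM EFinM.
  rewrite ge0_integralZl//; last first.
    by do 2 apply: measurableT_comp => //.
  over.
rewrite ge0_integralZr//; last 2 first.
- by do 2 apply: measurableT_comp => //.
- by apply: integral_ge0.
move/integrableP : gi => [_ giy]; move/integrableP : hi => [_ hiy].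
rewrite lte_mul_pinfty//; first exact: integral_ge0.
by rewrite ge0_fin_numE//; exact: integral_ge0.
Qed.

Lemma intble_section1 x : m2.-integrable setT (EFin \o (fun y => F (x, y))).
Proof.
apply: (@intble_le _ _ _ _ _ (fun y => g x * h y)) => //; last exact: intbleZ.
exact: (measurableT_comp mF).
Qed.

Lemma intble_section2 y : m1.-integrable setT (EFin \o (fun x => F (x, y))).
Proof.
apply: (@intble_le _ _ _ _ _ (fun x => h y * g x)) => //; last exact: intbleZ.
  exact: (measurableT_comp mF).
by move=> x; rewrite mulrC.
Qed.

Lemma intble_Rint1 : m1.-integrable setT (EFin \o (fun x => \int[m2]_y F (x, y))).
Proof. by have [] := Rint_prod1 intble_prod_dom intble_section1. Qed.

Lemma intble_Rint2 : m2.-integrable setT (EFin \o (fun y => \int[m1]_x F (x, y))).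
Proof. by have [] := Rint_prod2 intble_prod_dom intble_section2. Qed.

Lemma Rfubini_dom :
  \int[m1]_x \int[m2]_y F (x, y) = \int[m2]_y \int[m1]_x F (x, y).
Proof.
have [_ ->] := Rint_prod1 intble_prod_dom intble_section1.
by have [_ ->] := Rint_prod2 intble_prod_dom intble_section2.
Qed.

End dominated.
End RealFubini.

(** * Affine change of variables for Lebesgue measure *)

Section AffineSubstitution.
Context (R : realType).
Local Notation leb := (@lebesgue_measure R).

Lemma measurable_affine (a b : R) : measurable_fun setT (fun u : R => b + a * u).
Proof. by apply: measurable_funD => //; exact: measurable_funM. Qed.

Section image.
Variables a b : R.
Hypothesis a0 : a != 0.

Let A (u : measurableTypeR R) : measurableTypeR R := b + a * (u : R).
Let mA : measurable_fun setT A. Proof. exact: measurable_affine. Qed.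
Let pA : {measure set (measurableTypeR R) -> \bar R} :=
  measure_function_pushforward__canonical__measure_function_Measure leb mA.

(** Lebesgue measure is determined by its values on half-open intervals. The sign of [a] matters
    because a negative slope reverses the endpoints and turns []c, d]] into an interval closed on
    the left. *)
Lemma lebesgue_affine (S : set R) : measurable S ->
  leb S = mscale `|a|%:nng pA S.
Proof.
move=> mS; apply: lebesgue_measure_unique => //= _ [[c d] /= _ <-].
have aV : 0 < `|a| by rewrite normr_gt0.
rewrite /mscale /pA /= /pushforward /=.
have [cd|dc] := ltP c d; last first.
  by rewrite set_itv_ge ?bnd_simp -?leNgt// preimage_set0 !measure0 mule0.
rewrite lebesgue_measure_itv/= lte_fin cd.
have [agt|alt] := ltP 0 a.
  have -> : A @^-1` `]c, d] = `](c - b) / a, (d - b) / a]%classic.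
    apply/seteqP; split => u; rewrite /A /= !in_itv/=.
      by rewrite ltr_pdivrMr// ler_pdivlMr// ltrBlDl lerBrDl (mulrC u).
    by rewrite ltr_pdivrMr// ler_pdivlMr// ltrBlDl lerBrDl (mulrC u).
  rewrite lebesgue_measure_itv/= lte_fin ltr_pM2r ?invr_gt0// ltrD2r cd.
  rewrite gtr0_norm// -!EFinB -EFinM; congr EFin; field; exact: a0.
have {}alt : a < 0 by rewrite lt_neqAle a0.
have -> : A @^-1` `]c, d] = `[(d - b) / a, (c - b) / a[%classic.
  apply/seteqP; split => u; rewrite /A /= !in_itv/=.
    by rewrite ler_ndivrMr// ltr_ndivlMr// lerBrDl ltrBlDl (mulrC u) andbC.
  by rewrite ler_ndivrMr// ltr_ndivlMr// lerBrDl ltrBlDl (mulrC u) andbC.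
rewrite lebesgue_measure_itv/= lte_fin ltr_nM2r ?invr_lt0// ltrD2r cd.
rewrite ltr0_norm// -!EFinB -EFinM; congr EFin; field; exact: a0.
Qed.

Lemma ge0_integral_affine (f : R -> R) : measurable_fun setT f ->
  (forall x, 0 <= f x) ->
  (\int[leb]_x (f x)%:E = `|a|%:E * \int[leb]_u (f (b + a * u))%:E)%E.
Proof.
move=> mf f0.
have mEf : measurable_fun setT (EFin \o f) by exact/measurable_EFinP.
transitivity (integral (mscale `|a|%:nng pA) setT (EFin \o f)).
  by apply: eq_measure_integral => S mS _; exact: lebesgue_affine.
rewrite ge0_integral_mscale//; last by move=> x _; rewrite /= lee_fin.
congr (_ * _)%E.
apply: (@ge0_integral_pushforward _ _ _ _ _ _ mA leb setT (EFin \o f)) => //.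
by move=> x _; rewrite /= lee_fin.
Qed.

Lemma intble_affine (f : R -> R) : leb.-integrable setT (EFin \o f) ->
  leb.-integrable setT (EFin \o (fun u => f (b + a * u))).
Proof.
move=> fi; have mf := intble_meas fi.
apply/integrableP; split; first exact/measurable_EFinP/measurableT_comp.
move/integrableP : fi => [_ ]; rewrite /= (ge0_integral_affine (f := fun x => `|f x|))//.
  (* Were the transformed integral infinite, the positive factor would make the finite integral of
     the absolute value of [f] infinite as well. *)
  have [h|] := ltP (\int[leb]_x (`|f (b + a * x)|)%:E)%E +oo%E => //.
  by rewrite leye_eq => /eqP /= ->; rewrite gt0_muley// lte_fin normr_gt0.
exact: measurableT_comp.
Qed.

Lemma Rint_affine (f : R -> R) : leb.-integrable setT (EFin \o f) ->
  \int[leb]_x f x = `|a| * \int[leb]_u f (b + a * u).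
Proof.
move=> fi; have mf := intble_meas fi.
have H g : leb.-integrable setT (EFin \o g) -> (forall x, 0 <= g x) ->
   \int[leb]_x g x = `|a| * \int[leb]_u g (b + a * u).
  move=> gi g0; rewrite -RintegralZl//; last exact: (intble_affine gi).
  rewrite /Rintegral ge0_integral_affine//; last exact: intble_meas gi.
  congr fine; rewrite -ge0_integralZl//.
    by apply/measurable_EFinP/measurableT_comp => //; exact: intble_meas gi.
  by move=> x _; rewrite lee_fin.
have [p [q [pi qi p0 q0 fE]]] : exists p q : R -> R,
  [/\ leb.-integrable setT (EFin \o p), leb.-integrable setT (EFin \o q),
      forall x, 0 <= p x, forall x, 0 <= q x & f = fun x => p x - q x].
  exists (f^\+), (f^\-); split.
  - exact: integrable_funrpos.
  - exact: integrable_funrneg.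
  - exact: funrpos_ge0.
  - exact: funrneg_ge0.
  - by rewrite -[LHS]funrposBneg.
rewrite fE !RintegralB//; try exact: (intble_affine pi); try exact: (intble_affine qi).
by rewrite mulrBr (H p)// (H q).
Qed.

End image.

Lemma Rint_opp (f : R -> R) : leb.-integrable setT (EFin \o f) ->
  \int[leb]_x f (- x) = \int[leb]_x f x.
Proof.
move=> fi; rewrite (@Rint_affine (-1) 0 _ f fi) ?oppr_eq0 ?oner_neq0//.
by rewrite normrN1 mul1r; apply: eq_Rintegral => x _; rewrite add0r mulN1r.
Qed.

Lemma Rint_odd (f : R -> R) : leb.-integrable setT (EFin \o f) ->
  (forall x, f (- x) = - f x) -> \int[leb]_x f x = 0.
Proof.
move=> fi fN; have := Rint_opp fi.
under eq_Rintegral do rewrite fN.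
rewrite RintegralN// => /eqP; rewrite eq_sym -subr_eq0 opprK -mulr2n mulrn_eq0.
by move/eqP.
Qed.

End AffineSubstitution.

(** * Cosine transforms *)

Section DerivativeRules.
Context {R : realType}.
Implicit Types (f g : R -> R) (x a b : R).

Lemma isd_add f g x a b : is_derive x 1 f a -> is_derive x 1 g b ->
  is_derive x 1 (fun t => f t + g t) (a + b).
Proof. exact: is_deriveD. Qed.

Lemma isd_mul f g x a b : is_derive x 1 f a -> is_derive x 1 g b ->
  is_derive x 1 (fun t => f t * g t) (a * g x + f x * b).
Proof.
move=> df dg; apply: (is_derive_eq (is_deriveM df dg)).
by rewrite addrC mulrC.
Qed.

Lemma isd_cst (c : R) x : is_derive x 1 (fun _ : R => c) 0.
Proof. exact: is_derive_cst. Qed.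

Lemma isd_id x : is_derive x 1 (fun t : R => t) 1.
Proof. exact: is_derive_id. Qed.

Lemma isd_scale f x a (c : R) : is_derive x 1 f a ->
  is_derive x 1 (fun t => c * f t) (c * a).
Proof.
move=> df; apply: (is_derive_eq (isd_mul (isd_cst c x) df)).
by rewrite mul0r add0r.
Qed.

Lemma isd_opp f x a : is_derive x 1 f a -> is_derive x 1 (fun t => - f t) (- a).
Proof. exact: is_deriveN. Qed.

Lemma isd_comp f g x a b : is_derive (g x) 1 f a -> is_derive x 1 g b ->
  is_derive x 1 (fun t => f (g t)) (a * b).
Proof. exact: is_derive1_comp. Qed.

Lemma der_derivable f x a : is_derive x 1 f a -> derivable f x 1.
Proof. by case. Qed.

Lemma der_derive1 f x a : is_derive x 1 f a -> derive1 f x = a.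
Proof. by move=> df; rewrite derive1E derive_val. Qed.

Lemma derivable_der f x : derivable f x 1 -> is_derive x 1 f (derive1 f x).
Proof. by move=> df; rewrite derive1E; exact: DeriveDef. Qed.

Lemma der_continuous f (df : R -> R) : (forall x, is_derive x 1 f (df x)) ->
  continuous f.
Proof.
by move=> H x; apply: differentiable_continuous; apply/derivable1_diffP; case: (H x).
Qed.

Lemma der_lipschitz f (df : R -> R) (C : R) : (forall x, is_derive x 1 f (df x)) ->
  (forall x, `|df x| <= C) -> forall x y, `|f x - f y| <= C * `|x - y|.
Proof.
move=> H HC.
have W x y : x < y -> `|f y - f x| <= C * `|y - x|.
  move=> xy; have [c _ ->] := MVT xy (fun z _ => H z)
    (continuous_subspaceT (der_continuous H)).
  by rewrite normrM ler_wpM2r.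
move=> x y; have [/W|/W|->] := ltgtP x y => //; last by rewrite !subrr !normr0 mulr0.
by rewrite distrC (distrC x).
Qed.

Lemma MVT_any f (df : R -> R) : (forall x, is_derive x 1 f (df x)) ->
  forall x y, exists2 c, `|c - x| <= `|y - x| & f y - f x = df c * (y - x).
Proof.
move=> H x y; have [xy|yx|<-] := ltgtP x y.
- have [c] := MVT xy (fun z _ => H z) (continuous_subspaceT (der_continuous H)).
  rewrite in_itv/= => /andP[xc cy] E; exists c => //.
  by rewrite !gtr0_norm ?subr_gt0// lerD2r ltW.
- have [c] := MVT yx (fun z _ => H z) (continuous_subspaceT (der_continuous H)).
  rewrite in_itv/= => /andP[yc cx] E; exists c => //.
    by rewrite !ltr0_norm ?subr_lt0// lerN2 lerD2r ltW.
  by rewrite -opprB E -mulrN opprB.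
- by exists x; rewrite ?subrr// mulr0.
Qed.

End DerivativeRules.

Section CosTransform.
Context d (T : measurableType d) (R : realType) (mu : {measure set T -> \bar R}).
Implicit Types X f : T -> R.

(** One definition for two objects: with Lebesgue measure and [X = idfun] it is the Fourier
    transform of an even function; with [P], the error as [X] and [f = 1] it is an even
    characteristic function. *)
Definition cos_transform X f (s : R) : R := \int[mu]_w (cos (s * X w) * f w).

Variables X f : T -> R.
Hypothesis mX : measurable_fun setT X.
Hypothesis fi : mu.-integrable setT (EFin \o f).

Lemma measurable_cosM s : measurable_fun setT (fun w => cos (s * X w)).
Proof.
apply: (measurableT_comp (continuous_measurable_fun (@continuous_cos R))).
exact: measurable_funM.
Qed.

Lemma intble_cosM s : mu.-integrable setT (EFin \o (fun w => cos (s * X w) * f w)).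
Proof.
apply: (@intble_le _ _ _ _ _ (fun w => `|f w|)); last exact: intble_norm.
  by apply: measurable_funM; [exact: measurable_cosM|exact: intble_meas fi].
by move=> w; rewrite normrM ler_piMl// cos_max.
Qed.

Lemma cos_transform_bound s : `|cos_transform X f s| <= \int[mu]_w `|f w|.
Proof.
apply: Rint_le_norm; [exact: intble_cosM|exact: intble_norm|].
by move=> w; rewrite normrM ler_piMl// cos_max.
Qed.

Lemma continuous_cos_transform : continuous (cos_transform X f).
Proof.
move=> s; apply/(@cvg_nbhsP _ R^o) => u us.
apply: (Rint_cvg (mu := mu) (f_ := fun n w => cos (u n * X w) * f w)
  (f := fun w => cos (s * X w) * f w) (g := fun w => `|f w|)).
- by move=> n; apply: measurable_funM; [exact: measurable_cosM|exact: intble_meas fi].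
- move=> w; apply: cvgM; last exact: cvg_cst.
  apply: continuous_cvg; first exact: continuous_cos.
  by apply: cvgM => //; exact: cvg_cst.
- by move=> n w; rewrite normrM ler_piMl// cos_max.
- exact: intble_norm.
Qed.

Lemma measurable_cos_transform : measurable_fun setT (cos_transform X f).
Proof. by apply: continuous_measurable_fun; exact: continuous_cos_transform. Qed.

End CosTransform.

(** * The Cauchy kernel as the Fourier transform of a two-sided exponential *)

Section CauchyKernel.
Context {R : realType}.
Local Notation leb := (@lebesgue_measure R).

(** This is 2 pi times the Poisson kernel of the half-plane at height [e]. *)
Definition cauchy (e z : R) : R := 2 * e / (e ^+ 2 + z ^+ 2).

Lemma cauchyN (e z : R) : cauchy e (- z) = cauchy e z.
Proof. by rewrite /cauchy sqrrN. Qed.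

Lemma sqrD_gt0 (e z : R) : 0 < e -> 0 < e ^+ 2 + z ^+ 2.
Proof. by move=> e0; rewrite ltr_pwDl ?exprn_gt0 ?sqr_ge0. Qed.

Lemma cauchy_ge0 (e z : R) : 0 < e -> 0 <= cauchy e z.
Proof. by move=> e0; rewrite /cauchy divr_ge0 ?mulr_ge0// ltW ?sqrD_gt0. Qed.

Lemma cauchy_le (e z : R) : 0 < e -> cauchy e z <= 2 / e.
Proof.
move=> e0; rewrite /cauchy ler_pdivrMr ?sqrD_gt0//.
rewrite -(ler_pM2l e0).
have -> : e * (2 / e * (e ^+ 2 + z ^+ 2)) = 2 * (e ^+ 2 + z ^+ 2).
  by field; rewrite gt_eqF.
by have := sqr_ge0 z; nra.
Qed.

Lemma oneDsqr_pos (x : R) : 0 < oneDsqr x.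
Proof. exact: lt_le_trans ltr01 (oneDsqr_ge1 _). Qed.

Lemma measurable_cauchy (e : R) : 0 < e -> measurable_fun setT (cauchy e).
Proof.
move=> e0; apply: continuous_measurable_fun => z.
apply: cvgM; first exact: cvg_cst.
apply: cvgV; first by rewrite gt_eqF// sqrD_gt0.
apply: cvgD; first exact: cvg_cst.
exact: exprn_continuous.
Qed.

Lemma integral_oneDsqrV : (\int[leb]_x ((oneDsqr x)^-1)%:E = pi%:E)%E.
Proof.
rewrite ge0_symfun_integralT//=.
- rewrite (_ : [set x | _] = `[0, +oo[%classic); last first.
    by apply/seteqP; split => x/=; rewrite in_itv/= andbT.
  by rewrite integral0y_oneDsqr -EFinM mulrCA divff// mulr1.
- exact: continuous_oneDsqrV.
- by move=> x /=; rewrite /oneDsqr sqrrN.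
Qed.

Lemma intble_oneDsqrV : leb.-integrable setT (EFin \o (fun x => (oneDsqr x)^-1)).
Proof.
apply: intble_ge0.
- by apply: continuous_measurable_fun; exact: continuous_oneDsqrV.
- by move=> x; rewrite invr_ge0 ltW// oneDsqr_pos.
- by rewrite integral_oneDsqrV ltry.
Qed.

Lemma Rint_oneDsqrV : \int[leb]_x (oneDsqr x)^-1 = pi.
Proof. by rewrite /Rintegral integral_oneDsqrV. Qed.

Lemma cauchy_scaled (e z : R) : 0 < e -> e * cauchy e (e * z) = 2 * (oneDsqr z)^-1.
Proof.
move=> e0; rewrite /cauchy /oneDsqr; field.
by apply/andP; split; rewrite gt_eqF//; [exact: oneDsqr_pos|exact: sqrD_gt0].
Qed.

Lemma cauchy_oneDsqrV (e : R) : 0 < e ->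
  cauchy e = fun z => (2 / e) * (oneDsqr (0 + e^-1 * z))^-1.
Proof.
move=> e0; apply/funext => z; rewrite add0r.
have := cauchy_scaled (e^-1 * z) e0.
rewrite mulVKf ?gt_eqF// => /(canRL (mulKf _)) ->; last by rewrite gt_eqF.
by rewrite mulrA (mulrC _ 2).
Qed.

Lemma intble_cauchy (e : R) : 0 < e -> leb.-integrable setT (EFin \o cauchy e).
Proof.
move=> e0; rewrite cauchy_oneDsqrV//; apply: intbleZ.
by apply: (intble_affine 0 _ intble_oneDsqrV); rewrite invr_eq0 gt_eqF.
Qed.

Lemma Rint_cauchy (e : R) : 0 < e -> \int[leb]_z cauchy e z = 2 * pi.
Proof.
move=> e0; rewrite cauchy_oneDsqrV// RintegralZl//; last first.
  by apply: (intble_affine 0 _ intble_oneDsqrV); rewrite invr_eq0 gt_eqF.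
have eV : e^-1 != 0 by rewrite invr_eq0 gt_eqF.
have := Rint_affine 0 eV intble_oneDsqrV.
rewrite Rint_oneDsqrV gtr0_norm ?invr_gt0// => ->.
by field; rewrite gt_eqF.
Qed.

Lemma Rint_cauchy_shift (e b : R) : 0 < e ->
  leb.-integrable setT (EFin \o (fun z => cauchy e (b - z))) /\
  \int[leb]_z cauchy e (b - z) = 2 * pi.
Proof.
move=> e0; have m1 : -1 != 0 :> R by rewrite oppr_eq0 oner_neq0.
have E : (fun z => cauchy e (b - z)) = (fun z => cauchy e (b + -1 * z)).
  by apply/funext => z; rewrite mulN1r.
rewrite E; split; first exact: (intble_affine b m1 (intble_cauchy e0)).
have := Rint_affine b m1 (intble_cauchy e0).
by rewrite normrN1 mul1r Rint_cauchy.
Qed.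

(** An antiderivative on the half-line of [expR (- e * s) * (1 + cos (t * s))]. The added 1 keeps
    the integrand nonnegative, so that its improper integral is read off from the limit at infinity
    before anything is known to be integrable; the cosine part is separated afterwards. *)
Let expcos_prim (e t s : R) : R :=
  - e^-1 * expR (- e * s) +
  expR (- e * s) * ((e ^+ 2 + t ^+ 2)^-1 * (t * sin (t * s) + - e * cos (t * s))).

Let expcos_prim_der (e t s : R) : 0 < e ->
  is_derive s 1 (expcos_prim e t) (expR (- e * s) * (1 + cos (t * s))).
Proof.
move=> e0.
have dl c : is_derive s 1 (fun s => c * s) (c * 1) by apply: isd_scale; exact: isd_id.
have dE : is_derive s 1 (fun s => expR (- e * s)) (expR (- e * s) * (- e * 1)).
  by apply: (isd_comp (f := expR)) (dl _); exact: is_derive_expR.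
have dS : is_derive s 1 (fun s => sin (t * s)) (cos (t * s) * (t * 1)).
  by apply: (isd_comp (f := sin)) (dl _); exact: is_derive_sin.
have dC : is_derive s 1 (fun s => cos (t * s)) (- sin (t * s) * (t * 1)).
  by apply: (isd_comp (f := cos)) (dl _); exact: is_derive_cos.
apply: (is_derive_eq (isd_add (isd_scale _ dE) (isd_mul dE
  (isd_scale _ (isd_add (isd_scale _ dS) (isd_scale _ dC)))))).
field; apply/andP; split; rewrite gt_eqF//; exact: sqrD_gt0.
Qed.

Let cvg_expN (e : R) : 0 < e -> expR (- e * s) @[s --> +oo] --> (0 : R).
Proof.
move=> e0; have H : e * s @[s --> +oo] --> +oo.
  by apply: gt0_cvgMry => //; exact: cvg_id.
have := cvg_comp _ _ H (@cvgr_expR R).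
by apply: cvg_trans; apply: near_eq_cvg; near=> s; rewrite /= mulNr.
Unshelve. all: end_near. Qed.

Let expcos_prim_cvg (e t : R) : 0 < e -> expcos_prim e t s @[s --> +oo] --> (0 : R).
Proof.
move=> e0.
have [M HM] : exists M, forall s, `|- e^-1 + (e ^+ 2 + t ^+ 2)^-1 *
    (t * sin (t * s) + - e * cos (t * s))| <= M.
  exists (e^-1 + (e ^+ 2 + t ^+ 2)^-1 * (`|t| + e)) => s.
  have eV0 : 0 < e^-1 by rewrite invr_gt0.
  have q0 : 0 < (e ^+ 2 + t ^+ 2)^-1 by rewrite invr_gt0 sqrD_gt0.
  rewrite (le_trans (ler_normD _ _))// normrN gtr0_norm//.
  rewrite lerD2l normrM gtr0_norm// ler_pM2l//.
  rewrite (le_trans (ler_normD _ _))// !normrM normrN (gtr0_norm e0).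
  apply: lerD; first by rewrite ler_piMr// sin_max.
  by rewrite ler_piMr ?cos_max// ltW.
have L : M * expR (- e * s) @[s --> +oo] --> (0 : R).
  by rewrite -(mulr0 M); apply: cvgM; [exact: cvg_cst|exact: cvg_expN].
apply: norm_cvg0; apply: (squeeze_cvgr _ (cvg_cst 0) L).
near=> s; rewrite normr_ge0 /=.
have -> : expcos_prim e t s = (- e^-1 + (e ^+ 2 + t ^+ 2)^-1 *
    (t * sin (t * s) + - e * cos (t * s))) * expR (- e * s).
  by rewrite /expcos_prim; ring.
by rewrite normrM (ger0_norm (expR_ge0 _)) ler_wpM2r ?expR_ge0.
Unshelve. all: end_near. Qed.

Lemma continuous_expN (e : R) : continuous (fun s : R => expR (- e * `|s|)).
Proof.
move=> s; apply: continuous_comp; last exact: continuous_expR.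
by apply: cvgM; [exact: cvg_cst|exact: norm_continuous].
Qed.

Lemma continuous_expcos (e t : R) :
  continuous (fun s : R => expR (- e * `|s|) * (1 + cos (t * s))).
Proof.
move=> s; apply: cvgM; first exact: continuous_expN.
apply: cvgD; first exact: cvg_cst.
apply: continuous_cvg; first exact: continuous_cos.
by apply: cvgM; [exact: cvg_cst|exact: cvg_id].
Qed.

Let int_expcos (e t : R) : 0 < e ->
  (\int[leb]_s (expR (- e * `|s|) * (1 + cos (t * s)))%:E =
   (2 / e + cauchy e t)%:E)%E.
Proof.
move=> e0.
have c1 s : 0 <= 1 + cos (t * s) :> R by have := cos_geN1 (t * s); lra.
rewrite ge0_symfun_integralT; first last.
- by move=> s /=; rewrite normrN mulrN cosN.
- exact: continuous_expcos.
- by move=> s; rewrite mulr_ge0// expR_ge0.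
rewrite (_ : [set x | _] = `[0, +oo[%classic); last first.
  by apply/seteqP; split => x/=; rewrite in_itv/= andbT.
rewrite (@ge0_continuous_FTC2y _ _ (expcos_prim e t) 0 0).
- rewrite -EFinB -EFinM /expcos_prim /cauchy !mulr0 expR0 sin0 cos0.
  by congr EFin; field; apply/andP; split; rewrite gt_eqF//; exact: sqrD_gt0.
- by move=> s _; rewrite mulr_ge0// expR_ge0.
- by apply: continuous_subspaceT; exact: continuous_expcos.
- exact: expcos_prim_cvg.
- by move=> s _; exact: der_derivable (expcos_prim_der _ _ e0).
- apply: cvg_at_right_filter.
  exact: (der_continuous (fun s => expcos_prim_der t s e0)).
- move=> s; rewrite in_itv/= andbT => s0.
  by rewrite (der_derive1 (expcos_prim_der _ _ e0)) gtr0_norm.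
Qed.

Lemma intble_expN (e : R) : 0 < e ->
  leb.-integrable setT (EFin \o (fun s : R => expR (- e * `|s|))).
Proof.
move=> e0; have E : (fun s : R => expR (- e * `|s|)) =
    (fun s => 2^-1 * (expR (- e * `|s|) * (1 + cos (0 * s)))).
  by apply/funext => s; rewrite mul0r cos0; field.
rewrite E; apply: intbleZ; apply: intble_ge0.
- by apply: continuous_measurable_fun; exact: continuous_expcos.
- by move=> s; rewrite mul0r cos0 mulr_ge0 ?expR_ge0.
- by rewrite int_expcos// ltry.
Qed.

Lemma Rint_expN_cos (e t : R) : 0 < e ->
  \int[leb]_s (cos (t * s) * expR (- e * `|s|)) = cauchy e t.
Proof.
move=> e0.
have H u : \int[leb]_s (expR (- e * `|s|) * (1 + cos (u * s))) = 2 / e + cauchy e u.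
  by rewrite /Rintegral int_expcos.
have Ei := intble_expN e0.
have Eci u := @intble_cosM _ _ _ leb id _ (@measurable_id _ _ setT) Ei u.
have D u : \int[leb]_s (expR (- e * `|s|) * (1 + cos (u * s))) =
    \int[leb]_s expR (- e * `|s|) + \int[leb]_s (cos (u * s) * expR (- e * `|s|)).
  have <- := RintegralD measurableT Ei (Eci u).
  by apply: eq_Rintegral => s _; rewrite mulrDr mulr1 (mulrC (expR _)).
(* At frequency 0 the cosine is 1, so the two summands of [D] coincide and their sum [4 / e]
   determines each of them. *)
have E0 : \int[leb]_s expR (- e * `|s|) = 2 / e.
  have := D 0; rewrite H.
  under [in X in _ = _ + X -> _]eq_Rintegral do rewrite mul0r cos0 mul1r.
  rewrite /cauchy => h.
  have h' : 2 / e + 2 * e / (e ^+ 2 + 0 ^+ 2) = 2 * (2 / e).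
    by field; rewrite gt_eqF.
  apply: (@mulfI _ (2 : R)); first by rewrite pnatr_eq0.
  by rewrite -h' h mulr_natl mulr2n.
by have := D t; rewrite H E0 => /addrI ->.
Qed.

End CauchyKernel.

(** * Weak Fourier inversion and Plancherel's inequality for cosine transforms *)

Section Inversion.
Context {R : realType}.
Local Notation leb := (@lebesgue_measure R).
Local Notation intble f := (leb.-integrable setT (EFin \o f)).
Local Notation cosT f := (cos_transform leb idfun f).

(* Damping makes the inversion integrals absolutely convergent; the cosine
   transform of the damping factor is the Cauchy kernel, an approximate identity. *)
Let damp (n : nat) (s : R) : R := expR (- n.+1%:R^-1 * `|s|).

Let damp_ge0 n s : 0 <= damp n s. Proof. exact: expR_ge0. Qed.

Let damp_le1 n s : damp n s <= 1.
Proof. by rewrite -expR0 ler_expR mulNr oppr_le0 mulr_ge0. Qed.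

Let cvg_invS : (n.+1%:R^-1 : R) @[n --> \oo] --> (0 : R).
Proof.
exact: cvg_harmonic.
Qed.

Let cvg_damp s : damp n s @[n --> \oo] --> (1 : R).
Proof.
rewrite -expR0; apply: continuous_cvg; first exact: continuous_expR.
rewrite -[X in _ --> X](mul0r `|s|) -[X in X * _](@oppr0 R).
by apply: cvgM; [apply: cvgN; exact: cvg_invS|exact: cvg_cst].
Qed.

Let intble_damp n : intble (damp n).
Proof. exact: intble_expN. Qed.

Let measurable_id' :
  measurable_fun [set: measurableTypeR R] (idfun : measurableTypeR R -> R).
Proof. exact: measurable_id. Qed.

Let meas_cos2 : measurable_fun setT (fun z : R * R => cos (z.1 * z.2)).
Proof.
apply: (measurableT_comp (continuous_measurable_fun (@continuous_cos R))).
exact: measurable_funM.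
Qed.

Lemma measurable_cauchy_sub (e : R) : 0 < e ->
  measurable_fun setT (fun z : R * R => cauchy e (z.1 - z.2)).
Proof.
move=> e0; apply: (measurableT_comp (measurable_cauchy e0)).
exact: measurable_funB.
Qed.

Lemma measurable_cauchy_add (e : R) : 0 < e ->
  measurable_fun setT (fun z : R * R => cauchy e (z.1 + z.2)).
Proof.
move=> e0; apply: (measurableT_comp (measurable_cauchy e0)).
exact: measurable_funD.
Qed.

Let normM3_le (x c y b : R) : `|c| <= b -> `|x * c * y| <= b * `|y| * `|x|.
Proof.
move=> cb; rewrite !normrM.
have -> : `|x| * `|c| * `|y| = `|c| * (`|y| * `|x|) by ring.
by rewrite -mulrA ler_wpM2r// mulr_ge0.
Qed.

Let normM3_le1 (x c y : R) : `|x| <= 1 -> `|y| <= 1 -> `|x * c * y| <= `|c|.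
Proof.
move=> x1 y1; rewrite !normrM (mulrC `|x|) -mulrA ler_piMr//.
exact: mulr_ile1.
Qed.

Let normM3_ler (x c y b : R) : `|c| <= b -> `|x * y * c| <= b * `|x| * `|y|.
Proof.
move=> cb; rewrite !normrM.
have -> : `|x| * `|y| * `|c| = `|c| * (`|x| * `|y|) by ring.
by rewrite -mulrA ler_wpM2r// mulr_ge0.
Qed.

Section inversion.
Variables (K g : R -> R) (M : R).
Hypotheses (Ki : intble K) (Ke : forall t, K (- t) = K t) (gi : intble g).
Hypotheses (ki : intble (cosT K)) (gM : forall t, `|g t| <= M) (gc : continuous g).

Let cos_cosT t s : cos (t * s) * cosT K s = \int[leb]_u (cos ((t - u) * s) * K u).
Proof.
have Kcos := intble_cosM measurable_id' Ki s.
have msin : measurable_fun setT (fun u => sin (s * u)).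
  apply: (measurableT_comp (continuous_measurable_fun (@continuous_sin R))).
  exact: measurable_funM.
have Ksin : intble (fun u => sin (s * u) * K u).
  apply: (@intble_le _ _ _ leb _ (fun w => `|K w|)); last exact: intble_norm.
    by apply: measurable_funM => //; exact: intble_meas Ki.
  by move=> w; rewrite normrM ler_piMl// sin_max.
have -> : \int[leb]_u (cos ((t - u) * s) * K u) =
   \int[leb]_u (cos (t * s) * (cos (s * u) * K u) + sin (t * s) * (sin (s * u) * K u)).
  by apply: eq_Rintegral => u _; rewrite mulrBl (mulrC u) cosB; ring.
have := RintegralD measurableT (intbleZ (cos (t * s)) Kcos) (intbleZ (sin (t * s)) Ksin).
move=> /= ->; rewrite (RintegralZl _ measurableT Kcos) (RintegralZl _ measurableT Ksin).
(* The addition formula leaves a sine transform, which vanishes because [K] is even. *)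
rewrite [X in _ + _ * X]Rint_odd ?mulr0 ?addr0//.
by move=> u; rewrite mulrN sinN Ke mulNr.
Qed.

(** Multiplication by [cos (t * s)] amounts to a translation of [K]; after the interchange of
    integrals the transform acts on the damping factor alone, which is where the Cauchy kernel comes
    from. *)
Let damped n t : \int[leb]_s (cos (t * s) * cosT K s * damp n s) =
  \int[leb]_u (K u * cauchy n.+1%:R^-1 (t - u)).
Proof.
transitivity (\int[leb]_s \int[leb]_u (cos ((t - u) * s) * K u * damp n s)).
  apply: eq_Rintegral => s _; rewrite cos_cosT -RintegralZr//.
  apply: (@intble_le _ _ _ leb _ (fun w => `|K w|)); last exact: intble_norm.
    apply: measurable_funM; last exact: intble_meas Ki.
    apply: (measurableT_comp (continuous_measurable_fun (@continuous_cos R))).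
    by apply: measurable_funM => //; exact: measurable_funB.
  by move=> w; rewrite normrM ler_piMl// cos_max.
rewrite (Rfubini_dom (m1 := leb) (m2 := leb) (F := fun z => cos ((t - z.2) * z.1) * K z.2 * damp n z.1)
  (g := damp n) (h := fun u => `|K u|)) //=; last 3 first.
- apply: measurable_funM.
    apply: measurable_funM; last exact: (measurableT_comp (intble_meas Ki)).
    apply: (measurableT_comp (continuous_measurable_fun (@continuous_cos R))).
    by apply: measurable_funM => //; exact: measurable_funB.
  exact: (measurableT_comp (intble_meas (intble_damp n))).
- move=> s u; rewrite !normrM (ger0_norm (damp_ge0 _ _)) mulrC ler_wpM2l//.
  by rewrite ler_piMl// cos_max.
- exact: intble_norm.
apply: eq_Rintegral => u _.
rewrite -(Rint_expN_cos (e := n.+1%:R^-1)) // -RintegralZl//.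
  by apply: eq_Rintegral => s _; rewrite mulrAC mulrC.
exact: (intble_cosM measurable_id' (intble_damp n)).
Qed.

Let damped_pairing n : \int[leb]_t (\int[leb]_s (cos (t * s) * cosT K s * damp n s) * g t) =
  \int[leb]_u \int[leb]_t (K u * cauchy n.+1%:R^-1 (t - u) * g t).
Proof.
have e0 : 0 < n.+1%:R^-1 :> R by rewrite invr_gt0.
transitivity (\int[leb]_t \int[leb]_u (K u * cauchy n.+1%:R^-1 (t - u) * g t)).
  apply: eq_Rintegral => t _; rewrite damped -RintegralZr//.
  apply: (intbleM (M := 2 / n.+1%:R^-1)) => //.
    apply: (measurableT_comp (measurable_cauchy e0)).
    exact: measurable_funB.
  by move=> u; rewrite ger0_norm ?cauchy_ge0// cauchy_le.
apply: (Rfubini_dom (m1 := leb) (m2 := leb) (F := fun z => K z.2 * cauchy n.+1%:R^-1 (z.1 - z.2) * g z.1)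
  (g := fun t => 2 / n.+1%:R^-1 * `|g t|) (h := fun u => `|K u|)) => //=.
- apply: measurable_funM; last exact: (measurableT_comp (intble_meas gi)).
  apply: measurable_funM; first exact: (measurableT_comp (intble_meas Ki)).
  exact: measurable_cauchy_sub.
- move=> t u; apply: normM3_le.
  by rewrite ger0_norm ?cauchy_ge0// cauchy_le.
- exact/intbleZ/intble_norm.
- exact: intble_norm.
Qed.

(** Substituting [t = u + z / n.+1] trades a kernel that concentrates as [n] grows for the fixed
    weight [2 / (1 + z ^ 2)], which then dominates uniformly in [n]. *)
Let pairing_scaled n u : \int[leb]_t (K u * cauchy n.+1%:R^-1 (t - u) * g t) =
  K u * \int[leb]_z (2 * (oneDsqr z)^-1 * g (u + n.+1%:R^-1 * z)).
Proof.
have e0 : 0 < n.+1%:R^-1 :> R by rewrite invr_gt0.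
have Fi : intble (fun t => g t * cauchy n.+1%:R^-1 (t - u)).
  apply: (intbleM (M := 2 / n.+1%:R^-1)) => //.
    apply: (measurableT_comp (measurable_cauchy e0)).
    exact: measurable_funB.
  by move=> t; rewrite ger0_norm ?cauchy_ge0// cauchy_le.
rewrite -[RHS]mulr1; transitivity (K u * \int[leb]_t (g t * cauchy n.+1%:R^-1 (t - u))).
  rewrite -RintegralZl//; apply: eq_Rintegral => t _; ring.
rewrite mulr1; congr (_ * _).
have eN0 : n.+1%:R^-1 != 0 :> R by rewrite gt_eqF.
rewrite (Rint_affine u eN0 Fi) gtr0_norm// -RintegralZl//; last exact: (intble_affine u eN0 Fi).
apply: eq_Rintegral => z _; rewrite -(cauchy_scaled z e0).
rewrite (_ : u + _ - u = n.+1%:R^-1 * z); ring.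
Qed.

(** Both sides are limits of the damped pairings: on the transform side because the transform of [K]
    is integrable, on the other side because [g] is bounded and continuous along an approximate
    identity. Nothing is claimed at a single point, since [K] may differ from its inverse transform
    on a null set. *)
Lemma cos_inversion :
  \int[leb]_t (cosT (cosT K) t * g t) = 2 * pi * \int[leb]_t (K t * g t).
Proof.
have mK := intble_meas Ki; have mg := intble_meas gi; have mk := intble_meas ki.
have C1 : \int[leb]_t (\int[leb]_s (cos (t * s) * cosT K s * damp n s) * g t)
   @[n --> \oo] --> \int[leb]_t (cosT (cosT K) t * g t).
  apply: (Rint_cvg (mu := leb) (g := fun t => \int[leb]_s `|cosT K s| * `|g t|)) => [n|t|n t|].
  - apply: measurable_funM => //.
    have -> : (fun t => \int[leb]_s (cos (t * s) * cosT K s * damp n s)) =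
        cosT (fun s => cosT K s * damp n s).
      by apply/funext => t; apply: eq_Rintegral => s _; rewrite mulrA.
    apply: measurable_cos_transform => //; apply: (intbleM (M := 1)) => //.
      exact: intble_meas (intble_damp n).
    by move=> s; rewrite ger0_norm ?damp_ge0 ?damp_le1.
  - apply: cvgM; last exact: cvg_cst.
    apply: (Rint_cvg (mu := leb) (g := fun s => `|cosT K s|)) => [n|s|n s|].
    + apply: measurable_funM; last exact: intble_meas (intble_damp n).
      by apply: measurable_funM => //; exact: (measurable_cosM measurable_id').
    + rewrite -[X in _ --> X]mulr1; apply: cvgM; [exact: cvg_cst|exact: cvg_damp].
    + by apply: normM3_le1; rewrite ?cos_max// ger0_norm.
    + exact: intble_norm.
  - rewrite normrM ler_wpM2r//; apply: Rint_le_norm.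
    + have := @intble_cosM _ _ _ leb _ (fun s => cosT K s * damp n s) measurable_id' _ t.
      move=> H; apply: (intble_eq _ (H _)) => [s /=|]; first by rewrite mulrA.
      apply: (intbleM (M := 1)) => //; first exact: intble_meas (intble_damp n).
      by move=> s; rewrite ger0_norm ?damp_ge0 ?damp_le1.
    + exact: intble_norm.
    + by move=> s; apply: normM3_le1; rewrite ?cos_max// ger0_norm.
  - exact/intbleZ/intble_norm.
have C2 : \int[leb]_u \int[leb]_t (K u * cauchy n.+1%:R^-1 (t - u) * g t) @[n --> \oo]
    --> \int[leb]_u (K u * (2 * pi * g u)).
  apply: (Rint_cvg (mu := leb) (g := fun u => 2 * pi * M * `|K u|)) => [n|u|n u|].
  - have e0 : 0 < n.+1%:R^-1 :> R by rewrite invr_gt0.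
    apply: intble_meas.
    apply: (intble_Rint2 (m1 := leb) (m2 := leb) (F := fun z => K z.2 * cauchy n.+1%:R^-1 (z.1 - z.2) * g z.1)
      (g := fun t => 2 / n.+1%:R^-1 * `|g t|) (h := fun u => `|K u|)) => //=.
    + apply: measurable_funM; last exact: (measurableT_comp mg).
      apply: measurable_funM; first exact: (measurableT_comp mK).
      exact: measurable_cauchy_sub.
    + move=> t u; apply: normM3_le.
      by rewrite ger0_norm ?cauchy_ge0// cauchy_le.
    + exact/intbleZ/intble_norm.
    + exact: intble_norm.
  - under eq_fun do rewrite pairing_scaled.
    apply: cvgM; first exact: cvg_cst.
    have -> : 2 * pi * g u = \int[leb]_z (2 * g u * (oneDsqr z)^-1).
      by rewrite (RintegralZl _ measurableT intble_oneDsqrV) Rint_oneDsqrV mulrAC.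
    apply: (Rint_cvg (mu := leb) (g := fun z => 2 * M * (oneDsqr z)^-1)) => [n|z|n z|].
    + apply: measurable_funM; last first.
        by apply: (measurableT_comp mg); exact: measurable_affine.
      by apply: measurable_funM => //; exact: intble_meas intble_oneDsqrV.
    + rewrite mulrAC; apply: cvgM; first exact: cvg_cst.
      apply: continuous_cvg; first exact: gc.
      rewrite -[X in _ --> X]addr0; apply: cvgD; first exact: cvg_cst.
      by rewrite -(mul0r z); apply: cvgM; [exact: cvg_invS|exact: cvg_cst].
    + rewrite normrM mulrAC ger0_norm; last first.
        by rewrite mulr_ge0// invr_ge0 ltW// oneDsqr_pos.
      by rewrite ler_wpM2l// mulr_ge0// invr_ge0 ltW// oneDsqr_pos.
    + by apply: intbleZ; exact: intble_oneDsqrV.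
  - rewrite pairing_scaled normrM mulrC ler_wpM2r//.
    have -> : 2 * pi * M = \int[leb]_z (2 * M * (oneDsqr z)^-1).
      by rewrite (RintegralZl _ measurableT intble_oneDsqrV) Rint_oneDsqrV mulrAC.
    have oi := intbleZ 2 intble_oneDsqrV.
    apply: Rint_le_norm.
    + apply: (intbleM (M := M)) => //.
      by apply: (measurableT_comp mg); exact: measurable_affine.
    + by apply: intbleZ; exact: intble_oneDsqrV.
    + move=> z; rewrite normrM mulrAC ger0_norm; last first.
        by rewrite mulr_ge0// invr_ge0 ltW// oneDsqr_pos.
      by rewrite ler_wpM2l// mulr_ge0// invr_ge0 ltW// oneDsqr_pos.
  - exact/intbleZ/intble_norm.
have -> : 2 * pi * \int[leb]_t (K t * g t) = \int[leb]_u (K u * (2 * pi * g u)).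
  rewrite -RintegralZl//; last by apply: (intbleM (M := M)).
  by apply: eq_Rintegral => u _; rewrite mulrCA.
apply: (cvg_unique _ C1); first exact: norm_hausdorff.
by move: C2; under eq_fun do rewrite -damped_pairing.
Qed.

End inversion.

Section plancherel.
Variables (a : R -> R) (B : R).
Hypotheses (ai : intble a) (aB : forall s, `|a s| <= B).

(* The integral of cos (t * s) * cos (t * s') * damp n t over t.  It is a
   nonnegative symmetric kernel of mass 2 * pi, so that Schur's test bounds the
   damped square of the transform of a. *)
Let k n (s s' : R) : R :=
  2^-1 * (cauchy n.+1%:R^-1 (s - s') + cauchy n.+1%:R^-1 (s + s')).

Let kC n s s' : k n s s' = k n s' s.
Proof. by rewrite /k -opprB cauchyN (addrC s). Qed.

Let k_ge0 n s s' : 0 <= k n s s'.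
Proof.
have e0 : 0 < n.+1%:R^-1 :> R by rewrite invr_gt0.
by rewrite /k mulr_ge0// addr_ge0// cauchy_ge0.
Qed.

Let k_le n s s' : k n s s' <= 2 / n.+1%:R^-1.
Proof.
have e0 : 0 < n.+1%:R^-1 :> R by rewrite invr_gt0.
by have := cauchy_le (s - s') e0; have := cauchy_le (s + s') e0; rewrite /k; lra.
Qed.

Let k_intble n s : intble (k n s).
Proof.
have e0 : 0 < n.+1%:R^-1 :> R by rewrite invr_gt0.
apply: intbleZ; apply: intbleD; first by have [] := Rint_cauchy_shift s e0.
have [H _] := Rint_cauchy_shift (- s) e0.
by apply: intble_eq H => z; rewrite -opprD cauchyN.
Qed.

Let k_int n s : \int[leb]_s' k n s s' = 2 * pi.
Proof.
have e0 : 0 < n.+1%:R^-1 :> R by rewrite invr_gt0.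
have [H1 E1] := Rint_cauchy_shift s e0.
have [H2 E2] := Rint_cauchy_shift (- s) e0.
have H2' : intble (fun z => cauchy n.+1%:R^-1 (s + z)).
  by apply: intble_eq H2 => z; rewrite -opprD cauchyN.
rewrite RintegralZl//; last exact: intbleD.
rewrite RintegralD// E1.
under [X in _ + X]eq_Rintegral do rewrite -cauchyN opprD.
by rewrite E2; field.
Qed.

Let mk n : measurable_fun setT (fun z : R * R => k n z.1 z.2).
Proof.
have e0 : 0 < n.+1%:R^-1 :> R by rewrite invr_gt0.
apply: measurable_funM => //; apply: measurable_funD.
  exact: measurable_cauchy_sub.
exact: measurable_cauchy_add.
Qed.

Let mks n s : measurable_fun setT (k n s).
Proof. exact: intble_meas (k_intble n s). Qed.

Let ma : measurable_fun setT a. Proof. exact: intble_meas ai. Qed.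

Let a2i : intble (fun s => a s ^+ 2).
Proof. by under eq_fun do rewrite expr2; exact: (intbleM (M := B)). Qed.

Let F n (z : R * R) := a z.1 ^+ 2 * k n z.1 z.2.

(** A uniform bound on [k n] does not make [F n] integrable over the plane; the finite mass [2 * pi]
    in the second variable does, by Tonelli. *)
Let Fi n : (leb \x leb)%E.-integrable setT (EFin \o F n).
Proof.
have mF : measurable_fun setT (EFin \o F n).
  apply/measurable_EFinP; apply: measurable_funM; last exact: mk.
  by apply: measurable_funX; exact: (measurableT_comp ma).
apply/(@integrable12ltyP _ _ (measurableTypeR R) (measurableTypeR R) R leb leb _ mF) => /=.
under eq_integral => s _.
  under eq_integral => s' _ do
    rewrite /F /= normrM (ger0_norm (sqr_ge0 _)) (ger0_norm (k_ge0 _ _ _)).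
  rewrite -EFin_Rint; last by apply: intbleZ; exact: k_intble.
  rewrite (RintegralZl _ measurableT (k_intble n s)) k_int.
  over.
apply: integrable_lty => //.
by under [X in _.-integrable _ X]eq_fun do rewrite mulrC; exact: intbleZ.
Qed.

Let F_iter n : \int[leb]_s \int[leb]_s' F n (s, s') = 2 * pi * \int[leb]_s a s ^+ 2.
Proof.
rewrite -RintegralZl//; apply: eq_Rintegral => s _.
have := RintegralZl (a s ^+ 2) measurableT (k_intble n s).
by rewrite k_int mulrC => ->.
Qed.

(** By symmetry of [k n] the square of [a] can be attached to either variable with the same total,
    as Schur's test requires. *)
Let F_iter' n : intble (fun s => \int[leb]_s' (a s' ^+ 2 * k n s s')) /\
  \int[leb]_s \int[leb]_s' (a s' ^+ 2 * k n s s') = 2 * pi * \int[leb]_s a s ^+ 2.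
Proof.
have Fs1 s : intble (fun s' => F n (s, s')) by exact: (intbleZ (a s ^+ 2) (k_intble n s)).
have Fs2 s : intble (fun s' => F n (s', s)).
  apply: (intbleM (M := 2 / n.+1%:R^-1)) => //.
    exact: (measurableT_comp (mk n)).
  by move=> s'; rewrite ger0_norm ?k_ge0 ?k_le.
have [I2 E2] := Rint_prod2 (Fi n) Fs2.
have [_ E1] := Rint_prod1 (Fi n) Fs1.
have EF s : \int[leb]_s' (a s' ^+ 2 * k n s s') = \int[leb]_s' F n (s', s).
  by apply: eq_Rintegral => s' _; rewrite kC.
split; first by apply: intble_eq I2 => s; rewrite EF.
by rewrite -(F_iter n) E1 -E2; apply: eq_Rintegral => s _; rewrite EF.
Qed.

Let Ac : continuous (cosT a).
Proof. exact: continuous_cos_transform. Qed.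

Let AB s : `|cosT a s| <= \int[leb]_w `|a w|.
Proof. exact: cos_transform_bound. Qed.

Let A2damp n : intble (fun t => cosT a t ^+ 2 * damp n t).
Proof.
apply: (intble_eq (mu := leb) (f := fun t => damp n t * cosT a t ^+ 2)).
  by move=> t; rewrite mulrC.
apply: (intbleM (M := (\int[leb]_w `|a w|) ^+ 2)) => //.
  by apply: measurable_funX; exact: continuous_measurable_fun.
by move=> t; rewrite normrX lerXn2r// nnegrE Rintegral_ge0.
Qed.

(** The square is opened one factor at a time, each by an interchange of integrals: what is not
    being expanded stays bounded, and the damping keeps the product integrable in [t]. *)
Let damped_square n : \int[leb]_t (cosT a t ^+ 2 * damp n t) =
  \int[leb]_s \int[leb]_s' (a s * a s' * k n s s').
Proof.
have mdamp := intble_meas (intble_damp n).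
have mA : measurable_fun setT (cosT a) by exact: continuous_measurable_fun.
have Adi : intble (fun t => cosT a t * damp n t).
  apply: (intble_eq (mu := leb) (f := fun t => damp n t * cosT a t)) => [t|].
    by rewrite mulrC.
  exact: (intbleM (M := \int[leb]_w `|a w|)).
transitivity (\int[leb]_t \int[leb]_s (cos (t * s) * a s * (cosT a t * damp n t))).
  apply: eq_Rintegral => t _; rewrite expr2 -mulrA {1}/cos_transform -RintegralZr//.
  exact: intble_cosM.
transitivity (\int[leb]_s \int[leb]_t (cos (t * s) * a s * (cosT a t * damp n t))).
  apply: (Rfubini_dom (m1 := leb) (m2 := leb)
    (F := fun z => cos (z.1 * z.2) * a z.2 * (cosT a z.1 * damp n z.1))
    (g := fun t => `|cosT a t * damp n t|) (h := fun s => `|a s|)) => /=.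
- apply: measurable_funM; last exact: (measurableT_comp (intble_meas Adi)).
  by apply: measurable_funM; [exact: meas_cos2|exact: (measurableT_comp ma)].
- by move=> t s; rewrite normrM mulrC ler_wpM2l// normrM ler_piMl// cos_max.
- exact: intble_norm.
- exact: intble_norm.
apply: eq_Rintegral => s _.
transitivity (a s * \int[leb]_t (cos (t * s) * cosT a t * damp n t)).
  rewrite -RintegralZl//; first by apply: eq_Rintegral => t _; ring.
  apply: (@intble_le _ _ _ leb _ (fun t => `|cosT a t * damp n t|)); last exact: intble_norm.
    apply: measurable_funM => //; apply: measurable_funM => //.
    apply: (measurableT_comp (continuous_measurable_fun (@continuous_cos R))).
    exact: measurable_funM.
  by move=> t; rewrite -mulrA normrM ler_piMl// cos_max.
have ks : intble (fun s' => a s' * k n s s').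
  apply: (intbleM (M := 2 / n.+1%:R^-1)) => //; first exact: mks.
  by move=> s'; rewrite ger0_norm ?k_ge0 ?k_le.
transitivity (a s * \int[leb]_s' (a s' * k n s s')); last first.
  by rewrite -RintegralZl//; apply: eq_Rintegral => s' _; rewrite mulrA.
congr (_ * _).
transitivity (\int[leb]_t \int[leb]_s' (cos (t * s') * a s' * (cos (t * s) * damp n t))).
  apply: eq_Rintegral => t _; rewrite -mulrA mulrCA {1}/cos_transform -RintegralZr//.
  exact: intble_cosM.
transitivity (\int[leb]_s' \int[leb]_t (cos (t * s') * a s' * (cos (t * s) * damp n t))).
  apply: (Rfubini_dom (m1 := leb) (m2 := leb)
    (F := fun z => cos (z.1 * z.2) * a z.2 * (cos (z.1 * s) * damp n z.1))
    (g := damp n) (h := fun s => `|a s|)) => /=.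
- apply: measurable_funM; last first.
    apply: measurable_funM; last exact: (measurableT_comp mdamp).
    apply: (measurableT_comp (continuous_measurable_fun (@continuous_cos R))).
    exact: measurable_funM.
  by apply: measurable_funM; [exact: meas_cos2|exact: (measurableT_comp ma)].
- move=> t s'; rewrite normrM mulrC; apply: ler_pM => //.
    by rewrite normrM (ger0_norm (damp_ge0 _ _)) ler_piMl ?cos_max.
  by rewrite normrM ler_piMl// cos_max.
- exact: intble_damp.
- exact: intble_norm.
apply: eq_Rintegral => s' _.
have ci u := intble_cosM measurable_id' (intble_damp n) u.
have e0 : 0 < n.+1%:R^-1 :> R by rewrite invr_gt0.
rewrite /k -!(Rint_expN_cos (e := n.+1%:R^-1))//.
have <- := RintegralD measurableT (ci (s - s')) (ci (s + s')).
have cci := intbleD (ci (s - s')) (ci (s + s')).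
have <- := RintegralZl 2^-1 measurableT cci.
have cci2 := intbleZ 2^-1 cci.
have <- := RintegralZl (a s') measurableT cci2.
apply: eq_Rintegral => t _ /=.
by rewrite mulrBl mulrDl cosB cosD !(mulrC _ t); field.
Qed.

(** Stated in the extended reals because finiteness of the left-hand side is part of the claim;
    [intble_dkernel2] relies on it. The damped squares are bounded uniformly in [n], and since the
    damping factor increases to 1, monotone convergence carries the bound to the limit. *)
Lemma cos_plancherel_le :
  (\int[leb]_t (cosT a t ^+ 2)%:E <= (2 * pi * \int[leb]_s a s ^+ 2)%:E)%E.
Proof.
have bound n : \int[leb]_t (cosT a t ^+ 2 * damp n t) <= 2 * pi * \int[leb]_s a s ^+ 2.
  have [I' E'] := F_iter' n.
  have I1 : intble (fun s => \int[leb]_s' F n (s, s')).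
    apply: (intble_eq (mu := leb) (f := fun s => 2 * pi * a s ^+ 2)); last exact: intbleZ.
    move=> s; have := RintegralZl (a s ^+ 2) measurableT (k_intble n s).
    by rewrite k_int mulrC => ->.
  have ks s : intble (fun s' => a s' * k n s s').
    apply: (intbleM (M := 2 / n.+1%:R^-1)) => //.
      exact: mks.
    by move=> s'; rewrite ger0_norm ?k_ge0 ?k_le.
  have k2 s : intble (fun s' => a s' ^+ 2 * k n s s').
    apply: (intbleM (M := 2 / n.+1%:R^-1)) => //.
      exact: mks.
    by move=> s'; rewrite ger0_norm ?k_ge0 ?k_le.
  have kk s : intble (fun s' => a s * a s' * k n s s').
    by apply: intble_eq (intbleZ (a s) (ks s)) => s'; rewrite mulrA.
  rewrite damped_square.
  have -> : 2 * pi * \int[leb]_s a s ^+ 2 = \int[leb]_s (2^-1 *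
      (\int[leb]_s' F n (s, s') + \int[leb]_s' (a s' ^+ 2 * k n s s'))).
    rewrite RintegralZl//; last exact: intbleD.
    by rewrite RintegralD// E' F_iter; field.
  apply: le_Rintegral => //.
  - have dom := intble_Rint1 (m1 := leb) (m2 := leb) (F := fun z => a z.1 * a z.2 * k n z.1 z.2)
      (g := fun s => 2 / n.+1%:R^-1 * `|a s|) (h := fun s => `|a s|).
    apply: dom.
    + apply: measurable_funM; last exact: mk.
      by apply: measurable_funM; exact: (measurableT_comp ma).
    + by move=> s s'; apply: normM3_ler; rewrite ger0_norm ?k_ge0 ?k_le.
    + exact/intbleZ/intble_norm.
    + exact: intble_norm.
  - by apply: intbleZ; exact: intbleD.
  - move=> s _; have Fsi : intble (fun s' => F n (s, s')).
      exact: (intbleZ (a s ^+ 2) (k_intble n s)).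
    rewrite -RintegralD// -RintegralZl//; last exact: intbleD.
    apply: le_Rintegral => //; first by apply: intbleZ; exact: intbleD.
    move=> s' _; rewrite /F /=.
    have := k_ge0 n s s'; have := sqr_ge0 (a s - a s').
    set q := k n s s'; move=> h1 h2.
    (* Schur's test: twice the product [a s * a s'] is at most the sum of the squares, here weighted
       by the nonnegative kernel. *)
    suff : 0 <= (a s - a s') ^+ 2 * q by nra.
    exact: mulr_ge0.
have mA : measurable_fun setT (cosT a) by exact: continuous_measurable_fun.
have mon := @cvg_monotone_convergence _ _ _ leb setT measurableT
  (fun n t => (cosT a t ^+ 2 * damp n t)%:E).
have {mon} : (\int[leb]_t (cosT a t ^+ 2 * damp n t)%:E)%E @[n --> \oo] -->
    (\int[leb]_t (cosT a t ^+ 2)%:E)%E.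
  rewrite [X in _ --> X](_ : _ = (\int[leb]_t
      limn (fun n => (cosT a t ^+ 2 * damp n t)%:E))%E).
    apply: mon.
    - by move=> n; apply/measurable_EFinP; exact: intble_meas (A2damp n).
    - by move=> n t _; rewrite lee_fin mulr_ge0// sqr_ge0.
    - move=> t _ n m nm; rewrite lee_fin ler_wpM2l ?sqr_ge0// ler_expR !mulNr.
      by rewrite lerN2 ler_wpM2r// lef_pV2 ?posrE// ler_nat.
  apply: eq_integral => t _; apply/esym/cvg_lim => //.
  apply: cvg_EFin; first exact: nearW.
  by rewrite -[X in _ --> X]mulr1; apply: cvgM; [exact: cvg_cst|exact: cvg_damp].
move/cvge_to_le; apply; apply: nearW => n.
by rewrite -(EFin_Rint (A2damp n)) lee_fin.
Qed.

End plancherel.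
End Inversion.

(** * Bias of smoothing *)

Section Calculus2.
Context {R : realType}.
Implicit Types f : R -> R -> R.

(** [L] only has to be close to [g2] near [a]: subtracting the corresponding quadratic leaves a
    function [G] whose derivative is small by the mean value theorem for [g1]. Using that theorem
    twice gives [t ^ 2 * m] without the sharp factor one half, which is harmless. *)
Lemma taylor2 (g g1 g2 : R -> R) (a t L m : R) :
  (forall x : R, is_derive x 1 g (g1 x)) ->
  (forall x : R, is_derive x 1 g1 (g2 x)) ->
  (forall c, `|c - a| <= `|t| -> `|g2 c - L| <= m) ->
  `|g (a + t) - g a - t * g1 a - t ^+ 2 / 2 * L| <= t ^+ 2 * m.
Proof.
move=> dg dg1 H.
pose G s := g s + (- g1 a * s + - (L / 2) * ((s - a) * (s - a))).
have dG (s : R) : is_derive s 1 G (g1 s - g1 a - (s - a) * L).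
  have dsa : is_derive s 1 (fun s : R => s - a) (1 + 0).
    exact: (isd_add (isd_id s) (isd_cst (- a) s)).
  have := isd_add (dg s) (isd_add (isd_scale (- g1 a) (isd_id s))
    (isd_scale (- (L / 2)) (isd_mul dsa dsa))).
  by move/is_derive_eq; apply; field.
have [c ca] := MVT_any dG a (a + t).
rewrite (addrC a) addrK in ca *.
have [e ec] := MVT_any dg1 a c.
move=> E1 E2.
have -> : g (t + a) - g a - t * g1 a - t ^+ 2 / 2 * L = G (t + a) - G a.
  by rewrite /G; field.
have -> : G (t + a) - G a = (g2 e - L) * (c - a) * t by rewrite E2 E1; ring.
rewrite (normrM _ t) (normrM _ (c - a)) -(real_normK (num_real t)) expr2.
rewrite (_ : `|t| * `|t| * m = m * `|t| * `|t|); last by ring.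
rewrite ler_wpM2r// ler_pM// H//; exact: le_trans ec ca.
Qed.

Definition smooth_bounded k C f :=
  continuously_differentiable2 k f /\ partials_bounded k C f.

Lemma smooth_boundedS k C f : smooth_bounded k.+1 C f ->
  [/\ forall x y : R, is_derive x 1 (fun u => f u y) (dx f x y),
      forall x y : R, is_derive y 1 (f x) (dy f x y),
      forall x y, `|dx f x y| <= C, forall x y, `|dy f x y| <= C &
      smooth_bounded k C (dx f) /\ smooth_bounded k C (dy f)].
Proof.
move=> [[D c1 c2] [Bd b1 b2]]; split=> [x y|x y|x y|x y|].
- by have [d _] := D x y; exact: derivable_der.
- by have [_ d] := D x y; exact: derivable_der.
- by have [] := Bd x y.
- by have [] := Bd x y.
- by split; split.
Qed.

(* Unfolding partial derivatives during unification is prohibitively slow. *)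
Opaque dx dy.

Lemma lipschitz2 k C f : smooth_bounded k.+1 C f ->
  forall a b a' b', `|f a b - f a' b'| <= C * (`|a - a'| + `|b - b'|).
Proof.
move=> /smooth_boundedS[Dx Dy bx by_ _] a b a' b'.
have -> : f a b - f a' b' = (f a b - f a' b) + (f a' b - f a' b').
  by rewrite addrA subrK.
rewrite (le_trans (ler_normD _ _))// mulrDr lerD//.
  exact: (der_lipschitz (fun x => Dx x b) (fun x => bx x b)).
exact: (der_lipschitz (Dy a') (by_ a')).
Qed.

Lemma smooth_bounded_ge0 k C f : smooth_bounded k.+1 C f -> 0 <= C.
Proof. by move=> /smooth_boundedS[_ _ H _ _]; exact: le_trans (H 0 0). Qed.

(* Both mixed partials are limits of the second difference over a square of
   side t divided by t ^+ 2. *)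
Lemma mixed_partials_eq f (fx fy fxy fyx : R -> R -> R) (C : R) : 0 <= C ->
  (forall x y : R, is_derive x 1 (fun u => f u y) (fx x y)) ->
  (forall x y : R, is_derive y 1 (f x) (fy x y)) ->
  (forall x y : R, is_derive y 1 (fx x) (fxy x y)) ->
  (forall x y : R, is_derive x 1 (fun u => fy u y) (fyx x y)) ->
  (forall a b a' b', `|fxy a b - fxy a' b'| <= C * (`|a - a'| + `|b - b'|)) ->
  (forall a b a' b', `|fyx a b - fyx a' b'| <= C * (`|a - a'| + `|b - b'|)) ->
  forall x y, fxy x y = fyx x y.
Proof.
move=> C0 Dx Dy Dxy Dyx Hxy Hyx x y.
have W (t : R) : 0 < t -> `|fxy x y - fyx x y| <= 4 * C * t.
  move=> t0.
  have d1 (s : R) : is_derive s 1 (fun s => f s (y + t) - f s y) (fx s (y + t) - fx s y).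
    exact: (isd_add (Dx s (y + t)) (isd_opp (Dx s y))).
  have [c cx E1] := MVT_any d1 x (x + t).
  have [e ey E2] := MVT_any (Dxy c) y (y + t).
  have d2 (s : R) : is_derive s 1 (fun s => f (x + t) s - f x s) (fy (x + t) s - fy x s).
    exact: (isd_add (Dy (x + t) s) (isd_opp (Dy x s))).
  have [e' ey' E3] := MVT_any d2 y (y + t).
  have [c' cx' E4] := MVT_any (fun s => Dyx s e') x (x + t).
  rewrite (addrC _ t) addrK in cx ey cx' ey' E1 E2 E3 E4.
  have E : fxy c e = fyx c' e'.
    have t2 : t * t != 0 by rewrite mulf_neq0// gt_eqF.
    have key (a b : R) : a * t * t = b * t * t -> a = b.
      by rewrite -!mulrA; exact: mulIf.
    apply: key.
    have e0 : y + t - y = t by ring.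
    by rewrite e0 in E2 E3; rewrite -E2 -E1 -E4 -E3; ring.
  have L1 := Hxy c e x y.
  have L2 := Hyx c' e' x y.
  have nt : `|t| = t by exact: gtr0_norm.
  have e0 : y + t - y = t by ring.
  rewrite ?e0 nt in cx ey cx' ey'.
  have -> : fxy x y - fyx x y =
    (fyx c' e' - fyx x y) - (fxy c e - fxy x y).
    by rewrite E; ring.
  rewrite (le_trans (ler_normB _ _))//.
  have b1 : C * (`|c - x| + `|e - y|) <= C * (2 * t) by rewrite ler_wpM2l//; lra.
  have b2 : C * (`|c' - x| + `|e' - y|) <= C * (2 * t) by rewrite ler_wpM2l//; lra.
  by rewrite (le_trans (lerD L2 L1))// (le_trans (lerD b2 b1))//; lra.
apply/eqP; rewrite -subr_eq0 -normr_eq0 eq_le normr_ge0 andbT.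
apply/ler_addgt0Pr => e e0; rewrite add0r.
have D0 : 0 < 4 * C + 1 by rewrite ltr_wpDl// mulr_ge0.
have := W (e / (4 * C + 1)) (divr_gt0 e0 D0); move/le_trans; apply.
rewrite mulrA ler_pdivrMr// mulrC ler_pM2l//; lra.
Qed.

(** The third order of smoothness makes the mixed second partials Lipschitz, as [mixed_partials_eq]
    asks. *)
Lemma schwarz k C f : smooth_bounded k.+3 C f ->
  forall x y, dy (dx f) x y = dx (dy f) x y.
Proof.
move=> H; have [Dx Dy _ _ [Hx Hy]] := smooth_boundedS H.
have [_ Dxy _ _ [_ Hxy]] := smooth_boundedS Hx.
have [Dyx _ _ _ [Hyx _]] := smooth_boundedS Hy.
exact: (mixed_partials_eq (smooth_bounded_ge0 H) Dx Dy Dxy Dyx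
  (lipschitz2 Hxy) (lipschitz2 Hyx)).
Qed.

(** The partial derivative is the pointwise limit of difference quotients with step [1 / n.+1], each
    of them jointly measurable. *)
Lemma measurable_dy f : (forall x y : R, is_derive y 1 (f x) (dy f x y)) ->
  measurable_fun setT (fun z : R * R => f z.1 z.2) ->
  measurable_fun setT (fun z : R * R => dy f z.1 z.2).
Proof.
move=> D mf.
have mh (n : nat) : measurable_fun setT
    (fun z : R * R => n.+1%:R * (f z.1 (z.2 + n.+1%:R^-1) - f z.1 z.2)).
  apply: measurable_funM => //; apply: measurable_funB => //.
  apply: (measurableT_comp mf (g := fun z : R * R => (z.1, z.2 + n.+1%:R^-1))).
  apply: measurable_fun_pair => //.
  exact: measurable_funD.
apply: (measurable_fun_cvg mh) => z _.
have /is_derive1_caratheodory[g [gE cg <-]] := D z.1 z.2.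
under eq_fun => n do
  rewrite gE (addrC z.2) addrK mulrCA divff ?pnatr_eq0// mulr1.
apply: continuous_cvg; first exact: cg.
rewrite -[X in _ --> X]add0r; apply: cvgD; last exact: cvg_cst.
exact: cvg_harmonic.
Qed.

End Calculus2.

(** * The Gaussian kernel: decay and integration by parts *)

Section Gaussian.
Context {R : realType}.
Local Notation leb := (@lebesgue_measure R).
Local Notation intble f := (leb.-integrable setT (EFin \o f)).
Local Notation K2 := (@gaussian_kernel R).

Lemma gaussian_gt0 t : 0 < K2 t.
Proof.
by rewrite divr_gt0 ?expR_gt0// sqrtr_gt0 mulr_gt0// pi_gt0.
Qed.

Lemma gaussian_der (t : R) : is_derive t 1 K2 (- t * K2 t).
Proof.
have d : is_derive t 1 (fun t : R => - 2^-1 * (t * t)) (- 2^-1 * (1 * t + t * 1)).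
  by apply: isd_scale; apply: isd_mul; exact: isd_id.
have dE := isd_comp (g := fun t : R => - 2^-1 * (t * t)) (is_derive_expR _) d.
have := isd_scale (Num.sqrt (2 * pi))^-1 dE.
have -> : (fun t : R => (Num.sqrt (2 * pi))^-1 * expR (- 2^-1 * (t * t))) = K2.
  apply/funext => s; rewrite /gaussian_kernel mulrC; congr (expR _ / _).
  by field.
move/is_derive_eq; apply; rewrite /gaussian_kernel.
rewrite (_ : - 2^-1 * (t * t) = - (t ^+ 2 / 2)); last by field.
set c := Num.sqrt _; set E := expR _.
have c0 : c != 0 by rewrite gt_eqF// sqrtr_gt0 mulr_gt0// pi_gt0.
by field.
Qed.

Lemma continuous_gaussian : continuous K2.
Proof. exact: der_continuous gaussian_der. Qed.

Lemma gaussianN t : K2 (- t) = K2 t.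
Proof. by rewrite /gaussian_kernel sqrrN. Qed.

(** From [1 + x <= expR x] at [x = t ^ 2 / 2]. Quadratic decay suffices against functions of linear
    growth. *)
Lemma gaussian_decay t : K2 t * (1 + t ^+ 2 / 2) <= K2 0.
Proof.
rewrite /gaussian_kernel expr0n /= mul0r oppr0 expR0 mulrAC.
rewrite ler_wpM2r ?invr_ge0 ?sqrtr_ge0// expRN mulrC ler_pdivrMr ?expR_gt0// mul1r.
exact: expR_ge1Dx.
Qed.

Hypothesis K2i : intble K2.
Hypothesis K2m : intble (fun v => v ^+ 2 * K2 v).

Lemma intble_gaussian2 : intble (fun v => (1 + v ^+ 2) * K2 v).
Proof. by apply: intble_eq (intbleD K2i K2m) => v; rewrite mulrDl mul1r. Qed.

Lemma norm_le_sqr (v : R) : `|v| <= 1 + v ^+ 2.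
Proof. by rewrite -[v ^+ 2]real_normK ?num_real//; have := sqr_ge0 (`|v| - 1); nra. Qed.

Let decay_aux (q c w : R) : 0 <= q -> 0 <= c -> 1 <= w ->
  (q + c * w) * w <= (1 + w ^+ 2 / 2) * (4 * (q + c)).
Proof.
move=> q0 c0 w1; have w0 : 0 <= w by lra.
have h1 : 0 <= q * w * (w - 1) by rewrite !mulr_ge0// subr_ge0.
have h2 : 0 <= c * w ^+ 2 by rewrite mulr_ge0// sqr_ge0.
have h3 : 0 <= q * w ^+ 2 by rewrite mulr_ge0// sqr_ge0.
by lra.
Qed.

Let double_bound (a b c w : R) : a <= c / w -> b <= c / w -> a + b <= 2 * c / w.
Proof. by lra. Qed.

(** Stein's identity, which moves the derivative from the kernel onto [f]. A bounded derivative
    makes [f] grow at most linearly, so the second moment of [K2] gives integrability, and the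
    boundary terms at [n.+1] and [- n.+1] are of order [1 / n.+1]. *)
Lemma gaussian_ibp (f f' : R -> R) (C : R) : (forall x : R, is_derive x 1 f (f' x)) ->
  continuous f' -> (forall x, `|f' x| <= C) ->
  [/\ intble (fun v => - v * K2 v * f v), intble (fun v => K2 v * f' v) &
  \int[leb]_v (- v * K2 v * f v) = - \int[leb]_v (K2 v * f' v)].
Proof.
move=> df cf' fC.
have C0 : 0 <= C := le_trans (normr_ge0 _) (fC 0).
have cf := der_continuous df.
have fb v : `|f v| <= `|f 0| + C * `|v|.
  rewrite -lerBlDl (le_trans (lerB_dist _ _))//.
  by have := der_lipschitz df fC v 0; rewrite subr0.
have mK2 : measurable_fun setT K2 by apply: continuous_measurable_fun; exact: continuous_gaussian.
have I1 : intble (fun v => - v * K2 v * f v).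
  apply: (@intble_le _ _ _ leb _ (fun v => (`|f 0| + C) * ((1 + v ^+ 2) * K2 v))).
  - apply: measurable_funM; last exact: continuous_measurable_fun.
    by apply: measurable_funM => //; exact: measurableT_comp.
  - move=> v; rewrite (normrM (- v * K2 v)) (normrM (- v)) normrN.
    rewrite (gtr0_norm (gaussian_gt0 v)).
    rewrite mulrAC [leRHS]mulrA ler_wpM2r ?(ltW (gaussian_gt0 _))//.
    apply: (@le_trans _ _ (`|v| * (`|f 0| + C * `|v|))); first by rewrite ler_wpM2l.
    rewrite mulrDr mulrCA -expr2 real_normK ?num_real// mulrDl.
    rewrite lerD//; first by rewrite mulrC ler_wpM2l// norm_le_sqr.
    by rewrite ler_wpM2l// lerDr.
  - by apply: intbleZ; exact: intble_gaussian2.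
have I2 : intble (fun v => K2 v * f' v).
  by apply: (intbleM (M := C)) => //; exact: continuous_measurable_fun.
split => //.
pose H v := K2 v * f v; pose H' v := - v * K2 v * f v + K2 v * f' v.
have dH (v : R) : is_derive v 1 H (H' v) by apply: isd_mul => //; exact: gaussian_der.
have cH' : continuous H'.
  move=> v; apply: cvgD; apply: cvgM; [|exact: cf|exact: continuous_gaussian|exact: cf'].
  by apply: cvgM; [apply: cvgN; exact: cvg_id|exact: continuous_gaussian].
have IH : intble H' by exact: intbleD.
have L1 : (\int[leb]_(x in `[- n.+1%:R, n.+1%:R]) H' x)%R @[n --> \oo] --> \int[leb]_x H' x.
  under eq_fun do rewrite Rintegral_mkcond.
  apply: (Rint_cvg (mu := leb) (g := fun v => `|H' v|)).
  - move=> n; have [H1 _] := measurable_restrictT H' (measurable_itv `[- n.+1%:R, n.+1%:R]).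
    by apply: H1; apply: measurable_funTS; exact: continuous_measurable_fun.
  - move=> v; apply: cvg_near_cst; near=> n.
    rewrite patchE mem_set//= in_itv/= -ler_norml.
    apply: (@le_trans _ _ n%:R); last by rewrite ler_nat.
    near: n; exact: nbhs_infty_ger.
  - by move=> n v; rewrite patchE; case: ifP => // _; rewrite normr0.
  - exact: intble_norm.
have E n : (\int[leb]_(x in `[- n.+1%:R, n.+1%:R]) H' x)%R = H n.+1%:R - H (- n.+1%:R).
  rewrite /Rintegral (@continuous_FTC2 _ H' H)//.
  - by rewrite gtrN.
  - exact: continuous_subspaceT.
  - split=> [v _||]; first exact: der_derivable (dH v).
      by apply: cvg_at_right_filter; exact: (der_continuous dH).
    by apply: cvg_at_left_filter; exact: (der_continuous dH).
  - by move=> v _; exact: der_derive1 (dH v).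
have L2 : H n.+1%:R - H (- n.+1%:R) @[n --> \oo] --> (0 : R).
  pose c := 2 * (4 * K2 0 * (`|f 0| + C)).
  have Lh : c * n.+1%:R^-1 @[n --> \oo] --> (0 : R).
    by rewrite -(mulr0 c); apply: cvgM; [exact: cvg_cst|exact: cvg_harmonic].
  apply: norm_cvg0; apply: (squeeze_cvgr _ (cvg_cst 0) Lh).
  apply: nearW => n; rewrite normr_ge0/=.
  have Hb v : 1 <= `|v| -> `|H v| <= 4 * K2 0 * (`|f 0| + C) * `|v|^-1.
    move=> v1; have v0 : 0 < `|v| := lt_le_trans ltr01 v1.
    rewrite ler_pdivlMr// normrM (gtr0_norm (gaussian_gt0 v)).
    have k0 := ltW (gaussian_gt0 v).
    apply: (@le_trans _ _ (K2 v * (1 + v ^+ 2 / 2) * (4 * (`|f 0| + C)))); last first.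
      rewrite (_ : 4 * K2 0 * _ = K2 0 * (4 * (`|f 0| + C))); last by ring.
      by rewrite ler_wpM2r ?gaussian_decay// mulr_ge0// addr_ge0.
    rewrite -(mulrA (K2 v) `|f v|).
    rewrite -(mulrA (K2 v) (1 + v ^+ 2 / 2) (4 * (`|f 0| + C))) ler_wpM2l//.
    apply: (@le_trans _ _ ((`|f 0| + C * `|v|) * `|v|)); first by rewrite ler_wpM2r.
    rewrite -(real_normK (num_real v)).
    exact: decay_aux.
  rewrite (le_trans (ler_normB _ _))// /c.
  have n1 : 1 <= `|n.+1%:R| :> R by rewrite ger0_norm// ler1n.
  have b1 := Hb n.+1%:R n1; have b2 := Hb (- n.+1%:R); rewrite normrN in b2.
  have {}b2 := b2 n1; have nE : `|n.+1%:R| = n.+1%:R :> R by exact: ger0_norm.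
  rewrite nE in b1 b2.
  exact: double_bound b1 b2.
have Z : \int[leb]_x H' x = 0.
  apply: (cvg_unique _ L1); first exact: norm_hausdorff.
  by move: L2; under eq_fun do rewrite -E.
by move: Z; rewrite /H' RintegralD// => /eqP; rewrite addr_eq0 => /eqP.
Unshelve. all: end_near. Qed.

Hypothesis K2_1 : \int[leb]_v K2 v = 1.

(** [gaussian_ibp] for the identity function. This is why no moment of [K2] shows up in the bias. *)
Lemma gaussian_second_moment : \int[leb]_v (v ^+ 2 * K2 v) = 1.
Proof.
have c1 : continuous (fun _ : R => 1 : R) by exact: cst_continuous.
have [] := @gaussian_ibp (fun v => v) (fun=> 1) 1 (@isd_id R) c1.
  by move=> _; rewrite normr1.
move=> I _; under [X in _ = - X -> _]eq_Rintegral do rewrite mulr1.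
rewrite K2_1 => E; apply: oppr_inj; rewrite -E -RintegralN//.
by apply: eq_Rintegral => v _; rewrite expr2; ring.
Qed.

End Gaussian.

(** * Smoothing by the product kernel and its second-order bias *)

Section Smoothing.
Context {R : realType}.
Local Notation leb := (@lebesgue_measure R).
Local Notation leb2 := (leb \x leb)%E.
Local Notation intble f := (leb.-integrable setT (EFin \o f)).
Local Notation intble2 f := (leb2.-integrable setT (EFin \o f)).
Local Notation K2 := (@gaussian_kernel R).
Local Notation RT := (measurableTypeR R).

Lemma Rint_prodM (g h : R -> R) : intble g -> intble h ->
  intble2 (fun z : RT * RT => g z.1 * h z.2) /\
  \int[leb2]_z (g z.1 * h z.2) = (\int[leb]_x g x) * \int[leb]_y h y.
Proof.
move=> gi hi.
have I : intble2 (fun z : RT * RT => g z.1 * h z.2).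
  apply: (intble_prod_dom (m1 := leb) (m2 := leb) (g := fun x => `|g x|)
    (h := fun y => `|h y|)).
  - apply: measurable_funM.
      exact: (measurableT_comp (intble_meas gi)).
    exact: (measurableT_comp (intble_meas hi)).
  - by move=> x y; rewrite normrM.
  - exact: intble_norm.
  - exact: intble_norm.
split => //.
have [_ <-] := Rint_prod1 (m1 := leb) (m2 := leb) I (fun x => intbleZ (g x) hi).
rewrite /= -RintegralZr//; apply: eq_Rintegral => x _.
exact: RintegralZl.
Qed.

Variable K1 : R -> R.
Hypotheses (K1i : intble K1) (K1m : intble (fun u => u ^+ 2 * K1 u)).
Hypotheses (K1e : forall u, K1 (- u) = K1 u) (K1_1 : \int[leb]_u K1 u = 1).
Hypotheses (K2i : intble K2) (K2m : intble (fun v => v ^+ 2 * K2 v)).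
Hypothesis K2_1 : \int[leb]_v K2 v = 1.

Definition weight (z : RT * RT) : R := K1 z.1 * K2 z.2.

Definition kernel_mean (F : RT * RT -> R) : R := \int[leb2]_z (weight z * F z).

(** Growth that the second moments of both kernels can absorb; it is the common envelope in the
    integrability checks that follow, where it is written out. *)
Let Q (z : RT * RT) : R := (1 + z.1 ^+ 2) * (1 + z.2 ^+ 2).

Let Q_ge1 z : 1 <= Q z.
Proof. by rewrite /Q; have := sqr_ge0 z.1; have := sqr_ge0 z.2; nra. Qed.

Let mW : measurable_fun setT weight.
Proof.
apply: measurable_funM.
  exact: (measurableT_comp (intble_meas K1i)).
exact: (measurableT_comp (intble_meas K2i)).
Qed.

Lemma weight_intble c (F : RT * RT -> R) : measurable_fun setT F ->
  (forall z, `|F z| <= c * ((1 + z.1 ^+ 2) * (1 + z.2 ^+ 2))) ->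
  intble2 (fun z => weight z * F z).
Proof.
move=> mF Fc.
have i1 : intble (fun u => c * (`|K1 u| + `|u ^+ 2 * K1 u|)).
  by apply: intbleZ; apply: intbleD; exact: intble_norm.
have [I _] := Rint_prodM i1 (intble_gaussian2 K2i K2m).
apply: (@intble_le _ _ _ leb2 _ (fun z => c * (`|K1 z.1| + `|z.1 ^+ 2 * K1 z.1|) *
  ((1 + z.2 ^+ 2) * K2 z.2))) => //.
  exact: measurable_funM.
move=> z; rewrite normrM.
apply: (le_trans (ler_wpM2l (normr_ge0 _) (Fc z))).
rewrite /weight (normrM (K1 _)) (gtr0_norm (gaussian_gt0 z.2)).
rewrite (normrM (z.1 ^+ 2)) (ger0_norm (sqr_ge0 _)).
by rewrite le_eqVlt; apply/orP; left; apply/eqP; ring.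
Qed.

Lemma kernel_meanD F G : intble2 (fun z => weight z * F z) ->
  intble2 (fun z => weight z * G z) ->
  intble2 (fun z => weight z * (F z + G z)) /\
  kernel_mean (fun z => F z + G z) = kernel_mean F + kernel_mean G.
Proof.
move=> iF iG; split; first by apply: intble_eq (intbleD iF iG) => z; rewrite mulrDr.
rewrite /kernel_mean -RintegralD//.
by apply: eq_Rintegral => z _; rewrite mulrDr.
Qed.

Lemma kernel_meanZ c F : intble2 (fun z => weight z * F z) ->
  intble2 (fun z => weight z * (c * F z)) /\
  kernel_mean (fun z => c * F z) = c * kernel_mean F.
Proof.
move=> iF; split; first by apply: intble_eq (intbleZ c iF) => z; rewrite mulrCA.
rewrite /kernel_mean -RintegralZl//.
by apply: eq_Rintegral => z _; rewrite mulrCA.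
Qed.

Lemma kernel_mean_prod (a b : R -> R) :
  intble (fun u => K1 u * a u) -> intble (fun v => K2 v * b v) ->
  intble2 (fun z => weight z * (a z.1 * b z.2)) /\
  kernel_mean (fun z => a z.1 * b z.2) =
    (\int[leb]_u (K1 u * a u)) * \int[leb]_v (K2 v * b v).
Proof.
move=> ia ib; have [I <-] := Rint_prodM ia ib.
have E : (fun z : RT * RT => K1 z.1 * a z.1 * (K2 z.2 * b z.2)) =
   (fun z => weight z * (a z.1 * b z.2)).
  by apply/funext => z; rewrite /weight; ring.
by rewrite E in I; split => //; rewrite /kernel_mean -E.
Qed.

(** [K1] may change sign, so remainders are integrated against the absolute value of the weight. *)
Definition abs_moment (F : RT * RT -> R) : R := \int[leb2]_z (`|weight z| * F z).

Lemma abs_moment_intble c (F : RT * RT -> R) : measurable_fun setT F ->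
  (forall z, `|F z| <= c * ((1 + z.1 ^+ 2) * (1 + z.2 ^+ 2))) ->
  intble2 (fun z => `|weight z| * F z).
Proof.
move=> mF Fc; have I := weight_intble mF Fc.
apply: (@intble_le _ _ _ leb2 _ (fun z => `|weight z * F z|)); last exact: intble_norm.
  by apply: measurable_funM => //; exact: measurableT_comp.
by move=> z; rewrite (normrM `|weight z|) normr_id -normrM.
Qed.

Let sum_le_Q (a b : R) : 0 <= a -> 0 <= b -> a + b <= (1 + a) * (1 + b).
Proof. by move=> a0 b0; have := mulr_ge0 a0 b0; lra. Qed.

Let cross_le (a b c d : R) : 0 <= a -> 0 <= b -> 0 <= c -> 0 <= d ->
  a * c + b * d <= (a + b) * (c + d).
Proof.
move=> a0 b0 c0 d0.
by have := mulr_ge0 a0 d0; have := mulr_ge0 b0 c0; lra.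
Qed.

Lemma kernel_mean_le c (F G : RT * RT -> R) : measurable_fun setT F -> measurable_fun setT G ->
  (forall z, `|F z| <= G z) ->
  (forall z, `|G z| <= c * ((1 + z.1 ^+ 2) * (1 + z.2 ^+ 2))) ->
  `|kernel_mean F| <= abs_moment G.
Proof.
move=> mF mG FG Gc; apply: Rint_le_norm.
- apply: (weight_intble (c := c)) => // z.
  exact: le_trans (le_trans (FG z) (ler_norm _)) (Gc z).
- exact: abs_moment_intble Gc.
- by move=> z; rewrite normrM ler_wpM2l.
Qed.

Let m0 := abs_moment (fun=> 1).
Let m1 := abs_moment (fun z => `|z.1|).
Let m2 := abs_moment (fun z => `|z.2|).

Let mfst : measurable_fun setT (fun z : RT * RT => z.1 : R).
Proof. exact: measurable_fst. Qed.

Let msnd : measurable_fun setT (fun z : RT * RT => z.2 : R).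
Proof. exact: measurable_snd. Qed.

Let b0 (z : RT * RT) : `|1 : R| <= 1 * ((1 + z.1 ^+ 2) * (1 + z.2 ^+ 2)).
Proof. by rewrite normr1 mul1r; exact: Q_ge1. Qed.

Let b1 (z : RT * RT) : `| `|z.1| | <= 1 * ((1 + z.1 ^+ 2) * (1 + z.2 ^+ 2)).
Proof.
by rewrite normr_id mul1r; have := norm_le_sqr z.1; have := sqr_ge0 z.2;
  have := sqr_ge0 z.1; nra.
Qed.

Let b2 (z : RT * RT) : `| `|z.2| | <= 1 * ((1 + z.1 ^+ 2) * (1 + z.2 ^+ 2)).
Proof.
by rewrite normr_id mul1r; have := norm_le_sqr z.2; have := sqr_ge0 z.2;
  have := sqr_ge0 z.1; nra.
Qed.

Lemma abs_moment_affine (a b c : R) :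
  abs_moment (fun z => a + b * `|z.1| + c * `|z.2|) = a * m0 + b * m1 + c * m2.
Proof.
have I0 := abs_moment_intble (measurable_cst _) b0.
have I1 := abs_moment_intble (measurableT_comp (@normr_measurable R setT) mfst) b1.
have I2 := abs_moment_intble (measurableT_comp (@normr_measurable R setT) msnd) b2.
have J0 := intbleZ a I0; have J1 := intbleZ b I1; have J2 := intbleZ c I2.
rewrite /m0 /m1 /m2 /abs_moment -(RintegralZl a measurableT I0).
rewrite -(RintegralZl b measurableT I1) -(RintegralZl c measurableT I2).
rewrite -(RintegralD measurableT J0 J1).
rewrite -(RintegralD measurableT (intbleD J0 J1) J2).
by apply: eq_Rintegral => z _ /=; ring.
Qed.

Lemma measurable_translate (f : R -> R -> R) (x y a b : R) :
  measurable_fun setT (fun z : R * R => f z.1 z.2) ->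
  measurable_fun setT (fun z : RT * RT => f (x + a * z.1) (y + b * z.2)).
Proof.
move=> mf.
apply: (measurableT_comp mf (g := fun z : RT * RT => (x + a * z.1, y + b * z.2))).
apply: measurable_fun_pair.
  by apply: measurable_funD => //; exact: measurable_funM.
by apply: measurable_funD => //; exact: measurable_funM.
Qed.

Definition smoothed (f : R -> R -> R) (h1 h2 x y : R) : R :=
  kernel_mean (fun z => f (x + h1 * z.1) (y + h2 * z.2)).

Section estimates.
Variables (f fx fy fxx fyy : R -> R -> R) (C : R).
Hypothesis C0 : 0 <= C.
Hypothesis Dx : forall x y : R, is_derive x 1 (fun u => f u y) (fx x y).
Hypothesis Dy : forall x y : R, is_derive y 1 (f x) (fy x y).
Hypothesis Dxx : forall x y : R, is_derive x 1 (fun u => fx u y) (fxx x y).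
Hypothesis Dyy : forall x y : R, is_derive y 1 (fy x) (fyy x y).
Hypothesis Bx : forall x y, `|fx x y| <= C.
Hypothesis Bxx : forall x y, `|fxx x y| <= C.
Hypothesis Byy : forall x y, `|fyy x y| <= C.
Hypothesis cfx : forall x, continuous (fx x).
Hypothesis Lf : forall a b a' b', `|f a b - f a' b'| <= C * (`|a - a'| + `|b - b'|).
Hypothesis Lfy : forall a b a' b', `|fy a b - fy a' b'| <= C * (`|a - a'| + `|b - b'|).
Hypothesis Lfxx : forall a b a' b', `|fxx a b - fxx a' b'| <= C * (`|a - a'| + `|b - b'|).
Hypothesis Lfyy : forall a b a' b', `|fyy a b - fyy a' b'| <= C * (`|a - a'| + `|b - b'|).
Hypothesis mf : measurable_fun setT (fun z : R * R => f z.1 z.2).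
Variables (h1 h2 x : R).
Hypotheses (h10 : 0 <= h1) (h20 : 0 <= h2).

Lemma smoothed_intble y : intble2 (fun z => weight z * f (x + h1 * z.1) (y + h2 * z.2)).
Proof.
apply: (weight_intble (c := `|f x y| + C * h1 + C * h2)).
  exact: measurable_translate.
move=> z; have := Lf (x + h1 * z.1) (y + h2 * z.2) x y.
have -> : x + h1 * z.1 - x = h1 * z.1 by ring.
have -> : y + h2 * z.2 - y = h2 * z.2 by ring.
rewrite (normrM h1) (normrM h2) (ger0_norm h10) (ger0_norm h20).
move=> H; rewrite -(subrK (f x y) (f _ _)) (le_trans (ler_normD _ _))//.
have := b1 z; have := b2 z; rewrite !normr_id !mul1r => h2z h1z.
rewrite [leLHS]addrC -addrA mulrDl; apply: lerD.
  by rewrite ler_peMr//; exact: Q_ge1.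
apply: (le_trans H); rewrite mulrDr mulrDl.
by apply: lerD; rewrite -!mulrA; do 2 (rewrite ler_wpM2l//).
Qed.

(** Takes the place of differentiability of the smoothed function: by the mean value theorem under
    the integral, every increment is compared with the one fixed slope [fy x y0], with an error that
    is small when [s], [y - y0] and the bandwidths are. *)
Lemma smoothed_slope y0 y s :
  `|smoothed f h1 h2 x (y + s) - smoothed f h1 h2 x y - s * fy x y0| <=
  `|s| * (C * ((`|s| + `|y - y0|) * m0 + h1 * m1 + h2 * m2)).
Proof.
have I1 := smoothed_intble (y + s); have I2 := smoothed_intble y.
(* The constant function is written as [1 * 1] so that [kernel_mean_prod] evaluates its mean as the
   product of the two unit masses. *)
have [I0 E0] := @kernel_mean_prod (fun=> 1) (fun=> 1)
  (intble_eq (fun u => esym (mulr1 _)) K1i) (intble_eq (fun u => esym (mulr1 _)) K2i).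
have {}E0 : kernel_mean (fun=> 1 * 1) = 1.
  rewrite E0; under eq_Rintegral do rewrite mulr1.
  by under [X in _ * X]eq_Rintegral do rewrite mulr1; rewrite K1_1 K2_1 mulr1.
have [I3 E3] := kernel_meanZ (- (s * fy x y0)) I0.
have [I4 E4] := kernel_meanZ (-1) I2.
have [I5 E5] := kernel_meanD I4 I3.
have [I6 E6] := kernel_meanD I1 I5.
pose G (z : RT * RT) := `|s| * (C * (`|s| + `|y - y0|)) + `|s| * (C * h1) * `|z.1| +
  `|s| * (C * h2) * `|z.2|.
have -> : smoothed f h1 h2 x (y + s) - smoothed f h1 h2 x y - s * fy x y0 =
   kernel_mean (fun z => f (x + h1 * z.1) (y + s + h2 * z.2) +
     (-1 * f (x + h1 * z.1) (y + h2 * z.2) + - (s * fy x y0) * (1 * 1))).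
  by rewrite E6 E5 E4 E3 E0 mulr1 mulN1r addrA.
have -> : `|s| * (C * ((`|s| + `|y - y0|) * m0 + h1 * m1 + h2 * m2)) = abs_moment G.
  by rewrite abs_moment_affine; ring.
have s0 : 0 <= `|s| by [].
have mG : measurable_fun setT G.
  apply: measurable_funD; first apply: measurable_funD => //.
    by apply: measurable_funM => //; exact: (measurableT_comp (@normr_measurable R setT)).
  by apply: measurable_funM => //; exact: (measurableT_comp (@normr_measurable R setT)).
apply: (kernel_mean_le (c := `|s| * (C * (`|s| + `|y - y0|)) + `|s| * (C * h1) +
    `|s| * (C * h2))) => //.
- apply: measurable_funD; first exact: measurable_translate.
  by apply: measurable_funD => //; apply: measurable_funM => //; exact: measurable_translate.
- move=> z.
  have [c cs E] := MVT_any (Dy (x + h1 * z.1)) (y + h2 * z.2) (y + s + h2 * z.2).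
  have -> : f (x + h1 * z.1) (y + s + h2 * z.2) + (-1 * f (x + h1 * z.1) (y + h2 * z.2) +
     - (s * fy x y0) * (1 * 1)) = s * (fy (x + h1 * z.1) c - fy x y0).
    have -> : f (x + h1 * z.1) (y + s + h2 * z.2) = f (x + h1 * z.1) (y + h2 * z.2) +
       fy (x + h1 * z.1) c * (y + s + h2 * z.2 - (y + h2 * z.2)).
      by rewrite -E; ring.
    by ring.
  rewrite normrM /G -!mulrA -!mulrDr ler_wpM2l//.
  apply: (le_trans (Lfy _ _ _ _)); rewrite ler_wpM2l//.
  rewrite (addrC x) addrK normrM (ger0_norm h10).
  have : `|c - y0| <= `|c - (y + h2 * z.2)| + (`|h2 * z.2| + `|y - y0|).
    have -> : c - y0 = (c - (y + h2 * z.2)) + (h2 * z.2 + (y - y0)) by ring.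
    by rewrite (le_trans (ler_normD _ _))// lerD2l ler_normD.
  have e : y + s + h2 * z.2 - (y + h2 * z.2) = s by ring.
  rewrite e in cs; rewrite (normrM h2) (ger0_norm h20).
  by move: cs; set p := `|c - _|; set q := `|c - y0|; lra.
- move=> z; rewrite ger0_norm; last first.
    by rewrite /G; apply: addr_ge0; [apply: addr_ge0|]; repeat apply: mulr_ge0 => //;
      exact: addr_ge0.
  rewrite /G; have := b1 z; have := b2 z; have := Q_ge1 z; rewrite /Q.
  set q := (1 + z.1 ^+ 2) * (1 + z.2 ^+ 2); rewrite !normr_id !mul1r => q1 g2 g1.
  rewrite !mulrDl; apply: lerD; first apply: lerD.
  + by rewrite ler_peMr//; repeat apply: mulr_ge0 => //; exact: addr_ge0.
  + by rewrite ler_wpM2l//; repeat apply: mulr_ge0.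
  + by rewrite ler_wpM2l//; repeat apply: mulr_ge0.
Qed.

(** Each branch of the minimum bounds the oscillation of a second derivative: [2 * D] by
    boundedness, the other by the Lipschitz property. The Lipschitz branch tends to 0 but would need
    third moments of the kernels; the constant branch provides an integrable dominating function
    from second moments. *)
Definition bias_modulus (D g1 g2 : R) : R := abs_moment (fun z =>
  (z.1 ^+ 2 + z.2 ^+ 2) * Num.min (2 * D) (D * (g1 * `|z.1| + g2 * `|z.2|))).

Lemma smoothed_bias y : f x y = 0 ->
  `|smoothed f h1 h2 x y - (\int[leb]_u (u ^+ 2 * K1 u) * h1 ^+ 2 * fxx x y +
      h2 ^+ 2 * fyy x y) / 2| <= (h1 ^+ 2 + h2 ^+ 2) * bias_modulus C h1 h2.
Proof.
move=> f0; pose m (z : RT * RT) := Num.min (2 * C) (C * (h1 * `|z.1| + h2 * `|z.2|)).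
have m0' z : 0 <= m z.
  by rewrite le_min !mulr_ge0//= addr_ge0// mulr_ge0.
have mle z : m z <= 2 * C by rewrite ge_min lexx.
(* Expanding in x at the shifted ordinate [y + h2 * z.2] and then in y at [x] avoids a mixed
   second-order term. The first-order term in x keeps the shifted ordinate, yet its mean vanishes
   because it factors and [K1 u * u] is odd. *)
pose P (z : RT * RT) := (h1 ^+ 2 / 2 * fxx x y) * (z.1 ^+ 2 * 1) +
  (h2 ^+ 2 / 2 * fyy x y) * (1 * z.2 ^+ 2) +
  h1 * (z.1 * fx x (y + h2 * z.2)) + (h2 * fy x y) * (1 * z.2).
have K1u : intble (fun u => K1 u * u).
  apply: (@intble_le _ _ _ leb _ (fun u => `|K1 u| + `|u ^+ 2 * K1 u|)).
  - by apply: measurable_funM => //; exact: intble_meas K1i.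
  - move=> u; rewrite (normrM (K1 u)) (normrM (u ^+ 2)) (ger0_norm (sqr_ge0 u)).
    rewrite [leRHS](_ : _ = `|K1 u| * (1 + u ^+ 2)); last by ring.
    by rewrite ler_wpM2l// norm_le_sqr.
  - by apply: intbleD; exact: intble_norm.
have K2v : intble (fun v => K2 v * v).
  apply: (@intble_le _ _ _ leb _ (fun v => (1 + v ^+ 2) * K2 v)).
  - by apply: measurable_funM => //; exact: intble_meas K2i.
  - move=> v; rewrite (normrM (K2 v)) (gtr0_norm (gaussian_gt0 v)) mulrC.
    by rewrite ler_wpM2r ?norm_le_sqr// ltW// gaussian_gt0.
  - exact: intble_gaussian2.
have K1u2 : intble (fun u => K1 u * u ^+ 2) by apply: intble_eq K1m => u; rewrite mulrC.
have K2v2 : intble (fun v => K2 v * v ^+ 2) by apply: intble_eq K2m => v; rewrite mulrC.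
have K11 := intble_eq (fun u => esym (mulr1 _)) K1i.
have K21 := intble_eq (fun u => esym (mulr1 _)) K2i.
have Kfx : intble (fun v => K2 v * fx x (y + h2 * v)).
  apply: (intbleM (M := C)) => //.
  have c : continuous (fun v : R => fx x (y + h2 * v)).
    move=> v; apply: (@continuous_comp _ _ _ (fun v : R => y + h2 * v) (fx x)); last first.
      exact: cfx.
    by apply: cvgD; [exact: cvg_cst|apply: cvgM; [exact: cvg_cst|exact: cvg_id]].
  exact: continuous_measurable_fun.
have [I1 E1] := @kernel_mean_prod (fun u => u ^+ 2) (fun=> 1) K1u2 K21.
have [I2 E2] := @kernel_mean_prod (fun=> 1) (fun v => v ^+ 2) K11 K2v2.
have [I3 E3] := @kernel_mean_prod (fun u => u) (fun v => fx x (y + h2 * v)) K1u Kfx.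
have [I4 E4] := @kernel_mean_prod (fun=> 1) (fun v => v) K11 K2v.
have odd1 : \int[leb]_u (K1 u * u) = 0.
  by apply: Rint_odd => // u; rewrite K1e mulrN.
have odd2 : \int[leb]_v (K2 v * v) = 0.
  by apply: Rint_odd => // v; rewrite gaussianN mulrN.
have one1 : \int[leb]_u (K1 u * 1) = 1.
  by under eq_Rintegral do rewrite mulr1; exact: K1_1.
have one2 : \int[leb]_u (K2 u * 1) = 1.
  by under eq_Rintegral do rewrite mulr1; exact: K2_1.
have sq1 : \int[leb]_u (K1 u * u ^+ 2) = \int[leb]_u (u ^+ 2 * K1 u).
  by apply: eq_Rintegral => u _; rewrite mulrC.
have sq2 : \int[leb]_u (K2 u * u ^+ 2) = 1.
  rewrite -[RHS](gaussian_second_moment K2i K2m K2_1).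
  by apply: eq_Rintegral => u _; rewrite mulrC.
have [J1 F1] := kernel_meanZ (h1 ^+ 2 / 2 * fxx x y) I1.
have [J2 F2] := kernel_meanZ (h2 ^+ 2 / 2 * fyy x y) I2.
have [J3 F3] := kernel_meanZ h1 I3.
have [J4 F4] := kernel_meanZ (h2 * fy x y) I4.
have [L2 G2] := kernel_meanD J1 J2.
have [L3 G3] := kernel_meanD L2 J3.
have [L4 G4] := kernel_meanD L3 J4.
have [J5 F5] := kernel_meanZ (-1) L4.
have [L6 G6] := kernel_meanD (smoothed_intble y) J5.
have -> : smoothed f h1 h2 x y - (\int[leb]_u (u ^+ 2 * K1 u) * h1 ^+ 2 * fxx x y +
      h2 ^+ 2 * fyy x y) / 2 =
   kernel_mean (fun z => f (x + h1 * z.1) (y + h2 * z.2) + -1 * P z).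
  rewrite G6 F5 G4 G3 G2 F1 F2 F3 F4 E1 E2 E3 E4 odd1 odd2 one1 one2 sq1 sq2.
  by rewrite -/(smoothed f h1 h2 x y); field.
have mm : measurable_fun setT (fun z : RT * RT => (z.1 ^+ 2 + z.2 ^+ 2) * m z).
  apply: measurable_funM; first by apply: measurable_funD; exact: measurable_funX.
  apply: measurable_minr => //; apply: measurable_funM => //; apply: measurable_funD.
    by apply: measurable_funM => //; exact: (measurableT_comp (@normr_measurable R setT)).
  by apply: measurable_funM => //; exact: (measurableT_comp (@normr_measurable R setT)).
have mbd z : `|(z.1 ^+ 2 + z.2 ^+ 2) * m z| <= (2 * C) * ((1 + z.1 ^+ 2) * (1 + z.2 ^+ 2)).
  have s1 := sqr_ge0 z.1; have s2 := sqr_ge0 z.2.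
  rewrite ger0_norm ?mulr_ge0// ?addr_ge0// mulrC; apply: ler_pM => //.
    by rewrite addr_ge0.
  exact: sum_le_Q.
have hh0 : 0 <= h1 ^+ 2 + h2 ^+ 2 by rewrite addr_ge0// sqr_ge0.
have -> : (h1 ^+ 2 + h2 ^+ 2) * bias_modulus C h1 h2 =
    abs_moment (fun z => (h1 ^+ 2 + h2 ^+ 2) * ((z.1 ^+ 2 + z.2 ^+ 2) * m z)).
  have I := abs_moment_intble mm mbd.
  rewrite /bias_modulus /abs_moment -(RintegralZl _ measurableT I).
  by apply: eq_Rintegral => z _; rewrite mulrCA.
have mfx : measurable_fun setT (fun z : RT * RT => fx x (y + h2 * z.2)).
  apply: (measurableT_comp (continuous_measurable_fun (cfx (x := x)))).
  by apply: measurable_funD => //; exact: measurable_funM.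
have mP : measurable_fun setT P.
  apply: measurable_funD; [apply: measurable_funD; [apply: measurable_funD|]|].
  - apply: measurable_funM => //; apply: measurable_funM => //; exact: measurable_funX.
  - apply: measurable_funM => //; apply: measurable_funM => //; exact: measurable_funX.
  - by apply: measurable_funM => //; exact: measurable_funM.
  - by apply: measurable_funM => //; exact: measurable_funM.
apply: (kernel_mean_le (c := (h1 ^+ 2 + h2 ^+ 2) * (2 * C))).
- apply: measurable_funD; first exact: measurable_translate.
  exact: measurable_funM.
- exact: measurable_funM.
- move=> z; pose a := h1 * z.1; pose b := h2 * z.2.
  have na : `|a| = h1 * `|z.1| by rewrite /a normrM (ger0_norm h10).
  have nb : `|b| = h2 * `|z.2| by rewrite /b normrM (ger0_norm h20).
  have T1 : `|f (x + a) (y + b) - f x (y + b) - a * fx x (y + b) -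
      a ^+ 2 / 2 * fxx x y| <= a ^+ 2 * m z.
    apply: (taylor2 (g1 := fun s => fx s (y + b)) (g2 := fun s => fxx s (y + b))).
    - move=> c ca; rewrite le_min; apply/andP; split.
        rewrite (le_trans (ler_normB _ _))// mulr_natl mulr2n.
        by apply: lerD; exact: Bxx.
      apply: (le_trans (Lfxx _ _ _ _)); rewrite ler_wpM2l//.
      by rewrite -na -nb (_ : y + b - y = b) ?lerD//; ring.
  have T2 : `|f x (y + b) - f x y - b * fy x y -
      b ^+ 2 / 2 * fyy x y| <= b ^+ 2 * m z.
    apply: (taylor2 (g1 := fy x) (g2 := fyy x)).
    - move=> c cb; rewrite le_min; apply/andP; split.
        rewrite (le_trans (ler_normB _ _))// mulr_natl mulr2n.
        by apply: lerD; exact: Byy.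
      apply: (le_trans (Lfyy _ _ _ _)); rewrite ler_wpM2l//.
      by rewrite subrr normr0 add0r -na -nb (le_trans cb)// lerDr.
  have -> : f (x + h1 * z.1) (y + h2 * z.2) + -1 * P z =
    (f (x + a) (y + b) - f x (y + b) - a * fx x (y + b) - a ^+ 2 / 2 * fxx x y) +
    (f x (y + b) - f x y - b * fy x y - b ^+ 2 / 2 * fyy x y).
    by rewrite f0 /P /a /b; field.
  rewrite (le_trans (ler_normD _ _))// (le_trans (lerD T1 T2))// -mulrDl mulrA.
  rewrite ler_wpM2r// /a /b !exprMn.
  by apply: cross_le; exact: sqr_ge0.
- by move=> z; rewrite normrM (ger0_norm hh0) -mulrA ler_wpM2l.
Qed.

End estimates.

Lemma bias_modulus_cvg C (h1 h2 : nat -> R) : 0 <= C ->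
  (forall n, 0 <= h1 n) -> (forall n, 0 <= h2 n) ->
  h1 n @[n --> \oo] --> (0 : R) -> h2 n @[n --> \oo] --> (0 : R) ->
  bias_modulus C (h1 n) (h2 n) @[n --> \oo] --> (0 : R).
Proof.
move=> C0 h10 h20 h1c h2c.
rewrite /bias_modulus /abs_moment.
have <- : \int[leb2]_z (fun=> 0 : R) z = 0.
  by rewrite /Rintegral integral0.
pose m n (z : RT * RT) := Num.min (2 * C) (C * (h1 n * `|z.1| + h2 n * `|z.2|)).
have m_ge0 n z : 0 <= m n z.
  by rewrite le_min !mulr_ge0//= addr_ge0// mulr_ge0.
have m_le n z : m n z <= 2 * C by rewrite ge_min lexx.
have ms : measurable_fun setT (fun z : RT * RT => z.1 ^+ 2 + z.2 ^+ 2).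
  by apply: measurable_funD; exact: measurable_funX.
apply: (Rint_cvg (mu := leb2) (f_ := fun n z => `|weight z| * ((z.1 ^+ 2 + z.2 ^+ 2) * m n z))
  (g := fun z => `|weight z| * ((z.1 ^+ 2 + z.2 ^+ 2) * (2 * C)))).
- move=> n; apply: measurable_funM; first exact: measurableT_comp.
  apply: measurable_funM => //.
  apply: measurable_minr => //; apply: measurable_funM => //; apply: measurable_funD.
    by apply: measurable_funM => //; exact: (measurableT_comp (@normr_measurable R setT)).
  by apply: measurable_funM => //; exact: (measurableT_comp (@normr_measurable R setT)).
- move=> z; rewrite -(mulr0 `|weight z|); apply: cvgM; first exact: cvg_cst.
  rewrite -(mulr0 (z.1 ^+ 2 + z.2 ^+ 2)); apply: cvgM; first exact: cvg_cst.
  have L : C * (h1 n * `|z.1| + h2 n * `|z.2|) @[n --> \oo] --> (0 : R).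
    rewrite -(mulr0 C); apply: cvgM; first exact: cvg_cst.
    rewrite -(addr0 0); apply: cvgD.
      by rewrite -(mul0r `|z.1|); apply: cvgM => //; exact: cvg_cst.
    by rewrite -(mul0r `|z.2|); apply: cvgM => //; exact: cvg_cst.
  apply: (squeeze_cvgr _ (cvg_cst 0) L); apply: nearW => n.
  by rewrite m_ge0 /m ge_min lexx orbT.
- move=> n z; have s0 : 0 <= z.1 ^+ 2 + z.2 ^+ 2 by rewrite addr_ge0// sqr_ge0.
  rewrite normrM normr_id ler_wpM2l// ger0_norm ?mulr_ge0//.
  by rewrite ler_wpM2l.
- apply: (abs_moment_intble (c := 2 * C)); first exact: measurable_funM.
  move=> z; have s1 := sqr_ge0 z.1; have s2 := sqr_ge0 z.2.
  rewrite ger0_norm ?mulr_ge0// ?addr_ge0// mulrC ler_wpM2l ?mulr_ge0//.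
  exact: sum_le_Q.
Qed.

End Smoothing.

(** * Independent observations *)

Section ProbabilityIntegral.
Context d (T : measurableType d) (R : realType) (P : probability T R).
Local Notation Pintble f := (P.-integrable setT (EFin \o f)).

Lemma bounded_intble (f : T -> R) M : measurable_fun setT f ->
  (forall w, `|f w| <= M) -> Pintble f.
Proof.
move=> mf fM; apply: (@intble_le _ _ _ P _ (cst M)) => //.
exact: finite_measure_integrable_cst.
Qed.

Lemma Rint_prob_cst (c : R) : \int[P]_w c = c.
Proof.
transitivity (c * fine (P setT)); first exact: Rintegral_cst.
by rewrite probability_setT mulr1.
Qed.

Section law.
Context d' (S : measurableType d') (V : T -> S).
Hypothesis mV : measurable_fun setT V.

#[local] HB.instance Definition _ := isMeasurableFun.Build _ _ _ _ V mV.

Definition law_of : probability S R := distribution P V.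

Lemma law_ofE A : law_of A = P (V @^-1` A). Proof. by []. Qed.

Lemma Rint_law (f : S -> R) M : measurable_fun setT f -> (forall s, `|f s| <= M) ->
  law_of.-integrable setT (EFin \o f) /\
  \int[law_of]_s f s = \int[P]_w f (V w).
Proof.
move=> mf fM; split.
  apply: (@intble_le _ _ _ law_of _ (cst M)) => //.
  exact: finite_measure_integrable_cst.
rewrite /Rintegral; congr fine; apply: integral_distribution.
  exact/measurable_EFinP.
by apply: (bounded_intble (M := M)) => //; exact: measurableT_comp.
Qed.

(** The law of [V] vanishes on null sets of [mu], and its Radon-Nikodym derivative has the same
    integral as [f] over every measurable set, hence equals [f] almost everywhere. *)
Lemma Rint_density (mu : {sigma_finite_measure set S -> \bar R}) (f phi : S -> R) M :
  (forall s, 0 <= f s) -> measurable_fun setT f ->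
  (forall A, measurable A -> P (V @^-1` A) = (\int[mu]_(s in A) (f s)%:E)%E) ->
  measurable_fun setT phi -> (forall s, `|phi s| <= M) ->
  mu.-integrable setT (EFin \o (fun s => phi s * f s)) /\
  \int[P]_w phi (V w) = \int[mu]_s (phi s * f s).
Proof.
move=> f0 mf dens mphi phiM.
have fi : mu.-integrable setT (EFin \o f).
  apply: intble_ge0 => //.
  by rewrite -dens// preimage_setT probability_setT ltry.
have phifi : mu.-integrable setT (EFin \o (fun s => phi s * f s)).
  by apply: intble_eq (intbleM fi mphi phiM) => s; rewrite mulrC.
split => //; have [li <-] := Rint_law mphi phiM.
have dom : law_of `<< mu.
  apply/null_content_dominatesP => A mA A0.
  rewrite law_ofE dens//; apply: null_set_integral => //.
  by apply: measurable_funTS; exact/measurable_EFinP.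
rewrite /Rintegral; congr fine.
rewrite -(Radon_Nikodym_change_of_variables dom measurableT li).
have RNi := @Radon_Nikodym_integrable _ _ _ (charge_of_finite_measure law_of) mu dom.
apply: ae_eq_integral => //.
- by apply: emeasurable_funM; [exact/measurable_EFinP|exact: measurable_int RNi].
- exact: (measurable_int _ phifi).
have ae : ae_eq mu setT
    (Radon_Nikodym (charge_of_finite_measure law_of) mu) (EFin \o f).
  apply: integral_ae_eq => //; first exact/measurable_EFinP.
  move=> E _ mE.
  have := @Radon_Nikodym_integral _ _ _ (charge_of_finite_measure law_of) mu E dom mE.
  by move=> <-; exact: dens.
have := ae_eqe_mul2l (EFin \o phi) ae.
by apply: filterS => s + _ => /(_ I) /= ->.
Qed.

End law.

Definition independent2 d1 d2 (S1 : measurableType d1) (S2 : measurableType d2)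
  (f : T -> S1) (g : T -> S2) := forall A B, measurable A -> measurable B ->
  P (f @^-1` A `&` g @^-1` B) = (P (f @^-1` A) * P (g @^-1` B))%E.

(** The law of the pair agrees with the product of the two laws on rectangles, hence on all
    measurable sets, and Fubini applies to the product. *)
Lemma independent2_Rint d1 d2 (S1 : measurableType d1) (S2 : measurableType d2)
    (f : T -> S1) (g : T -> S2) (phi : S1 * S2 -> R) M :
  measurable_fun setT f -> measurable_fun setT g -> independent2 f g ->
  measurable_fun setT phi -> (forall s, `|phi s| <= M) ->
  \int[P]_w phi (f w, g w) = \int[P]_w \int[P]_w' phi (f w, g w').
Proof.
move=> mf mg fg mphi phiM.
have mfg : measurable_fun setT (fun w => (f w, g w)) by exact: measurable_fun_pair.
have [_ <-] := Rint_law mfg mphi phiM.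
pose m1 := law_of mf; pose m2 := law_of mg.
have E (X : set (S1 * S2)) : measurable X -> (m1 \x m2)%E X = law_of mfg X.
  by apply: product_measure_unique => A B mA mB; exact: fg.
have -> : \int[law_of mfg]_s phi s = \int[(m1 \x m2)%E]_s phi s.
  by rewrite /Rintegral; congr fine; apply: eq_measure_integral => A mA _;
    first [exact: (E A mA) | exact: (esym (E A mA))].
have bnd1 x y : `|phi (x, y)| <= (fun=> M) x * (fun=> 1) y by rewrite mulr1.
have i1 : m1.-integrable setT (EFin \o (fun=> M)).
  exact: finite_measure_integrable_cst.
have i2 : m2.-integrable setT (EFin \o (fun=> 1)).
  exact: finite_measure_integrable_cst.
have I := intble_prod_dom mphi bnd1 i1 i2.
have [H <-] := Rint_prod1 I (intble_section1 mphi bnd1 i2).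
have inner x : \int[m2]_y phi (x, y) = \int[P]_w phi (x, g w).
  have [] // := Rint_law mg (f := fun y => phi (x, y)) (M := M).
  exact: (measurableT_comp mphi).
under eq_Rintegral do rewrite inner.
have mh : measurable_fun setT (fun x => \int[P]_w phi (x, g w)).
  by apply: eq_measurable_fun (intble_meas H) => x _; rewrite inner.
have [] // := Rint_law mf (f := fun x => \int[P]_w phi (x, g w)) (M := M) mh.
move=> x; rewrite -[leRHS]Rint_prob_cst; apply: Rint_le_norm => //.
  apply: (bounded_intble (M := M)) => //.
  by apply: (measurableT_comp mphi); exact: measurable_fun_pair.
exact: finite_measure_integrable_cst.
Qed.

(** For fixed [D] both sides are finite measures in [E] that agree on rectangles, a generating
    family closed under intersection. *)
Lemma pair_independent_event d1 d2 (S1 : measurableType d1) (S2 : measurableType d2)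
    (f : T -> S1) (g : T -> S2) (D : set T) :
  measurable_fun setT f -> measurable_fun setT g -> measurable D ->
  (forall A B, measurable A -> measurable B ->
    P ((f @^-1` A `&` g @^-1` B) `&` D) = (P (f @^-1` A `&` g @^-1` B) * P D)%E) ->
  forall E : set (S1 * S2), measurable E ->
    P ((fun w => (f w, g w)) @^-1` E `&` D) =
    (P ((fun w => (f w, g w)) @^-1` E) * P D)%E.
Proof.
move=> mf mg mD H E mE.
have mfg : measurable_fun setT (fun w => (f w, g w)) by exact: measurable_fun_pair.
have PDfin : P D \is a fin_num by exact: fin_num_measure.
have PD0 : 0 <= fine (P D) by exact: fine_ge0.
pose m1 : {measure set (S1 * S2) -> \bar R} :=
  measure_function_pushforward__canonical__measure_function_Measure (mrestr P mD) mfg.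
pose m2 : {measure set (S1 * S2) -> \bar R} := mscale (NngNum PD0) (law_of mfg).
suff : m1 E = m2 E.
  move=> h; have {}h : P ((fun w => (f w, g w)) @^-1` E `&` D) =
    ((fine (P D))%:E * P ((fun w => (f w, g w)) @^-1` E))%E := h.
  by rewrite h fineK// muleC.
apply: (@measure_unique _ _ _
  [set A `*` B | A in measurable & B in measurable] (fun=> setT)) => //.
- by rewrite measurable_prod_measurableType.
- move=> _ _ [A mA [B mB <-]] [A' mA' [B' mB' <-]].
  by exists (A `&` A'); [exact: measurableI|exists (B `&` B');
    [exact: measurableI|rewrite setXI]].
- by move=> _; exists setT => //; exists setT => //; rewrite setXTT.
- by rewrite bigcup_const.
- move=> _ [A mA [B mB <-]].
  transitivity (P (f @^-1` A `&` g @^-1` B) * P D)%E; first exact: H.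
  by rewrite /m2 /= /mscale /= fineK// muleC.
- move=> _; rewrite /m1 /= /pushforward /mrestr /=.
  by rewrite preimage_setT setTI -(fineK PDfin) ltry.
Qed.

(** Chebyshev's inequality for pairwise uncorrelated summands. Each new centred summand is
    orthogonal to the sum so far, so the second moment of the sum grows by at most [B], the bound on
    raw second moments, which also bounds variances. *)
Lemma uncorrelated_average_tail (psi : nat -> T -> R) (M m B : R) (n : nat) (t : R) :
  (forall j, measurable_fun setT (psi j)) -> (forall j w, `|psi j w| <= M) ->
  (forall j, \int[P]_w psi j w = m) ->
  (forall i j, i != j -> \int[P]_w (psi i w * psi j w) = m ^+ 2) ->
  (forall j, \int[P]_w (psi j w) ^+ 2 <= B) -> (0 < n)%N -> 0 < t ->
  (P [set w | (t <= `|n%:R^-1 * \sum_(j < n) psi j w - m|)%R] <=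
   (B / (n%:R * t ^+ 2))%:E)%E.
Proof.
move=> mpsi bpsi mean cov var n0 t0.
pose S k w := \sum_(j < k) (psi j w - m).
have mS k : measurable_fun setT (S k).
  by apply: measurable_sum => j; exact: measurable_funB.
have bpm j w : `|psi j w - m| <= M + `|m|.
  by rewrite (le_trans (ler_normB _ _))// lerD2r.
have M0 : 0 <= M + `|m| by exact: le_trans (normr_ge0 _) (bpm 0%N point).
have bS k w : `|S k w| <= k%:R * (M + `|m|).
  rewrite (le_trans (ler_norm_sum _ _ _))//.
  apply: (@le_trans _ _ (\sum_(j < k) (M + `|m|))).
    by apply: ler_sum => j _; exact: bpm.
  by rewrite sumr_const card_ord mulr_natl.
have pi j : Pintble (psi j) by exact: bounded_intble (bpsi j).
have ci c : Pintble (fun=> c : R) by exact: finite_measure_integrable_cst.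
have b2 (f g : T -> R) a b : measurable_fun setT f -> measurable_fun setT g ->
    (forall w, `|f w| <= a) -> (forall w, `|g w| <= b) -> Pintble (fun w => f w * g w).
  move=> mf mg fa gb; apply: (bounded_intble (M := a * b)).
    exact: measurable_funM.
  by move=> w; rewrite normrM ler_pM.
have mpm j : measurable_fun setT (fun w => psi j w - m) by exact: measurable_funB.
have cross i j : i != j -> \int[P]_w ((psi i w - m) * (psi j w - m)) = 0.
  move=> ij.
  have I1 : Pintble (fun w => psi i w * psi j w) by exact: (b2 _ _ M M).
  have I2 : Pintble (fun w => m * psi i w) by exact: intbleZ.
  have I3 : Pintble (fun w => m * psi j w) by exact: intbleZ.
  have -> : \int[P]_w ((psi i w - m) * (psi j w - m)) =
     \int[P]_w ((psi i w * psi j w - m * psi i w) - (m * psi j w - m ^+ 2)).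
    by apply: eq_Rintegral => w _; ring.
  rewrite (RintegralB measurableT (intbleB I1 I2) (intbleB I3 (ci _))).
  rewrite (RintegralB measurableT I1 I2) (RintegralB measurableT I3 (ci _)).
  rewrite (RintegralZl _ measurableT (pi i)) (RintegralZl _ measurableT (pi j)).
  by rewrite Rint_prob_cst !mean cov//; ring.
have diag j : \int[P]_w ((psi j w - m) * (psi j w - m)) <= B.
  have I1 : Pintble (fun w => psi j w ^+ 2).
    by apply: intble_eq (b2 (psi j) (psi j) M M _ _ _ _) => // w; rewrite expr2.
  have I2 : Pintble (fun w => (2 * m) * psi j w) by exact: intbleZ.
  have -> : \int[P]_w ((psi j w - m) * (psi j w - m)) =
     \int[P]_w ((psi j w ^+ 2 - 2 * m * psi j w) + m ^+ 2).
    by apply: eq_Rintegral => w _; ring.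
  rewrite (RintegralD measurableT (intbleB I1 I2) (ci _)).
  rewrite (RintegralB measurableT I1 I2) (RintegralZl _ measurableT (pi j)).
  rewrite Rint_prob_cst mean (le_trans _ (var j))//.
  by have := sqr_ge0 m; rewrite expr2; lra.
have Sj k j : (k <= j)%N -> \int[P]_w (S k w * (psi j w - m)) = 0.
  elim: k => [_|k IH kj].
    rewrite -[RHS](Rint_prob_cst 0); apply: eq_Rintegral => w _.
    by rewrite /S big_ord0 mul0r.
  have -> : \int[P]_w (S k.+1 w * (psi j w - m)) =
     \int[P]_w (S k w * (psi j w - m) + (psi k w - m) * (psi j w - m)).
    by apply: eq_Rintegral => w _; rewrite /S big_ord_recr/= mulrDl.
  rewrite RintegralD//.
  - by rewrite IH ?(ltnW kj)// cross ?addr0// ltn_eqF.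
  - exact: (b2 _ _ (k%:R * (M + `|m|)) (M + `|m|)).
  - exact: (b2 _ _ (M + `|m|) (M + `|m|)).
have SS k : \int[P]_w (S k w * S k w) <= k%:R * B.
  elim: k => [|k IH].
    rewrite mul0r (_ : \int[P]_w _ = 0)//.
    rewrite -[RHS](Rint_prob_cst 0); apply: eq_Rintegral => w _.
    by rewrite /S big_ord0 mul0r.
  have I1 : Pintble (fun w => S k w * S k w).
    exact: (b2 _ _ (k%:R * (M + `|m|)) (k%:R * (M + `|m|))).
  have I2 : Pintble (fun w => S k w * (psi k w - m)).
    exact: (b2 _ _ (k%:R * (M + `|m|)) (M + `|m|)).
  have I3 : Pintble (fun w => (psi k w - m) * (psi k w - m)).
    exact: (b2 _ _ (M + `|m|) (M + `|m|)).
  have -> : \int[P]_w (S k.+1 w * S k.+1 w) =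
    \int[P]_w ((S k w * S k w + 2 * (S k w * (psi k w - m))) +
       (psi k w - m) * (psi k w - m)).
    by apply: eq_Rintegral => w _; rewrite /S big_ord_recr/=; ring.
  rewrite (RintegralD measurableT (intbleD I1 (intbleZ 2 I2)) I3).
  rewrite (RintegralD measurableT I1 (intbleZ 2 I2)) (RintegralZl _ measurableT I2).
  rewrite Sj// mulr0 addr0 -natr1 mulrDl mul1r.
  exact: lerD.
have nR : 0 < n%:R :> R by rewrite ltr0n.
have avg w : n%:R^-1 * \sum_(j < n) psi j w - m = n%:R^-1 * S n w.
  rewrite /S sumrB sumr_const card_ord mulrBr -(mulr_natl m) mulrA.
  by rewrite mulVf ?mul1r// gt_eqF.
have nV : `|n%:R^-1| = n%:R^-1 :> R by rewrite ger0_norm// invr_ge0.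
set A := [set w | _].
have AE : A = [set w | (n%:R * t) ^+ 2 <= S n w * S n w].
  apply/seteqP; split => w; rewrite /A /=.
    rewrite avg normrM nV mulrC ler_pdivlMr// (mulrC t) => h.
    rewrite -expr2 -(real_normK (num_real (S n w))).
    by rewrite lerXn2r// nnegrE// mulr_ge0// ltW.
  move=> h; rewrite avg normrM nV mulrC ler_pdivlMr// (mulrC t).
  have nt : 0 <= n%:R * t by rewrite mulr_ge0// ltW.
  by rewrite -ler_sqr ?nnegrE// (real_normK (num_real (S n w))) expr2.
have mA : measurable A.
  rewrite AE -[X in measurable X]setTI.
  apply: measurable_fun_le => //; exact: measurable_funM.
have ISS : Pintble (fun w => S n w * S n w).
  exact: (b2 _ _ (n%:R * (M + `|m|)) (n%:R * (M + `|m|))).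
have key : (n%:R * t) ^+ 2 * fine (P A) <= n%:R * B.
  apply: le_trans (SS n).
  have -> : fine (P A) = \int[P]_w (\1_A w).
    by rewrite /Rintegral integral_indic// setIT.
  have IA : Pintble (\1_A : T -> R).
    by apply: (bounded_intble (M := 1)) => // w; rewrite indicE; case: (_ \in _);
      rewrite ?normr1 ?normr0.
  rewrite -(RintegralZl _ measurableT IA).
  apply: le_Rintegral => //; first exact: intbleZ.
  move=> w _; rewrite indicE; case: (boolP (w \in A)) => [|_].
    by rewrite inE AE /= mulr1.
  by rewrite mulr0 -expr2 sqr_ge0.
rewrite -(fineK (fin_num_measure P A mA)) lee_fin ler_pdivlMr; last first.
  by rewrite mulr_gt0// exprn_gt0.
rewrite -(ler_pM2l nR) mulrC -mulrA.
by move: key; rewrite exprMn; congr (_ <= _); ring.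
Qed.

End ProbabilityIntegral.

Section LebesguePlane.
Context {R : realType}.
Local Notation RT := (measurableTypeR R).

(** A name for the product measure, able to carry the sigma-finiteness that [Rint_density] asks of
    its reference measure. *)
Definition plane_measure : set (RT * RT)%type -> \bar R :=
  (@lebesgue_measure R \x @lebesgue_measure R)%E.

HB.instance Definition _ := Measure.on plane_measure.

Let plane_measure_sigma_finite : sigma_finite setT plane_measure.
Proof.
have /sigma_finiteP[F [TF ndF Foo]] := sigma_finiteT (@lebesgue_measure R).
exists (fun n => F n `*` F n).
  rewrite -setXTT TF predeqE => -[x y]; split.
    move=> [/= [n _ Fnx] [k _ Fky]]; exists (maxn n k) => //; split.
    - by move: x Fnx; exact/subsetPset/ndF/leq_maxl.
    - by move: y Fky; exact/subsetPset/ndF/leq_maxr.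
  by move=> [n _ []/= Fx Fy]; split; exists n.
move=> k; have [mF finF] := Foo k; split; first exact: measurableX.
by rewrite [plane_measure _]product_measure1E// lte_mul_pinfty// ge0_fin_numE.
Qed.

HB.instance Definition _ := Measure_isSigmaFinite.Build _ _ _ plane_measure
  plane_measure_sigma_finite.

End LebesguePlane.

(** * Independence and means in the contaminated sample *)

Section ContaminatedSample.
Context d (T : measurableType d) (R : realType) (P : probability T R).
Variables (X Y U : nat -> {RV P >-> R}) (p : R -> R -> R) (fU : R -> R).
Hypothesis HS : contaminated_sample X Y U p fU.

Local Notation RT := (measurableTypeR R).

Let XY (j : nat) (w : T) : R * R := (X j w, Y j w).

Let mXY j : measurable_fun setT (XY j).
Proof. by apply: measurable_fun_pair. Qed.

Let mU j : measurable_fun setT (U j). Proof. by []. Qed.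

(** A family of events to which [mutually_independent] can be applied, indexed by pairs ([inl]) and
    errors ([inr]): index [i] receives [A] and [C], every other index [B] and [D]. *)
Let event (i j : nat) (A B : set (R * R)) (C D : set R) (k : nat + nat) : set T :=
  match k with
  | inl l => if l == i then XY l @^-1` A else XY l @^-1` B
  | inr l => if l == i then U l @^-1` C else U l @^-1` D
  end.

Let eventP i j A B C D k : measurable A -> measurable B -> measurable C ->
  measurable D -> sample_sigma_algebras X Y U k (event i j A B C D k).
Proof.
move=> mA mB mC mD; case: k => l /=; case: ifP => _.
- by exists A => //; rewrite setTI.
- by exists B => //; rewrite setTI.
- by exists C => //; rewrite setTI.
- by exists D => //; rewrite setTI.
Qed.

Let indep1 i A C : measurable A -> measurable C ->
  P (XY i @^-1` A `&` U i @^-1` C) = (P (XY i @^-1` A) * P (U i @^-1` C))%E.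
Proof.
move=> mA mC; have [_ _ ind] := HS.
have /= := ind [:: inl i; inr i] (event i i A A C C).
rewrite bigcap_seq !big_cons !big_nil /= eqxx setIT mule1; apply => //.
by move=> k _; exact: eventP.
Qed.

Lemma pair_error_independent i : independent2 P (XY i) (U i).
Proof. by move=> A C; exact: indep1. Qed.

Let indep4 i j A B C D : i != j -> measurable A -> measurable B ->
  measurable C -> measurable D ->
  P ((XY i @^-1` A `&` U i @^-1` C) `&` (XY j @^-1` B `&` U j @^-1` D)) =
  (P (XY i @^-1` A `&` U i @^-1` C) * P (XY j @^-1` B `&` U j @^-1` D))%E.
Proof.
move=> ij mA mB mC mD; have [_ _ ind] := HS.
have ji : (j == i) = false by rewrite eq_sym (negbTE ij).
rewrite !indep1//.
have /= := ind [:: inl i; inr i; inl j; inr j] (event i j A B C D).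
rewrite bigcap_seq !big_cons !big_nil /= eqxx ji setIT mule1 !setIA !muleA.
apply; last by move=> k _; exact: eventP.
by rewrite !inE /= !orbF; apply/and3P; split => //; apply/eqP => -[] /eqP; rewrite (negbTE ij).
Qed.

Let V (j : nat) (w : T) : (R * R) * R := (XY j w, U j w).

Let mV j : measurable_fun setT (V j). Proof. exact: measurable_fun_pair. Qed.

(** Independence on products of events extends to arbitrary events of an observation by
    [pair_independent_event], used once for each observation while the event of the other stays
    fixed. *)
Lemma observations_independent i j : i != j -> independent2 P (V i) (V j).
Proof.
move=> ij E F mE mF.
have mpre k G : measurable G -> measurable (V k @^-1` G).
  by move=> mG; rewrite -[X in measurable X]setTI; exact: mV.
rewrite setIC (muleC (P _)).
apply: (pair_independent_event (mXY j) (mU j) (mpre i E mE)) => // B D mB mD.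
rewrite setIC (muleC (P _)).
have mXYB : measurable (XY j @^-1` B).
  by rewrite -[X in measurable X]setTI; exact: mXY.
have mUD : measurable (U j @^-1` D).
  by rewrite -[X in measurable X]setTI; exact: mU.
apply: (pair_independent_event (mXY i) (mU i) (measurableI _ _ mXYB mUD)) => //.
by move=> A C mA mC; exact: indep4.
Qed.

Lemma Rint_pair_density j (phi : R * R -> R) M : measurable_fun setT phi ->
  (forall s, `|phi s| <= M) ->
  (@lebesgue_measure R \x @lebesgue_measure R)%E.-integrable setT
     (EFin \o (fun s => phi s * p s.1 s.2)) /\
  \int[P]_w phi (X j w, Y j w) =
  \int[(@lebesgue_measure R \x @lebesgue_measure R)%E]_s (phi s * p s.1 s.2).
Proof.
move=> mphi bphi; have [/(_ j)[p0 mp dens] _ _] := HS.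
have mV' : @measurable_fun _ _ T (RT * RT)%type setT (XY j) := mXY j.
have mp' : @measurable_fun _ _ (RT * RT)%type RT setT (fun s : RT * RT => p s.1 s.2) := mp.
have mphi' : @measurable_fun _ _ (RT * RT)%type RT setT phi := mphi.
have dens' (A : set (RT * RT)) : measurable A ->
  P (XY j @^-1` A) = (\int[(@lebesgue_measure R \x @lebesgue_measure R)]_(s in A) (p s.1 s.2)%:E)%E.
  exact: dens.
have D := @Rint_density _ _ _ P _ (RT * RT)%type (XY j) mV' plane_measure
  (fun s => p s.1 s.2) phi M.
exact: D (fun s => p0 s.1 s.2) mp' dens' mphi' bphi.
Qed.

Lemma Rint_error j (phi : R -> R) M : measurable_fun setT phi ->
  (forall s, `|phi s| <= M) -> \int[P]_w phi (U j w) = \int[P]_w phi (U 0%N w).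
Proof.
move=> mphi bphi; have [_ dU _] := HS.
have [u0 mu dens] := dU j; have [_ _ dens0] := dU 0%N.
have [_ ->] := @Rint_density _ _ _ P _ (measurableTypeR R) (U j) (mU j)
  (@lebesgue_measure R) fU phi M u0 mu dens mphi bphi.
by have [_ ->] := @Rint_density _ _ _ P _ (measurableTypeR R) (U 0%N) (mU 0%N)
  (@lebesgue_measure R) fU phi M u0 mu dens0 mphi bphi.
Qed.

Lemma Rint_observation j (phi : R * R -> R -> R) M :
  measurable_fun setT (fun z : (R * R) * R => phi z.1 z.2) ->
  (forall s u, `|phi s u| <= M) ->
  \int[P]_w phi (X j w, Y j w) (U j w) =
  \int[P]_w \int[P]_w' phi (X j w, Y j w) (U j w').
Proof.
move=> mphi bphi.
apply: (independent2_Rint (phi := fun z => phi z.1 z.2) (mXY j) (mU j) _ mphi).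
  exact: pair_error_independent.
by move=> z; exact: bphi.
Qed.

Lemma observations_uncorrelated i j (psi : (R * R) * R -> R) M m : i != j ->
  measurable_fun setT psi -> (forall z, `|psi z| <= M) ->
  (forall k, \int[P]_w psi (X k w, Y k w, U k w) = m) ->
  \int[P]_w (psi (X i w, Y i w, U i w) * psi (X j w, Y j w, U j w)) = m ^+ 2.
Proof.
move=> ij mpsi bpsi mean.
have := @independent2_Rint _ _ _ P _ _ _ _ (V i) (V j)
  (fun z => psi z.1 * psi z.2) (M * M) (mV i) (mV j) (observations_independent ij).
move=> /= ->.
- have pin k : P.-integrable setT (EFin \o (fun w => psi (V k w))).
    exact: (bounded_intble P (measurableT_comp mpsi (mV k)) (fun w => bpsi _)).
  under eq_Rintegral do rewrite (RintegralZl _ measurableT (pin j)) mean.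
  by rewrite (RintegralZr _ measurableT (pin i)) mean expr2.
- by apply: measurable_funM; exact: (measurableT_comp mpsi).
- by move=> z; rewrite normrM ler_pM.
Qed.

(* A density that is C-Lipschitz exceeds p x y - 2 * C on the square of side 2
   around (x, y), where its mass is at most 1. *)
Lemma density_bounded (C : R) :
  (forall a b a' b', `|p a b - p a' b'| <= C * (`|a - a'| + `|b - b'|)) ->
  0 <= C -> forall x y, `|p x y| <= 2 * C + 1.
Proof.
move=> L C0 x y; have [/(_ 0%N)[p0 mp dens] _ _] := HS.
rewrite ger0_norm//; set c := p x y - 2 * C.
suff : c <= 1 by rewrite /c; lra.
have [c0|c0] := leP c 0; first by rewrite (le_trans c0).
pose S : set (R * R) := `[x - 1, x + 1] `*` `[y - 1, y + 1].
have mS : measurable S by apply: measurableX; exact: measurable_itv.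
pose leb := @lebesgue_measure R.
have S4 : (leb \x leb)%E S = 4%:E.
  rewrite product_measure1E; [|exact: measurable_itv|exact: measurable_itv].
  have l (a : R) : @lebesgue_measure R `[a - 1, a + 1] = 2%:E.
    rewrite lebesgue_measure_itv /= lte_fin ifT; last by lra.
    by rewrite -EFinB; congr EFin; ring.
  transitivity (2%:E * 2%:E : \bar R)%E; first by congr (_ * _)%E; exact: l.
  by rewrite -EFinM; congr EFin; ring.
have : (P (XY 0 @^-1` S) <= 1)%E.
  by apply: probability_le1; rewrite -[X in measurable X]setTI; exact: mXY.
rewrite (dens S mS) => H.
have : (c%:E * (leb \x leb)%E S <= 1)%E.
  apply: le_trans H; rewrite -integral_cst//.
  apply: ge0_le_integral => //.
  - by move=> z _; rewrite lee_fin ltW.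
  - by apply/measurable_EFinP; exact: measurable_funTS.
  - move=> [a b] [/=]; rewrite !in_itv/= => /andP[a1 a2] /andP[b1 b2].
    rewrite lee_fin /c.
    have := L x y a b.
    have ha : `|x - a| <= 1 by rewrite ler_norml; apply/andP; split; lra.
    have hb : `|y - b| <= 1 by rewrite ler_norml; apply/andP; split; lra.
    have : C * (`|x - a| + `|y - b|) <= C * 2 by rewrite ler_wpM2l//; lra.
    move=> h1 h2; have := ler_norm (p x y - p a b); lra.
rewrite S4 -EFinM lee_fin; lra.
Qed.

End ContaminatedSample.

(** * Deconvolution *)

Lemma lip_continuous (R : realType) (f : R -> R) (C : R) :
  (forall s t, `|f s - f t| <= C * `|s - t|) -> continuous f.
Proof.
move=> L x; apply/cvgrPdist_lt => e e0.
have C1 : 0 < `|C| + 1 by rewrite ltr_wpDl.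
near=> t; apply: le_lt_trans (L x t) _.
apply: (@le_lt_trans _ _ ((`|C| + 1) * `|x - t|)).
  by rewrite ler_wpM2r// (le_trans (ler_norm C))// lerDl.
rewrite -ltr_pdivlMl// mulrC.
near: t; apply/nbhs_ballP; exists (e / (`|C| + 1)) => //=.
by rewrite divr_gt0.
Unshelve. all: by end_near.
Qed.

Section UnitBall.
Context {R : realType}.
Local Notation leb := (@lebesgue_measure R).
Local Notation intble f := (leb.-integrable setT (EFin \o f)).

Definition unit_ball : set R := [set` `[(-1 : R), 1]].

Let measurable_unit_ball : measurable unit_ball. Proof. exact: measurable_itv. Qed.

Let lebesgue_unit_ball : leb unit_ball = 2%:E.
Proof.
rewrite /unit_ball lebesgue_measure_itv /= lte_fin ifT; last by lra.
by rewrite -EFinB; congr EFin; ring.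
Qed.

Lemma intble_indic_unit_ball : intble (\1_unit_ball : R -> R).
Proof.
apply: (intble_ge0 (mu := leb)); [exact: measurable_indic|by move=> s; rewrite indicE|].
rewrite integral_indic// setIT.
have h : (leb unit_ball < +oo)%E by rewrite lebesgue_unit_ball ltry.
exact: h.
Qed.

Let Rint_indic_unit_ball : \int[leb]_s (\1_unit_ball s) = 2 :> R.
Proof. by rewrite /Rintegral integral_indic// setIT; exact: (congr1 fine lebesgue_unit_ball). Qed.

Variables (f : R -> R) (M : R).
Hypotheses (mf : measurable_fun setT f) (fM : forall s, `|f s| <= M).
Hypothesis f0 : forall s, 1 < `|s| -> f s = 0.

Let f_le s : `|f s| <= M * \1_unit_ball s.
Proof.
rewrite indicE; have [sI|sI] := boolP (s \in unit_ball); first by rewrite mulr1.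
rewrite f0 ?normr0 ?mulr0//; rewrite notin_setE /unit_ball /= in_itv/= in sI.
by rewrite ltNge; apply/negP => h; apply: sI; rewrite -ler_norml.
Qed.

Lemma intble_supported : intble f.
Proof. exact: (intble_le (mu := leb) mf f_le (intbleZ M intble_indic_unit_ball)). Qed.

Lemma Rint_sqr_supported : \int[leb]_s f s ^+ 2 <= 2 * M ^+ 2.
Proof.
have Ii := intble_indic_unit_ball.
rewrite mulrC -Rint_indic_unit_ball -(RintegralZl _ measurableT Ii).
apply: le_trans (ler_norm _) _; apply: Rint_le_norm.
- apply: (intble_eq (mu := leb) (f := fun s => f s * f s)) => [s|]; first by rewrite expr2.
  exact: (intbleM (mu := leb) intble_supported mf fM).
- exact: intbleZ.
move=> s; rewrite ger0_norm ?sqr_ge0// -[leLHS]real_normK ?num_real//.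
have := f_le s; rewrite indicE; case: (s \in unit_ball) => /=; last first.
  by rewrite !mulr0 normr_le0 => /eqP->; rewrite normr0 expr0n.
rewrite !mulr1 => h; rewrite ler_sqr ?nnegrE//; exact: le_trans h.
Qed.

End UnitBall.

Section GaussianScore.
Context {R : realType}.
Local Notation leb := (@lebesgue_measure R).
Local Notation RT := (measurableTypeR R).
Local Notation K2 := (@gaussian_kernel R).
Local Notation intble f := (leb.-integrable setT (EFin \o f)).

(** The derivative of the Gaussian kernel. It replaces [K2] in the y-derivative of the estimator, at
    the price of a factor [- h2^-1]. *)
Definition score (v : R) : R := - v * K2 v.

Lemma score_le v : `|score v| <= (1 + v ^+ 2) * K2 v.
Proof.
rewrite /score normrM normrN (gtr0_norm (gaussian_gt0 v)).
by rewrite ler_wpM2r ?norm_le_sqr// ltW// gaussian_gt0.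
Qed.

Lemma score_bound v : `|score v| <= 2 * K2 0.
Proof.
apply: le_trans (score_le v) _; have := gaussian_decay v.
by have := gaussian_gt0 v; have := sqr_ge0 v; set q := v ^+ 2; set K := K2 v; nra.
Qed.

Lemma measurable_score : measurable_fun setT score.
Proof.
apply: measurable_funM => //.
by apply: continuous_measurable_fun; exact: continuous_gaussian.
Qed.

Hypothesis K2i : intble K2.
Hypothesis K2m : intble (fun v => v ^+ 2 * K2 v).

Lemma intble_score : intble score.
Proof.
by apply: (intble_le (mu := leb)) (intble_gaussian2 K2i K2m);
  [exact: measurable_score|exact: score_le].
Qed.

Lemma intble_score2 : intble (fun v => score v ^+ 2).
Proof.
apply: (intble_eq (mu := leb) (f := fun v => score v * score v)) => [v|].
  by rewrite expr2.
exact: (intbleM (mu := leb) intble_score measurable_score score_bound).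
Qed.

End GaussianScore.

(** * Mean and variance of the estimated slope *)

Section Deconvolution.
Context d (T : measurableType d) (R : realType) (P : probability T R).
Variables (X Y U : nat -> {RV P >-> R}) (p : R -> R -> R) (fU : R -> R).
Hypothesis HS : contaminated_sample X Y U p fU.
Local Notation leb := (@lebesgue_measure R).
Local Notation RT := (measurableTypeR R).
Local Notation K2 := (@gaussian_kernel R).
Local Notation intble f := (leb.-integrable setT (EFin \o f)).
Local Notation cosT := (cos_transform leb idfun).
Variables (K1 a : R -> R) (h1 B : R).
Hypotheses (K1i : intble K1) (K1m : intble (fun u => u ^+ 2 * K1 u)) (K1e : forall t, K1 (- t) = K1 t) (ki : intble (cosT K1)).
Hypotheses (h10 : 0 < h1) (ai : intble a) (aB : forall s, `|a s| <= B).
Hypothesis sinU : forall s, \int[P]_w sin (s * U 0%N w) = 0.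
Hypothesis aE : forall s, a s * \int[P]_w cos (s / h1 * U 0%N w) = cosT K1 s.

(* The deconvoluting kernel when s |-> phi_K1 s / phi_U (s / h1) is the real
   function a. *)
Definition dkernel (t : R) : R := (2 * pi)^-1 * cosT a t.

Let mid : measurable_fun setT (idfun : RT -> R). Proof. exact: (@measurable_id _ RT). Qed.

Lemma measurable_dkernel : measurable_fun setT dkernel.
Proof.
apply: measurable_funM => //.
exact: (measurable_cos_transform (mu := leb) mid ai).
Qed.

Lemma dkernel_bound t : `|dkernel t| <= (2 * pi)^-1 * \int[leb]_s `|a s|.
Proof.
rewrite /dkernel normrM ger0_norm ?invr_ge0 ?mulr_ge0 ?pi_ge0//.
rewrite ler_wpM2l ?invr_ge0 ?mulr_ge0 ?pi_ge0//.
exact: (cos_transform_bound (mu := leb) mid ai).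
Qed.

Lemma intble_dkernel2 : intble (fun t => dkernel t ^+ 2) /\
  \int[leb]_t dkernel t ^+ 2 <= (2 * pi)^-1 * \int[leb]_s a s ^+ 2.
Proof.
have pi2 : 0 < 2 * pi :> R by rewrite mulr_gt0// pi_gt0.
have H := cos_plancherel_le ai aB.
have mc : measurable_fun setT (fun t => cosT a t ^+ 2).
  apply: measurable_funX.
  exact: (measurable_cos_transform (mu := leb) mid ai).
have ci : intble (fun t => cosT a t ^+ 2).
  apply: (intble_ge0 (mu := leb)) => // [t|]; first exact: sqr_ge0.
  by apply: le_lt_trans H _; rewrite ltry.
have E t : dkernel t ^+ 2 = (2 * pi)^-1 ^+ 2 * cosT a t ^+ 2 by rewrite exprMn.
split.
  apply: (intble_eq (mu := leb) (f := fun t => (2 * pi)^-1 ^+ 2 * cosT a t ^+ 2)) => //.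
  exact: intbleZ.
have -> : \int[leb]_t dkernel t ^+ 2 =
    \int[leb]_t ((2 * pi)^-1 ^+ 2 * cosT a t ^+ 2).
  by apply: eq_Rintegral => t _; exact: E.
rewrite (RintegralZl _ measurableT ci) expr2 -mulrA ler_pM2l ?invr_gt0//.
by rewrite -(EFin_Rint ci) lee_fin in H; rewrite ler_pdivrMl.
Qed.

(* The mean of cos ((c + U / h1) * s) is cos (c * s) * phi_U (s / h1), which
   cancels the denominator of the deconvoluting kernel. *)
Lemma error_mean c :
  \int[P]_w dkernel (c + U 0%N w / h1) = (2 * pi)^-1 * cosT (cosT K1) c.
Proof.
have mF : measurable_fun setT (fun z : T * RT =>
    cos ((c + U 0%N z.1 / h1) * z.2) * a z.2).
  apply: measurable_funM; last first.
    exact: (measurableT_comp (intble_meas ai) (measurable_snd (T1 := T) (T2 := RT))).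
  apply: measurableT_comp; first exact: continuous_measurable_fun (@continuous_cos R).
  apply: measurable_funM; last exact: (measurable_snd (T1 := T) (T2 := RT)).
  apply: measurable_funD => //; apply: measurable_funM => //.
  exact: (measurableT_comp _ (measurable_fst (T1 := T) (T2 := RT))).
have i1 : P.-integrable setT (EFin \o (fun=> 1 : R)).
  exact: finite_measure_integrable_cst.
have bF (w : T) (s : RT) :
    `|cos ((c + U 0%N w / h1) * s) * a s| <= (fun=> 1) w * (fun s => `|a s|) s.
  by rewrite normrM ler_wpM2r// ler_norml cos_geN1 cos_le1.
have F := Rfubini_dom (m1 := P) (m2 := leb) mF bF i1 (intble_norm ai).
have I1 := intble_Rint1 (m1 := P) (m2 := leb) mF bF i1 (intble_norm ai).
transitivity ((2 * pi)^-1 *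
    \int[P]_w \int[leb]_s (cos ((c + U 0%N w / h1) * s) * a s)).
  by rewrite -(RintegralZl _ measurableT I1); apply: eq_Rintegral.
rewrite F; congr (_ * _); apply: eq_Rintegral => s _ /=.
have ic (f : R -> R) (t : R) : continuous f -> (forall x, `|f x| <= 1) ->
    P.-integrable setT (EFin \o (fun w => f (t * U 0%N w))).
  move=> cf f1; apply: (@bounded_intble _ _ _ P _ 1) => //.
  apply: measurableT_comp; first exact: continuous_measurable_fun.
  exact: measurable_funM.
have icos : P.-integrable setT (EFin \o (fun w => cos (s / h1 * U 0%N w))).
  by apply: ic => x; [exact: continuous_cos|rewrite ler_norml cos_geN1 cos_le1].
have isin : P.-integrable setT (EFin \o (fun w => sin (s / h1 * U 0%N w))).
  by apply: ic => x; [exact: continuous_sin|rewrite ler_norml sin_geN1 sin_le1].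
have -> : \int[P]_w (cos ((c + U 0%N w / h1) * s) * a s) =
    \int[P]_w ((a s * cos (c * s)) * cos (s / h1 * U 0%N w) -
               (a s * sin (c * s)) * sin (s / h1 * U 0%N w)).
  apply: eq_Rintegral => w _.
  have -> : (c + U 0%N w / h1) * s = c * s + s / h1 * U 0%N w by ring.
  by rewrite cosD; ring.
rewrite RintegralB//; [|exact: intbleZ|exact: intbleZ].
rewrite (RintegralZl _ measurableT icos) (RintegralZl _ measurableT isin).
by rewrite sinU mulr0 subr0 -aE mulrAC -mulrA mulrC; ring.
Qed.

Section moments.
Variables (py : R -> R -> R) (C h2 x y : R).
Hypotheses (K2i : intble K2) (K2m : intble (fun v => v ^+ 2 * K2 v)).
Hypothesis C0 : 0 <= C.
Hypothesis h20 : 0 < h2.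
Hypothesis Dp : forall a b : R, is_derive b 1 (p a) (py a b).
Hypothesis py_le : forall a b, `|py a b| <= C.
Hypothesis p_le : forall a b, `|p a b| <= C.
Hypothesis Lpy : forall a b a' b', `|py a b - py a' b'| <= C * (`|a - a'| + `|b - b'|).
Hypothesis mpy : measurable_fun setT (fun z : R * R => py z.1 z.2).

(* The y-derivative of the estimator is - (h1 * h2 ^+ 2)^-1 times the average of
   these summands. *)
Definition slope_summand (z : (R * R) * R) : R :=
  dkernel ((z.1.1 + z.2 - x) / h1) * score ((z.1.2 - y) / h2).

Let A0 : R := \int[leb]_s `|a s|.
Let D0 : R := (2 * pi)^-1 * A0 * (2 * K2 0).

Lemma measurable_slope_summand : measurable_fun setT slope_summand.
Proof.
have m3 (f g : (RT * RT) * RT -> R) : measurable_fun setT f -> measurable_fun setT g ->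
    measurable_fun setT (fun z => dkernel (f z) * score (g z)).
  move=> mf mg; apply: measurable_funM.
    exact: measurableT_comp measurable_dkernel mf.
  exact: measurableT_comp measurable_score mg.
apply: m3.
  apply: measurable_funM => //; apply: measurable_funB => //.
  apply: measurable_funD; last exact: (measurable_snd (T1 := (RT * RT)%type) (T2 := RT)).
  exact: (measurableT_comp (measurable_fst (T1 := RT) (T2 := RT))
     (measurable_fst (T1 := (RT * RT)%type) (T2 := RT))).
apply: measurable_funM => //; apply: measurable_funB => //.
exact: (measurableT_comp (measurable_snd (T1 := RT) (T2 := RT))
   (measurable_fst (T1 := (RT * RT)%type) (T2 := RT))).
Qed.

Lemma slope_summand_bound z : `|slope_summand z| <= D0.
Proof.
rewrite /slope_summand normrM ler_pM//; first exact: dkernel_bound.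
exact: score_bound.
Qed.

(** Smoothing of [py] in the second variable alone. It is bounded, Lipschitz and integrable, and
    after rescaling it is the test function in [cos_inversion]. *)
Let G (u : R) : R := \int[leb]_v (K2 v * py u (y + h2 * v)).

(** Boundedness of [py] and Gaussian decay give integrability for every [u]; the joint density by
    itself would give it for almost every [u] only. *)
Let ibp u : [/\ intble (fun v => score v * p u (y + h2 * v)),
    intble (fun v => K2 v * py u (y + h2 * v)) &
    \int[leb]_v (score v * p u (y + h2 * v)) = - h2 * G u].
Proof.
have Df (v : R) : is_derive v 1 (fun v => p u (y + h2 * v)) (h2 * py u (y + h2 * v)).
  rewrite mulrC; apply: (isd_comp (f := p u) (g := fun v => y + h2 * v)) => //.
  rewrite -[X in is_derive _ _ _ X]add0r -[X in _ + X]mulr1.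
  by apply: isd_add; apply: isd_scale; exact: isd_id.
have cpy : continuous (py u).
  apply: (@lip_continuous R (py u) C) => b b'; have := Lpy u b u b'.
  by rewrite subrr normr0 add0r.
have cf : continuous (fun v => h2 * py u (y + h2 * v)).
  move=> v; apply: cvgMr.
  apply: (continuous_comp (f := fun v : R => y + h2 * v) (g := py u)); last exact: cpy.
  by apply: cvgD; [exact: cvg_cst|apply: cvgMr; exact: cvg_id].
have bf v : `|h2 * py u (y + h2 * v)| <= h2 * C.
  by rewrite normrM gtr0_norm// ler_pM2l.
have [I1 I2 E] := gaussian_ibp K2i K2m Df cf bf.
have I3 : intble (fun v => K2 v * py u (y + h2 * v)).
  apply: (intble_eq (mu := leb) (f := fun v => h2^-1 * (K2 v * (h2 * py u (y + h2 * v))))).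
    by move=> v; rewrite (mulrCA (K2 v)) mulKf// gt_eqF.
  exact: intbleZ.
split => //; rewrite [LHS]E mulNr -(RintegralZl _ measurableT I3); congr (- _).
by apply: eq_Rintegral => v _; rewrite mulrCA.
Qed.

Let G_le u : `|G u| <= C * \int[leb]_v K2 v.
Proof.
have [_ I _] := ibp u; rewrite -(RintegralZl _ measurableT K2i).
apply: Rint_le_norm => //; first exact: intbleZ.
by move=> v; rewrite normrM (gtr0_norm (gaussian_gt0 v)) mulrC ler_wpM2r// ltW// gaussian_gt0.
Qed.

Let G_lip u u' : `|G u - G u'| <= (C * \int[leb]_v K2 v) * `|u - u'|.
Proof.
have [_ I _] := ibp u; have [_ I' _] := ibp u'.
rewrite -RintegralB// mulrAC -(RintegralZl _ measurableT K2i).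
apply: Rint_le_norm; [exact: intbleB|exact: intbleZ|move=> v].
rewrite -mulrBr normrM (gtr0_norm (gaussian_gt0 v)) mulrC ler_wpM2r//.
  by rewrite ltW// gaussian_gt0.
by have := Lpy u (y + h2 * v) u' (y + h2 * v); rewrite subrr normr0 addr0.
Qed.

Let invh (t z h : R) : h != 0 -> (t + h * z - t) / h = z.
Proof. by move=> h0; rewrite addrAC subrr add0r mulrC mulKf. Qed.

Let h2n0 : h2 != 0. Proof. by rewrite gt_eqF. Qed.
Let h1n0 : h1 != 0. Proof. by rewrite gt_eqF. Qed.

Let inner u : intble (fun b => score ((b - y) / h2) * p u b) /\
  \int[leb]_b (score ((b - y) / h2) * p u b) = - h2 ^+ 2 * G u.
Proof.
have [I _ E] := ibp u.
have I' : intble (fun b => score ((b - y) / h2) * p u b).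
  have := intble_affine (- y / h2) (invr_neq0 h2n0) I.
  apply: (intble_eq (mu := leb)) => b /=.
  have -> : - y / h2 + h2^-1 * b = (b - y) / h2 by rewrite mulrC -mulrDr mulrC addrC.
  by rewrite mulrCA mulfV// mulr1 addrCA subrr addr0.
split => //; rewrite (Rint_affine y h2n0 I') (gtr0_norm h20).
transitivity (h2 * \int[leb]_v (score v * p u (y + h2 * v))).
  by congr (_ * _); apply: eq_Rintegral => v _; rewrite invh.
by rewrite E; ring.
Qed.

Let mean_error (c : R) : \int[P]_w dkernel ((c + U 0%N w - x) / h1) =
  (2 * pi)^-1 * cosT (cosT K1) ((c - x) / h1).
Proof.
rewrite -error_mean; apply: eq_Rintegral => w _; congr dkernel.
by rewrite addrAC mulrDl.
Qed.

(** The error is averaged first, with the pair held fixed, which turns [dkernel] into the double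
    cosine transform of [K1] divided by 2 pi. Integration by parts in the second coordinate then
    produces [G], and inversion in the first coordinate replaces the double transform by [2 * pi]
    times [K1]. *)
Lemma slope_summand_mean j :
  \int[P]_w slope_summand (X j w, Y j w, U j w) =
  - (h1 * h2 ^+ 2 * smoothed K1 py h1 h2 x y).
Proof.
rewrite (Rint_observation HS j (phi := fun s u => slope_summand (s, u)) (M := D0)); last 2 first.
- by apply: eq_measurable_fun measurable_slope_summand => -[s u] _.
- by move=> s u; exact: slope_summand_bound.
have mcc : measurable_fun setT (cosT (cosT K1)).
  exact: (measurable_cos_transform (mu := leb) mid ki).
pose phi (z : R * R) : R :=
  ((2 * pi)^-1 * cosT (cosT K1) ((z.1 - x) / h1)) * score ((z.2 - y) / h2).
have mscore : measurable_fun setT (fun z : RT * RT => score ((z.2 - y) / h2)).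
  apply: measurableT_comp measurable_score _.
  by apply: measurable_funM => //; apply: measurable_funB => //.
have mphi : measurable_fun setT phi.
  apply: (measurable_funM (D := [set: RT * RT])) mscore.
  apply: measurable_funM => //; apply: measurableT_comp mcc _.
  by apply: measurable_funM => //; apply: measurable_funB => //.
pose A1 : R := \int[leb]_s `|cosT K1 s|.
have bphi z : `|phi z| <= (2 * pi)^-1 * A1 * (2 * K2 0).
  rewrite /phi normrM ler_pM//; last exact: score_bound.
  rewrite normrM ger0_norm ?invr_ge0 ?mulr_ge0 ?pi_ge0//.
  rewrite ler_wpM2l ?invr_ge0 ?mulr_ge0 ?pi_ge0//.
  exact: (cos_transform_bound (mu := leb) mid ki).
transitivity (\int[P]_w phi (X j w, Y j w)).
  apply: eq_Rintegral => w _.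
  rewrite (Rint_error HS j (phi := fun u => slope_summand (X j w, Y j w, u)) (M := D0)); last 2 first.
  - by apply: (measurableT_comp measurable_slope_summand); exact: measurable_fun_pair.
  - by move=> u; exact: slope_summand_bound.
  have I : P.-integrable setT (EFin \o (fun w' => dkernel ((X j w + U 0%N w' - x) / h1))).
    apply: (@bounded_intble _ _ _ P _ ((2 * pi)^-1 * A0)) => [|w']; last exact: dkernel_bound.
    apply: measurableT_comp measurable_dkernel _.
    by apply: measurable_funM => //; apply: measurable_funB => //; exact: measurable_funD.
  by rewrite /slope_summand /= (RintegralZr _ measurableT I) mean_error.
have [Iphi ->] := Rint_pair_density HS j mphi bphi.
have section_intble (c : R) u : intble (fun b => c * score ((b - y) / h2) * p u b).
  apply: (intble_eq (mu := leb) (f := fun b => c * (score ((b - y) / h2) * p u b))).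
    by move=> b; rewrite mulrA.
  by apply: intbleZ; have [] := inner u.
have section_int (c : R) u :
    \int[leb]_b (c * score ((b - y) / h2) * p u b) = c * (- h2 ^+ 2 * G u).
  have [I <-] := inner u; rewrite -(RintegralZl _ measurableT I).
  by apply: eq_Rintegral => b _; rewrite mulrA.
have section_phi (u : RT) : intble (fun b : RT =>
    (fun s : RT * RT => phi s * p s.1 s.2) (u, b)).
  exact: (section_intble ((2 * pi)^-1 * cosT (cosT K1) ((u - x) / h1)) u).
have Hphi := Rint_prod1 (m1 := leb) (m2 := leb)
  (F := fun s : RT * RT => phi s * p s.1 s.2) Iphi section_phi.
have [I1 E1] := Hphi; rewrite -[LHS]E1.
have bscore (z : R * R) : `|score ((z.2 - y) / h2)| <= 2 * K2 0 by exact: score_bound.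
have [Isc _] := Rint_pair_density HS j mscore bscore.
(* Up to a constant factor, [G] is the section integral of a bounded function times the joint
   density, hence integrable by Fubini. *)
have Gi : intble G.
  have sec u : intble (fun b => score ((b - y) / h2) * p u b) by have [] := inner u.
  have [I2 _] := Rint_prod1 (m1 := leb) (m2 := leb)
    (F := fun s : RT * RT => score ((s.2 - y) / h2) * p s.1 s.2) Isc sec.
  apply: (intble_eq (mu := leb) (f := fun u => (- h2 ^+ 2)^-1 *
      \int[leb]_b (score ((b - y) / h2) * p u b))); last exact: intbleZ.
  by move=> u; have [_ ->] := inner u; rewrite mulKf// oppr_eq0 expf_neq0.
pose g u := G (x + h1 * u).
have gi : intble g by exact: (intble_affine x h1n0 Gi).
have gc : continuous g.
  apply: (@lip_continuous R g (C * \int[leb]_v K2 v * h1)) => s t.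
  apply: le_trans (G_lip _ _) _.
  by rewrite opprD addrACA subrr add0r -mulrBr normrM (gtr0_norm h10) mulrA.
have inv := cos_inversion K1i K1e gi ki (fun u => G_le (x + h1 * u)) gc.
have ccg : intble (fun u => cosT (cosT K1) u * g u).
  apply: (intble_eq (mu := leb) (f := fun u => g u * cosT (cosT K1) u)).
    by move=> u; rewrite mulrC.
  apply: (intbleM (mu := leb) (M := A1) gi mcc) => u.
  exact: (cos_transform_bound (mu := leb) mid ki).
transitivity (\int[leb]_u ((2 * pi)^-1 * cosT (cosT K1) ((u - x) / h1) * (- h2 ^+ 2 * G u))).
  by apply: eq_Rintegral => u _; exact: (section_int ((2 * pi)^-1 * cosT (cosT K1) ((u - x) / h1)) u).
have I3 : intble (fun u => (2 * pi)^-1 * cosT (cosT K1) ((u - x) / h1) * (- h2 ^+ 2 * G u)).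
  by apply: (intble_eq (mu := leb) _ I1) => u; exact: (section_int ((2 * pi)^-1 * cosT (cosT K1) ((u - x) / h1)) u).
rewrite (Rint_affine x h1n0 I3) (gtr0_norm h10).
transitivity (h1 * \int[leb]_u ((2 * pi)^-1 * - h2 ^+ 2 * (cosT (cosT K1) u * g u))).
  by congr (_ * _); apply: eq_Rintegral => u _; rewrite invh// mulrACA.
rewrite (RintegralZl _ measurableT ccg) inv.
have -> : smoothed K1 py h1 h2 x y = \int[leb]_u (K1 u * g u).
  have Is := smoothed_intble K1i K1m K2i K2m C0 Lpy mpy x (ltW h10) (ltW h20) y.
  have E u v : weight K1 (u, v) * py (x + h1 * u) (y + h2 * v) =
     K1 u * (K2 v * py (x + h1 * u) (y + h2 * v)) by rewrite /weight mulrA.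
  have Isec u : intble (fun v => weight K1 (u, v) * py (x + h1 * u) (y + h2 * v)).
    apply: (intble_eq (mu := leb)
      (f := fun v => K1 u * (K2 v * py (x + h1 * u) (y + h2 * v)))) => [v|].
      by rewrite E.
    by apply: intbleZ; have [] := ibp (x + h1 * u).
  have [_ H] := Rint_prod1 (m1 := leb) (m2 := leb)
    (F := fun z : RT * RT => weight K1 z * py (x + h1 * z.1) (y + h2 * z.2)) Is Isec.
  rewrite /smoothed /kernel_mean -[LHS]H; apply: eq_Rintegral => u _.
  have [_ I _] := ibp (x + h1 * u); rewrite -(RintegralZl _ measurableT I).
  by apply: eq_Rintegral => v _; exact: E.
have pi0 : 2 * pi != 0 :> R by rewrite mulf_neq0// gt_eqF// pi_gt0.
by move: (2 * pi) (\int[leb]_t (K1 t * g t)) pi0 => q I q0; field.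
Qed.

(** At a fixed value of the error, which only translates the argument of [dkernel], the density is
    bounded by [C]; rescaling both coordinates then produces [h1 * h2] and a bound free of the
    error. *)
Lemma slope_summand_second_moment j :
  \int[P]_w slope_summand (X j w, Y j w, U j w) ^+ 2 <=
  C * (h1 * h2) * (\int[leb]_t dkernel t ^+ 2 * \int[leb]_v score v ^+ 2).
Proof.
have mss2 : measurable_fun setT (fun z => slope_summand z ^+ 2).
  by apply: measurable_funX; exact: measurable_slope_summand.
have bss2 z : `|slope_summand z ^+ 2| <= D0 ^+ 2.
  rewrite normrX lerXn2r ?nnegrE//; last exact: slope_summand_bound.
  exact: le_trans (normr_ge0 _) (slope_summand_bound z).
rewrite (Rint_observation HS j (phi := fun s u => slope_summand (s, u) ^+ 2) (M := D0 ^+ 2)); last 2 first.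
- by apply: eq_measurable_fun mss2 => -[s u] _.
- by move=> s u; exact: bss2.
set Bd := (X in _ <= X).
have mF : measurable_fun setT (fun z : T * T =>
    slope_summand (X j z.1, Y j z.1, U j z.2) ^+ 2).
  apply: (measurableT_comp mss2).
  have m1 : measurable_fun setT (fun z : T * T => z.1) by exact: measurable_fst.
  have m2 : measurable_fun setT (fun z : T * T => z.2) by exact: measurable_snd.
  by apply: measurable_fun_pair; [apply: measurable_fun_pair|];
    exact: measurableT_comp.
have icst (c : R) : P.-integrable setT (EFin \o (fun=> c)).
  exact: finite_measure_integrable_cst.
have bF (w w' : T) : `|slope_summand (X j w, Y j w, U j w') ^+ 2| <=
    (fun=> D0 ^+ 2) w * (fun=> 1) w' by rewrite mulr1.
rewrite (Rfubini_dom (m1 := P) (m2 := P) mF bF (icst _) (icst _)).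
have I2 := intble_Rint2 (m1 := P) (m2 := P) mF bF (icst _) (icst _).
rewrite -[leRHS](Rint_prob_cst P); apply: (le_trans (ler_norm _)).
apply: Rint_le_norm => // w'; rewrite ger0_norm; last first.
  by apply: Rintegral_ge0 => // w _; exact: sqr_ge0.
rewrite /=; move: (U j w') => u.
pose phi (z : R * R) := slope_summand (z, u) ^+ 2.
have mphi : measurable_fun setT phi.
  by apply: (measurableT_comp mss2); exact: measurable_fun_pair.
have [I ->] := Rint_pair_density HS j mphi (fun z => bss2 (z, u)).
have [D2i _] := intble_dkernel2.
have S2i := intble_score2 K2i K2m.
pose f1 t := dkernel ((t + u - x) / h1) ^+ 2.
pose f2 t := score ((t - y) / h2) ^+ 2.
have e1 t : (u - x) / h1 + h1^-1 * t = (t + u - x) / h1.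
  by rewrite mulrC -mulrDr mulrC addrC addrA.
have e2 t : - y / h2 + h2^-1 * t = (t - y) / h2.
  by rewrite mulrC -mulrDr mulrC addrC.
have i1 : intble f1.
  apply: (intble_eq (mu := leb) _ (intble_affine ((u - x) / h1) (invr_neq0 h1n0) D2i)) => t.
  by rewrite /f1 /= e1.
have i2 : intble f2.
  apply: (intble_eq (mu := leb) _ (intble_affine (- y / h2) (invr_neq0 h2n0) S2i)) => t.
  by rewrite /f2 /= e2.
have E1 : \int[leb]_t f1 t = h1 * \int[leb]_t dkernel t ^+ 2.
  rewrite (Rint_affine (x - u) h1n0 i1) (gtr0_norm h10); congr (_ * _).
  apply: eq_Rintegral => t _; rewrite /f1; congr (dkernel _ ^+ 2).
  by rewrite (_ : _ + u - x = 0 + h1 * t - 0) ?invh//; ring.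
have E2 : \int[leb]_t f2 t = h2 * \int[leb]_t score t ^+ 2.
  rewrite (Rint_affine y h2n0 i2) (gtr0_norm h20); congr (_ * _).
  by apply: eq_Rintegral => t _; rewrite /f2 invh.
have [i12 E12] := Rint_prodM i1 i2.
have -> : Bd = \int[(leb \x leb)%E]_z (C * (f1 z.1 * f2 z.2)).
  by rewrite (RintegralZl _ measurableT i12) E12 E1 E2 /Bd; ring.
apply: (le_trans (ler_norm _)); apply: Rint_le_norm => //; first exact: intbleZ.
move=> [s t] /=; rewrite normrM mulrC /phi /slope_summand /= exprMn.
rewrite [X in _ * X]ger0_norm; last by rewrite mulr_ge0// sqr_ge0.
by rewrite ler_wpM2r// mulr_ge0// sqr_ge0.
Qed.

Hypothesis a0 : forall s, 1 < `|s| -> a s = 0.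

(** The second moment, of order [h1 * h2], is divided by the square of the scale [h1 * h2 ^ 2],
    which leaves [h1 * h2 ^ 3] in the denominator. The factor [(2 * pi)^-1] comes from Plancherel's
    inequality, and [2 * B ^ 2] bounds the integral of the square of [a] over an interval of length
    2. *)
Lemma slope_tail n t : (0 < n)%N -> 0 < t ->
  (P [set w | (t <= `| - ((h1 * h2 ^+ 2)^-1 * (n%:R^-1 *
       \sum_(j < n) slope_summand (X j w, Y j w, U j w)))
       - smoothed K1 py h1 h2 x y|)%R] <=
   (C * ((2 * pi)^-1 * (2 * B ^+ 2) * \int[leb]_v score v ^+ 2) /
     (n%:R * h1 * h2 ^+ 3 * t ^+ 2))%:E)%E.
Proof.
move=> n0 t0; set Q := smoothed _ _ _ _ _ _; set S2 := \int[leb]_v _.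
pose q := h1 * h2 ^+ 2; have q0 : 0 < q by rewrite mulr_gt0// exprn_gt0.
have mss := measurable_slope_summand.
have mV j : measurable_fun setT (fun w => (X j w, Y j w, U j w)).
  by apply: measurable_fun_pair => //; exact: measurable_fun_pair.
have mean := slope_summand_mean.
have bss := slope_summand_bound.
have mom := slope_summand_second_moment.
have := @uncorrelated_average_tail _ _ _ P
  (fun j w => slope_summand (X j w, Y j w, U j w)) _ _ _ n (q * t)
  (fun j => measurableT_comp mss (mV j)) (fun j w => bss _) mean
  (fun i j ij => observations_uncorrelated HS ij mss bss mean) mom n0 (mulr_gt0 q0 t0).
move=> H; have S20 : 0 <= S2 by apply: Rintegral_ge0 => // v _; exact: sqr_ge0.
have [_ D2] := intble_dkernel2.
have A2 := Rint_sqr_supported (intble_meas ai) aB a0.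
have n0R : 0 < n%:R :> R by rewrite ltr0n.
set lhs := P _; rewrite (_ : lhs = P [set w | (q * t <= `|n%:R^-1 *
   \sum_(j < n) slope_summand (X j w, Y j w, U j w) - - (q * Q)|)%R]); last first.
  congr (P _); apply/seteqP; split => w /=; set A := n%:R^-1 * _;
  have -> : - (q^-1 * A) - Q = - (q^-1 * (A - - (q * Q))) by field; rewrite gt_eqF.
    by rewrite normrN normrM (gtr0_norm (x := q^-1)) ?invr_gt0// ler_pdivlMl.
  by rewrite normrN normrM (gtr0_norm (x := q^-1)) ?invr_gt0// ler_pdivlMl.
apply: (le_trans H); rewrite lee_fin.
set D2v := \int[leb]_t _ in D2 *.
have -> : C * ((2 * pi)^-1 * (2 * B ^+ 2) * S2) / (n%:R * h1 * h2 ^+ 3 * t ^+ 2) =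
   C * (h1 * h2) * ((2 * pi)^-1 * (2 * B ^+ 2) * S2) / (n%:R * (q * t) ^+ 2).
  rewrite /q; move: ((2 * pi)^-1) => ip; field.
  by rewrite !gt_eqF// ?ltr0n.
rewrite ler_wpM2r//; first by rewrite invr_ge0; apply: mulr_ge0 => //; exact: sqr_ge0.
rewrite ler_wpM2l ?mulr_ge0 ?(ltW h10) ?(ltW h20)//.
rewrite ler_wpM2r//; apply: le_trans D2 _.
by rewrite ler_wpM2l// invr_ge0 mulr_ge0// pi_ge0.
Qed.

End moments.

End Deconvolution.

(** * Reduction to real transforms and lower bounds *)

Section ComplexToReal.
Context {R : realType}.
Local Open Scope complex_scope.
Local Notation leb := (@lebesgue_measure R).
Local Notation RT := (measurableTypeR R).
Local Notation intble f := (leb.-integrable setT (EFin \o f)).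
Local Notation cosT := (cos_transform leb idfun).

Lemma cabs_real (r : R) : cabs r%:C = `|r|.
Proof. by rewrite /cabs /ComplexField.Normc.normc /= expr0n /= addr0 sqrtr_sqr. Qed.

Let mid : measurable_fun setT (idfun : RT -> R). Proof. exact: (@measurable_id _ RT). Qed.

Lemma fourier_even (K : R -> R) : intble K -> (forall t, K (- t) = K t) ->
  forall s, fourier K s = (cosT K s)%:C.
Proof.
move=> Ki Ke s; rewrite /fourier /cintegral /=.
have isin : intble (fun t => sin (t * s) * K t).
  apply: (intble_eq (mu := leb) (f := fun t => K t * sin (t * s))).
    by move=> t; rewrite mulrC.
  apply: (intbleM (mu := leb) (M := 1) Ki).
    apply: measurableT_comp; first exact: continuous_measurable_fun (@continuous_sin R).
    exact: measurable_funM.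
  by move=> t; rewrite ler_norml sin_geN1 sin_le1.
congr (_ +i* _).
  by apply: eq_Rintegral => t _ /=; rewrite mulr0 subr0 (mulrC t).
transitivity (\int[leb]_t (sin (t * s) * K t)).
  by apply: eq_Rintegral => t _ /=; rewrite mulr0 add0r.
by apply: Rint_odd => // t; rewrite mulNr sinN Ke mulNr.
Qed.

(** The imaginary part of a characteristic function is odd; being even as well, it vanishes. *)
Lemma charfun_even d (T : measurableType d) (P : probability T R) (X : {RV P >-> R}) :
  (forall t, charfun X (- t) = charfun X t) ->
  (forall s, \int[P]_w sin (s * X w) = 0) /\
  (forall s, charfun X s = (\int[P]_w cos (s * X w))%:C).
Proof.
move=> ev; have S s : \int[P]_w sin (s * X w) = 0.
  have I : P.-integrable setT (EFin \o (fun w => sin (s * X w))).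
    apply: (@bounded_intble _ _ _ P _ 1) => [|w]; last by rewrite ler_norml sin_geN1 sin_le1.
    apply: measurableT_comp; first exact: continuous_measurable_fun (@continuous_sin R).
    exact: measurable_funM.
  have := congr1 (@complex.Im R) (ev s); rewrite /charfun /cintegral /=.
  have -> : \int[P]_w sin (- s * X w) = - \int[P]_w sin (s * X w).
    by rewrite -(RintegralN I); apply: eq_Rintegral => w _; rewrite mulNr sinN.
  lra.
by split => // s; rewrite /charfun /cintegral /= S.
Qed.

Lemma deconvoluting_kernel_real (phiK phiU : R -> R[i]) (k u : R -> R) h t :
  (forall s, phiK s = (k s)%:C) -> (forall s, phiU s = (u s)%:C) ->
  deconvoluting_kernel phiK phiU h t = dkernel (fun s => k s / u (s / h)) t.
Proof.
move=> Ek Eu; rewrite /deconvoluting_kernel /cintegral /= mul0r subr0.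
congr (_ * _); apply: eq_Rintegral => s _.
rewrite Ek Eu -(fmorphV (real_complex R)) -(rmorphM (real_complex R)) /= mulr0 subr0.
by rewrite cosN.
Qed.

End ComplexToReal.

(** * Lower bounds on the characteristic function of the error *)

Section Bounds.
Context {R : realType}.
Local Notation leb := (@lebesgue_measure R).
Local Notation intble f := (leb.-integrable setT (EFin \o f)).

(** The modulus of [u] has a positive minimum on [[0, t0]] and obeys the decay bound beyond. The
    factor [B0] admits a weight that is increasing only up to a constant, because the super smooth
    weight may decrease near 1. *)
Lemma inverse_bound (u W : R -> R) (B0 t0 c : R) :
  continuous u -> (forall t, u t != 0) -> (forall t, u (- t) = u t) ->
  0 < c -> 1 <= t0 -> (forall t, t0 <= t -> c <= `|u t| * W t) ->
  (forall t, 1 <= t -> 0 < W t) -> 0 < B0 ->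
  (forall t r, 1 <= t -> t <= r -> W t <= B0 * W r) ->
  exists2 A, 0 < A & forall r t, 1 <= r -> `|t| <= r -> `|u t|^-1 <= A * W r.
Proof.
move=> cu u0 ue c0 t01 Hc W0 B00 HW.
have cn : {within `[0, t0], continuous (fun t => `|u t|)}.
  by apply: continuous_subspaceT => t; apply: cvg_norm; exact: cu.
have [z _ zmin] := EVT_min (le_trans ler01 t01) cn.
have z0 : 0 < `|u z| by rewrite normr_gt0.
have un t : `|u `|t| | = `|u t|.
  by have [h|h] := leP 0 t; [rewrite (ger0_norm h)|rewrite (ltr0_norm h) ue].
(* The first summand serves arguments of modulus at most [t0], where [W r] is compared with [W 1];
   the second serves the larger ones. *)
exists (B0 * (`|u z|^-1 / W 1 + c^-1)).
  by rewrite mulr_gt0// addr_gt0 ?divr_gt0 ?invr_gt0// W0.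
move=> r t r1 tr; have Wr := W0 r r1.
have W1 : 0 < W 1 by exact: W0.
have H1 := HW 1 r (lexx _) r1.
have uz0 : 0 <= `|u z|^-1 / W 1 by rewrite mulr_ge0 ?invr_ge0// ltW.
have cV : 0 <= c^-1 by rewrite invr_ge0 ltW.
have BW : 0 <= B0 * W r by rewrite mulr_ge0// ltW.
rewrite mulrAC mulrDr -un; have [h|h] := leP `|t| t0.
  apply: (@le_trans _ _ (`|u z|^-1)).
    rewrite lef_pV2 ?posrE ?normr_gt0//; apply: zmin.
    by rewrite in_itv/= normr_ge0.
  apply: (@le_trans _ _ (B0 * W r * (`|u z|^-1 / W 1))); last by rewrite lerDl mulr_ge0.
  by rewrite mulrCA -[leLHS]mulr1 ler_wpM2l ?invr_ge0// ler_pdivlMr// mul1r.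
have t1 : 1 <= `|t| by exact: le_trans t01 (ltW h).
have ut : 0 < `|u `|t| | by rewrite normr_gt0.
apply: (@le_trans _ _ (B0 * W r * c^-1)); last by rewrite lerDr mulr_ge0.
rewrite ler_pdivlMr// mulrC -ler_pdivlMr ?invr_gt0// invrK mulrC.
by apply: le_trans (Hc _ (ltW h)) _; rewrite ler_wpM2l// HW.
Qed.

(** The inequality [ln y <= y] at [y = c / a * x], multiplied by [a]; the constant is [a / c] to the
    power [a]. *)
Lemma powR_le_expR (a c : R) : 0 < a -> 0 < c ->
  exists2 B, 0 < B & forall x, 1 <= x -> x `^ a <= B * expR (c * x).
Proof.
move=> a0 c0; exists (expR (- a * ln (c / a))); first exact: expR_gt0.
move=> x x1; have x0 : 0 < x by exact: lt_le_trans ltr01 x1.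
have ca : 0 < c / a by exact: divr_gt0.
rewrite -expRD /powR gt_eqF// ler_expR.
have : ln (c / a * x) <= c / a * x by apply/ltW/ln_sublinear; rewrite mulr_gt0.
rewrite lnM ?posrE// -(ler_pM2l a0) mulrDr mulrA (mulrCA a) divff ?gt_eqF// mulr1; lra.
Qed.

Lemma powR_ge1 (x b : R) : 1 <= x -> 0 <= b -> 1 <= x `^ b.
Proof.
move=> x1 b_0; have x0 : 0 < x by exact: lt_le_trans ltr01 x1.
by rewrite /powR gt_eqF// -expR0 ler_expR mulr_ge0// ln_ge0.
Qed.

(* With q = r / t, the ratio of the two weights is
   q `^ b0 * expR (- (q `^ b - 1) * t `^ b / d2), which is bounded as t >= 1. *)
Lemma super_smooth_weight_monotone (b d2 b0 : R) : 0 < b -> 0 < d2 -> 0 < b0 ->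
  exists2 B, 0 < B & forall t r, 1 <= t -> t <= r ->
    t `^ (- b0) * expR (t `^ b / d2) <= B * (r `^ (- b0) * expR (r `^ b / d2)).
Proof.
move=> b_0 d20 b00.
have [B B0 HB] := powR_le_expR (divr_gt0 b00 b_0) (divr_gt0 ltr01 d20).
exists (B * expR d2^-1); first by rewrite mulr_gt0// expR_gt0.
move=> t r t1 tr.
have t0 : 0 < t by exact: lt_le_trans ltr01 t1.
have r0 : 0 < r by exact: lt_le_trans t0 tr.
pose q := r / t; have q1 : 1 <= q by rewrite /q ler_pdivlMr// mul1r.
have q0 : 0 < q by exact: lt_le_trans ltr01 q1.
have qb1 : 1 <= q `^ b by exact: powR_ge1 (ltW b_0).
have tb1 : 1 <= t `^ b by exact: powR_ge1 (ltW b_0).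
have rE : r = q * t by rewrite /q divfK// gt_eqF.
have rb : r `^ b = q `^ b * t `^ b by rewrite rE powRM// ltW.
have rb0 : r `^ (- b0) = q `^ (- b0) * t `^ (- b0) by rewrite rE powRM// ltW.
have key : q `^ b0 <= B * expR (d2^-1 * q `^ b).
  have := HB _ qb1; rewrite -powRrM mul1r.
  by rewrite (_ : b * (b0 / b) = b0)// mulrCA divff ?mulr1// gt_eqF.
rewrite rb0 rb.
have qq : q `^ (- b0) * q `^ b0 = 1 by rewrite powRN mulVf// gt_eqF// powR_gt0.
have e : expR (t `^ b / d2) * expR (d2^-1 * q `^ b) <=
    expR d2^-1 * expR (q `^ b * t `^ b / d2).
  rewrite -!expRD ler_expR -subr_ge0.
  have -> : d2^-1 + q `^ b * t `^ b / d2 - (t `^ b / d2 + d2^-1 * q `^ b) =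
    ((q `^ b - 1) * (t `^ b - 1)) / d2 by ring.
  by rewrite divr_ge0 ?mulr_ge0 ?subr_ge0// ltW.
have tn : 0 <= t `^ (- b0) by exact: powR_ge0.
have qn : 0 <= q `^ (- b0) by exact: powR_ge0.
move: tn qn (expR_ge0 (t `^ b / d2)) (B0) key qq e.
move: (t `^ (- b0)) (q `^ (- b0)) (q `^ b0) (expR (t `^ b / d2)) (expR (d2^-1 * q `^ b))
  (expR d2^-1) (expR (q `^ b * t `^ b / d2)) => tn qn qp et eq ed er tn0 qn0 et0 B1 key qq e.
have h1 : et * 1 <= (qn * B) * (et * eq).
  rewrite -qq mulrCA -mulrA ler_wpM2l// mulrCA ler_wpM2l//.
have h2 : (qn * B) * (et * eq) <= (qn * B) * (ed * er).
  by rewrite ler_wpM2l// mulr_ge0// ltW.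
have := ler_wpM2l tn0 (le_trans h1 h2); rewrite mulr1.
by congr (_ <= _); ring.
Qed.

End Bounds.

Section Support.
Context {R : realType}.
Local Notation leb := (@lebesgue_measure R).

(** Uniqueness of the estimated mode is granted only inside [supportY p], so the zero that is
    located near y_M must be known to lie there. Some [p u y] is positive, and [r] is chosen so that
    the Lipschitz loss over the distance [r] in each coordinate is at most half of it. *)
Lemma supportY_nbhs (p : R -> R -> R) (C y : R) : (forall a b, 0 <= p a b) ->
  (forall a b a' b', `|p a b - p a' b'| <= C * (`|a - a'| + `|b - b'|)) ->
  supportY p y -> exists2 r, 0 < r & forall y', `|y' - y| < r -> supportY p y'.
Proof.
move=> p0 L yS; set D := `|C| + 1.
have D0 : 0 < D by rewrite /D ltr_wpDl.
have {}L a b a' b' : `|p a b - p a' b'| <= D * (`|a - a'| + `|b - b'|).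
  apply: le_trans (L _ _ _ _) _; rewrite ler_wpM2r ?addr_ge0//.
  by rewrite (le_trans (ler_norm C))// lerDl.
have [u pu] : exists u, 0 < p u y.
  apply: contrapT => /forallNP H; move: yS; rewrite /supportY /=.
  rewrite integral0_eq ?ltxx// => u _; congr EFin; apply/eqP.
  by rewrite eq_le p0 andbT leNgt; apply/negP; exact: H.
pose r := p u y / (4 * D); have r0 : 0 < r by rewrite divr_gt0// mulr_gt0.
have Dr : D * r = p u y / 4 by rewrite /r; field; rewrite gt_eqF.
exists r => // y' y'r; rewrite /supportY /=.
pose I : set R := [set` `[u - r, u + r]]; have mI : measurable I by exact: measurable_itv.
have lI : leb I = (2 * r)%:E.
  rewrite /I lebesgue_measure_itv /= lte_fin ifT; last by lra.
  by rewrite -EFinB; congr EFin; ring.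
apply: (@lt_le_trans _ _ ((p u y / 2)%:E * leb I)%E).
  rewrite lI -EFinM lte_fin; apply: mulr_gt0; first by rewrite divr_gt0.
  by rewrite mulr_gt0.
rewrite -integral_cst//.
have mp : measurable_fun setT (fun a => p a y').
  apply: continuous_measurable_fun; apply: (@lip_continuous R _ D) => a a'.
  by have := L a y' a' y'; rewrite subrr normr0 addr0.
apply: (@le_trans _ _ (\int[leb]_(a in I) (p a y')%:E)%E).
  apply: ge0_le_integral => //.
  - by move=> a _; rewrite lee_fin divr_ge0// p0.
  - by apply/measurable_EFinP; exact: measurable_funTS.
  - move=> a; rewrite /I /= in_itv/= => /andP[a1 a2]; rewrite lee_fin.
    have ha : `|u - a| <= r by rewrite ler_norml; apply/andP; split; lra.
    have := L u y a y'; have := ler_norm (p u y - p a y').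
    have : D * (`|u - a| + `|y - y'|) <= D * (r + r).
      by rewrite ler_wpM2l ?(ltW D0)// lerD// distrC ltW.
    rewrite (mulrDr D r r) Dr; lra.
apply: ge0_subset_integral => //; first by apply/measurable_EFinP.
by move=> a _; rewrite lee_fin.
Qed.

End Support.

Section SlopeEstimator.
Context {R : realType}.
Local Notation K2 := (@gaussian_kernel R).

Lemma slope_estimatorE (KU : R -> R) (h1 h2 : R) n (W Y : nat -> R) x y : h2 != 0 ->
  dy (density_estimator KU K2 h1 h2 n W Y) x y =
  - ((h1 * h2 ^+ 2)^-1 *
     (n%:R^-1 * \sum_(j < n) KU ((W j - x) / h1) * score ((Y j - y) / h2))).
Proof.
move=> h20; rewrite /dy /density_estimator; apply: der_derive1.
have D (m : nat) : is_derive y 1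
    (fun v : R => \sum_(j < m) KU ((W j - x) / h1) * K2 ((Y j - v) / h2))
    (- h2^-1 * \sum_(j < m) KU ((W j - x) / h1) * score ((Y j - y) / h2)).
  elim: m => [|m IH].
    rewrite big_ord0 mulr0.
    rewrite (_ : (fun v : R => _) = (fun=> 0)); first exact: isd_cst.
    by apply: funext => v; rewrite big_ord0.
  rewrite (_ : (fun v : R => _) = (fun v : R =>
      \sum_(j < m) KU ((W j - x) / h1) * K2 ((Y j - v) / h2) +
      KU ((W m - x) / h1) * K2 ((Y m - v) / h2))); last first.
    by apply: funext => v; rewrite big_ord_recr.
  rewrite big_ord_recr /= mulrDr; apply: isd_add => //.
  rewrite mulrCA; apply: isd_scale; rewrite mulrC /score.
  apply: (isd_comp (f := K2) (g := fun v : R => (Y m - v) / h2)).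
    exact: gaussian_der.
  rewrite (_ : (fun v : R => _) = (fun v : R => Y m / h2 + (- h2^-1) * v)); last first.
    by apply: funext => v; rewrite mulrBl mulNr (mulrC v).
  rewrite -[X in is_derive _ _ _ X]add0r -[X in _ + X]mulr1.
  by apply: isd_add; apply: isd_scale; exact: isd_id.
have := isd_scale ((n%:R * h1 * h2)^-1) (D n).
rewrite (_ : _ * (_ * _) = - ((h1 * h2 ^+ 2)^-1 *
     (n%:R^-1 * \sum_(j < n) KU ((W j - x) / h1) * score ((Y j - y) / h2))))//.
have -> : (n%:R * h1 * h2)^-1 = n%:R^-1 * h1^-1 * h2^-1 by rewrite !invfM.
have -> : (h1 * h2 ^+ 2)^-1 = h1^-1 * (h2^-1 * h2^-1) by rewrite expr2 !invfM.
by move: (n%:R^-1) (h1^-1) (h2^-1) (\sum_(j < n) _) => i1 i2 i3 s; ring.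
Qed.

Lemma continuous_score_sum (c Y : nat -> R) (h2 : R) n :
  continuous (fun y => \sum_(j < n) c j * score ((Y j - y) / h2)).
Proof.
have cs : continuous (@score R).
  by move=> v; apply: cvgM; [exact: cvgN|exact: continuous_gaussian].
elim: n => [|n IH] y.
  rewrite (_ : (fun y : R => _) = (fun=> 0)); first exact: cvg_cst.
  by apply: funext => v; rewrite big_ord0.
rewrite (_ : (fun y : R => _) = (fun y : R =>
   \sum_(j < n) c j * score ((Y j - y) / h2) + c n * score ((Y n - y) / h2))); last first.
  by apply: funext => v; rewrite big_ord_recr.
apply: cvgD; first exact: IH.
apply: cvgMr; apply: (continuous_comp (f := fun v : R => (Y n - v) / h2) (g := @score R)).
  by apply: cvgMl; apply: cvgB; [exact: cvg_cst|exact: cvg_id].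
exact: cs.
Qed.

End SlopeEstimator.

(** * Localization of the estimated zero *)

Section Localization.
Context d (T : measurableType d) (R : realType) (P : probability T R).
Variables (S : nat -> T -> R -> R) (Q : nat -> R -> R) (yhat : nat -> {RV P >-> R}).
Variables (D : set R) (y0 c Ct : R) (tn r : nat -> R).
Hypotheses (c0 : 0 < c) (Ct0 : 0 <= Ct).
Hypothesis cS : forall n w, continuous (S n w).
Hypothesis mS : forall n y, measurable_fun setT (S n ^~ y).
Hypothesis r0 : \forall n \near \oo, 0 < r n.
Hypothesis tail : \forall n \near \oo, forall y t, 0 < t ->
  (P [set w | (t <= `|S n w y - Q n y|)%R] <= (Ct * r n ^+ 2 / t ^+ 2)%:E)%E.
Hypothesis slope : forall M, 0 < M -> \forall n \near \oo,
  [/\ Q n (y0 + tn n + M * r n) <= - c * (M * r n),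
      c * (M * r n) <= Q n (y0 + tn n - M * r n) &
      forall y, `|y - (y0 + tn n)| <= M * r n -> D y].
Hypothesis single : with_probability_tending_to_one P (fun n => [set w |
  S n w (yhat n w) = 0 /\ forall y, D y -> S n w y = 0 -> y = yhat n w]).

(* The sign of S n w changes between y0 + tn n - M * r n and y0 + tn n + M * r n,
   and the zero in between is yhat n w by uniqueness. *)
Lemma zero_localized n w M : 0 < M * r n ->
  Q n (y0 + tn n + M * r n) <= - c * (M * r n) ->
  c * (M * r n) <= Q n (y0 + tn n - M * r n) ->
  (forall y, `|y - (y0 + tn n)| <= M * r n -> D y) ->
  (forall y, D y -> S n w y = 0 -> y = yhat n w) ->
  `|S n w (y0 + tn n + M * r n) - Q n (y0 + tn n + M * r n)| < c * (M * r n) ->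
  `|S n w (y0 + tn n - M * r n) - Q n (y0 + tn n - M * r n)| < c * (M * r n) ->
  `| `|yhat n w - y0| - `|tn n| | <= M * r n.
Proof.
set m := M * r n => m0 Q1 Q2 HD uniq; rewrite !ltr_norml => /andP[_ h1] /andP[h2 _].
have S1 : S n w (y0 + tn n + m) < 0 by lra.
have S2 : 0 < S n w (y0 + tn n - m) by lra.
have ab : y0 + tn n - m <= y0 + tn n + m by lra.
have [| |z] := @IVT _ (S n w) (y0 + tn n - m) (y0 + tn n + m) 0 ab.
- by apply: continuous_subspaceT => y; exact: cS.
- by rewrite ge_min le_max (ltW S1) (ltW S2) orbT.
rewrite in_itv/= => /andP[z1 z2] Sz.
have zm : `|z - (y0 + tn n)| <= m by rewrite ler_norml; apply/andP; split; lra.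
rewrite -(uniq z (HD z zm) Sz).
apply: le_trans (ler_dist_dist _ _) _.
by rewrite -addrA -opprD.
Qed.

Lemma estimated_zero_rate :
  stochastic_bigO P (fun n w => `|yhat n w - y0| - `|tn n|) r.
Proof.
move=> e e0; have [E [HE EP]] := single.
(* Chosen so that each of the two endpoints fails with probability at most [e / 4], the other
   [e / 2] going to the complement of [E n]. The added 1 keeps [M] positive when [Ct] is 0. *)
pose M := Num.sqrt (4 * Ct / (c ^+ 2 * e)) + 1.
have M0 : 0 < M by rewrite ltr_wpDl// sqrtr_ge0.
have M2 : 4 * Ct / (c ^+ 2 * e) <= M ^+ 2.
  have q0 : 0 <= 4 * Ct / (c ^+ 2 * e).
    by rewrite divr_ge0// mulr_ge0// ltW// exprn_gt0.
  rewrite -[leLHS](sqr_sqrtr q0).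
  by rewrite lerXn2r ?nnegrE ?sqrtr_ge0 ?(ltW M0)// /M lerDl.
exists M => //.
have EC : \forall n \near \oo, (P (~` E n) <= (e / 2)%:E)%E.
  have PE n : P (E n) \is a fin_num by apply: fin_num_measure; have [] := HE n.
  have fE : fine (P (E n)) @[n --> \oo] --> (1 : R) by exact: fine_cvg.
  have : \forall n \near \oo, 1 - e / 2 < fine (P (E n)).
    by apply: (cvgr_gt 1 fE); rewrite ltrBlDr ltrDl divr_gt0.
  apply: filterS => n h; have [mE _] := HE n.
  by rewrite probability_setC// -(fineK (PE n)) -EFinB lee_fin; lra.
near=> n.
have rn : 0 < r n by near: n.
have m0 : 0 < M * r n by rewrite mulr_gt0.
have cm0 : 0 < c * (M * r n) by rewrite mulr_gt0.
have [Q1 Q2 HD] : [/\ Q n (y0 + tn n + M * r n) <= - c * (M * r n),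
      c * (M * r n) <= Q n (y0 + tn n - M * r n) &
      forall y, `|y - (y0 + tn n)| <= M * r n -> D y].
  by near: n; exact: slope.
have tl : forall y t, 0 < t ->
  (P [set w | (t <= `|S n w y - Q n y|)%R] <= (Ct * r n ^+ 2 / t ^+ 2)%:E)%E.
  by near: n.
have ECn : (P (~` E n) <= (e / 2)%:E)%E by near: n.
have [mE HEn] := HE n.
pose bad y := [set w | (c * (M * r n) <= `|S n w y - Q n y|)%R].
have mbad y : measurable (bad y).
  rewrite -[X in measurable X]setTI; apply: measurable_fun_le => //.
  apply: measurableT_comp => //; apply: measurable_funB => //; exact: mS.
have quarter y : (P (bad y) <= (e / 4)%:E)%E.
  apply: le_trans (tl y _ cm0) _; rewrite lee_fin.
  have -> : Ct * r n ^+ 2 / (c * (M * r n)) ^+ 2 = (Ct / c ^+ 2) / M ^+ 2.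
    by field; rewrite !gt_eqF.
  rewrite ler_pdivrMr ?exprn_gt0//.
  move: M2; rewrite ler_pdivrMr ?mulr_gt0 ?exprn_gt0// => M2.
  rewrite ler_pdivrMr ?exprn_gt0//; move: M2; move: (c ^+ 2) (M ^+ 2) => q s; lra.
set yp := y0 + tn n + M * r n; set ym := y0 + tn n - M * r n.
apply: (@le_trans _ _ (P (~` E n `|` (bad yp `|` bad ym)))).
  apply: le_measure; rewrite ?inE.
  - rewrite (_ : [set w | _] =
        ~` [set w | `| `|yhat n w - y0| - `|tn n| | <= M * `|r n|]); last first.
      by apply/seteqP; split => w /=; rewrite ltNge => /negP.
    apply: measurableC; rewrite -[X in measurable X]setTI.
    apply: measurable_fun_le => //.
    apply: measurableT_comp => //; apply: measurable_funB => //.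
    by apply: measurableT_comp => //; apply: measurable_funB.
  - by apply: measurableU; [exact: measurableC|exact: measurableU].
  move=> w /= Mw; apply: contrapT => /not_orP[/contrapT Ew /not_orP[/negP b1 /negP b2]].
  rewrite -ltNge in b1; rewrite -ltNge in b2.
  have [_ uniq] := HEn _ Ew.
  have := zero_localized m0 Q1 Q2 HD uniq b1 b2.
  by rewrite leNgt; apply/negP/negPn; rewrite -(gtr0_norm rn).
apply: (@le_trans _ _ (P (~` E n) + (P (bad yp) + P (bad ym)))%E).
  apply: le_trans (measureU2 _ _ _) _; [exact: measurableC|exact: measurableU|].
  by apply: leeD => //; apply: measureU2.
apply: (@le_trans _ _ ((e / 2)%:E + ((e / 4)%:E + (e / 4)%:E))%E).
  by apply: leeD => //; apply: leeD; exact: quarter.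
by rewrite -!EFinD lee_fin; lra.
Unshelve. all: by end_near.
Qed.

End Localization.

(** * The deterministic zero of the mean slope *)

Section Root.
Context {R : realType}.
Variables (Q : nat -> R -> R) (B g w eta : nat -> R) (y0 l m0 Cb : R).
Hypotheses (l0 : 0 < l) (m00 : 0 <= m0).
Hypotheses (g0 : forall n, 0 < g n) (eta0 : forall n, 0 <= eta n).
Hypotheses (gc : g n @[n --> \oo] --> (0 : R)) (wc : w n @[n --> \oo] --> (0 : R)).
Hypothesis etac : eta n @[n --> \oo] --> (0 : R).
Hypothesis Hs : forall n y s,
  `|Q n (y + s) - Q n y + s * l| <= `|s| * (eta n + m0 * (`|s| + `|y - y0|)).
Hypothesis Hb : forall n, `|Q n y0 - B n| <= g n * w n.
Hypothesis HB : forall n, `|B n| <= g n * Cb.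

Lemma continuous_of_slope n : continuous (Q n).
Proof.
move=> y; apply/cvgrPdist_lt => e e0.
pose K := l + eta n + m0 * (1 + `|y - y0|).
have K0 : 0 < K.
  by rewrite /K ltr_wpDr ?mulr_ge0 ?addr_ge0// ltr_wpDr.
near=> z.
have zy : `|z - y| < Num.min 1 (e / K).
  rewrite distrC; near: z; apply/nbhs_ballP; exists (Num.min 1 (e / K)) => //=.
  by rewrite lt_min ltr01 divr_gt0.
move: zy; rewrite lt_min => /andP[z1 zK].
have := Hs n y (z - y); rewrite addrCA subrr addr0 => H.
rewrite distrC.
have -> : Q n z - Q n y = (Q n z - Q n y + (z - y) * l) - (z - y) * l by ring.
apply: le_lt_trans (ler_normB _ _) _; rewrite normrM (gtr0_norm l0).
apply: (@le_lt_trans _ _ (`|z - y| * K)); last by rewrite -ltr_pdivlMr.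
have : `|z - y| * (eta n + m0 * (`|z - y| + `|y - y0|)) <=
   `|z - y| * (eta n + m0 * (1 + `|y - y0|)).
  by rewrite ler_wpM2l// lerD2l ler_wpM2l// lerD2r ltW.
move: H; rewrite /K.
move: (`|z - y| * (eta n + m0 * (`|z - y| + `|y - y0|))) => W H1 H2.
apply: le_trans (lerD (le_trans H1 H2) (lexx _)) _.
by rewrite -mulrDr ler_wpM2l//; lra.
Unshelve. all: by end_near.
Qed.

(** An a priori bound on the zero: a function decreasing with slope at least [l / 2] has its zero
    within [2 / l] times its value at [y0], and [Hb] with [HB] bounds that value by
    [g n * (Cb + w n)]. *)
Let G n := 2 / l * (g n * (Cb + w n)).
Let Gc : G n @[n --> \oo] --> (0 : R).
Proof.
rewrite /G -[X in _ --> X](mulr0 (2 / l)); apply: cvgMr.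
rewrite -[X in _ --> X](mul0r (Cb + 0)); apply: cvgM => //.
by apply: cvgD => //; exact: cvg_cst.
Qed.

Let QG n : 2 * `|Q n y0| / l <= G n.
Proof.
rewrite /G mulrAC ler_wpM2l ?divr_ge0 ?(ltW l0)// mulrDr.
have -> : Q n y0 = B n + (Q n y0 - B n) by ring.
by rewrite (le_trans (ler_normD _ _))// lerD.
Qed.

Let tP n t := `|t| <= G n /\ Q n (y0 + t) = 0.
(** The default 0 is taken where no such zero exists, which by [tnP] happens for at most finitely
    many [n]. *)
Let tn n := xget 0 [set t | tP n t].

Let small : \forall n \near \oo, eta n + m0 * G n <= l / 2.
Proof.
have h : (eta n + m0 * G n) @[n --> \oo] --> (0 : R).
  rewrite -[X in _ --> X]addr0 -[X in _ + X](mulr0 m0).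
  by apply: cvgD => //; exact: cvgMr.
by apply: (cvgr_le _ h); rewrite divr_gt0.
Qed.

Let tnP : \forall n \near \oo, tP n (tn n).
Proof.
apply: filterS small => n sm; pose D := 2 * `|Q n y0| / l.
have D0 : 0 <= D by rewrite divr_ge0 ?mulr_ge0// ltW.
have DG : D <= G n by exact: QG.
have Dl : D * (l / 2) = `|Q n y0| by rewrite /D; field; rewrite gt_eqF.
(* The slope [- l] over the distance [D] moves [Q n] by twice the modulus of [Q n y0], while the
   error of this linear approximation is at most that modulus once; hence the change of sign. The
   inequalities are weak because [D] may be 0. *)
have bnd : D * (eta n + m0 * D) <= `|Q n y0|.
  rewrite -Dl ler_wpM2l//; apply: le_trans sm.
  by rewrite lerD2l ler_wpM2l.
have H1 := Hs n y0 D; have H2 := Hs n y0 (- D).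
rewrite subrr normr0 addr0 (ger0_norm D0) in H1.
rewrite subrr normr0 addr0 normrN (ger0_norm D0) in H2.
have q1 := ler_norm (Q n y0); have q2 := ler_norm (- Q n y0); rewrite normrN in q2.
have S1 : Q n (y0 + D) <= 0.
  have := le_trans H1 bnd; rewrite ler_norml => /andP[_]; lra.
have S2 : 0 <= Q n (y0 - D).
  have := le_trans H2 bnd; rewrite ler_norml => /andP[+ _]; lra.
have [| | |z] := @IVT _ (Q n) (y0 - D) (y0 + D) 0.
- by lra.
- by apply: continuous_subspaceT => y; exact: continuous_of_slope.
- by rewrite ge_min le_max S1 S2 orbT.
rewrite in_itv/= => /andP[z1 z2] Qz.
suff : [set t | tP n t] (tn n) by [].
apply: (xgetPex 0); exists (z - y0); split; last by rewrite addrCA subrr addr0.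
by apply: le_trans DG; rewrite ler_norml; apply/andP; split; lra.
Qed.

(** [g n * rho n] bounds the distance between [tn n] and [B n / l]: it results from [Hs] at the zero
    and [Hb], with [g n] factored out of [G n]. *)
Let rho n := l^-1 * (w n + 2 / l * (Cb + w n) * (eta n + m0 * G n)).

Let rhoc : rho n @[n --> \oo] --> (0 : R).
Proof.
rewrite /rho -[X in _ --> X](mulr0 l^-1); apply: cvgMr.
rewrite -[X in _ --> X]addr0; apply: cvgD => //.
rewrite -[X in _ --> X](mulr0 (2 / l * (Cb + 0))); apply: cvgM.
  by apply: cvgMr; apply: cvgD => //; exact: cvg_cst.
rewrite -[X in _ --> X]addr0 -[X in _ + X](mulr0 m0).
by apply: cvgD => //; exact: cvgMr.
Qed.

(** The last clause is the sign change that localization requires, with [c = l / 2]. It holds for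
    any positive null sequence [r], since the noise level and the squared bandwidths need not be
    comparable. *)
Lemma root_expansion : exists t : nat -> R,
  [/\ t n @[n --> \oo] --> (0 : R),
      \forall n \near \oo, Q n (y0 + t n) = 0,
      (fun n => `|t n| - `|B n| / l) =o_\oo g &
      forall M (r : nat -> R), 0 < M -> (\forall n \near \oo, 0 < r n) ->
        r n @[n --> \oo] --> (0 : R) -> \forall n \near \oo,
        Q n (y0 + t n + M * r n) <= - (l / 2) * (M * r n) /\
        l / 2 * (M * r n) <= Q n (y0 + t n - M * r n)].
Proof.
have tc : tn n @[n --> \oo] --> (0 : R).
  apply: norm_cvg0; apply: (@squeeze_cvgr _ _ _ _ (fun=> 0) G) => //; last exact: cvg_cst.
  by apply: filterS tnP => n [h _]; rewrite normr_ge0.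
exists tn; split => //.
- by apply: filterS tnP => n [].
- apply/eqoP => e e0; near=> n.
  have [tG Qt] : tP n (tn n) by near: n; exact: tnP.
  have re : rho n <= e by near: n; exact: (cvgr_le _ rhoc).
  rewrite (gtr0_norm (g0 n)) [e * _]mulrC.
  apply: (@le_trans _ _ (g n * rho n)); last by rewrite ler_wpM2l// ltW.
  have H := Hs n y0 (tn n); rewrite Qt subrr normr0 addr0 sub0r in H.
  have key : `|tn n * l - B n| <= g n * w n + G n * (eta n + m0 * G n).
    have -> : tn n * l - B n = (Q n y0 - B n) + (- Q n y0 + tn n * l) by ring.
    apply: le_trans (ler_normD _ _) _; apply: lerD => //.
    apply: le_trans H _; apply: ler_pM => //.
      by rewrite addr_ge0// mulr_ge0.
    by rewrite lerD2l ler_wpM2l.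
  have -> : `|tn n| - `|B n| / l = (`|tn n * l| - `|B n|) / l.
    by rewrite normrM (gtr0_norm l0) mulrBl mulfK// gt_eqF.
  rewrite normrM (gtr0_norm (x := l^-1)) ?invr_gt0//.
  rewrite ler_pdivrMr//; apply: le_trans (ler_dist_dist _ _) _.
  apply: le_trans key _; rewrite le_eqVlt; apply/orP; left; apply/eqP.
  by rewrite /rho /G; field; rewrite gt_eqF.
- move=> M r M0 r0 rc; near=> n.
  have [tG Qt] : tP n (tn n) by near: n; exact: tnP.
  have rn : 0 < r n by near: n.
  have m_0 : 0 < M * r n by exact: mulr_gt0.
  have sm : eta n + m0 * (M * r n + G n) <= l / 2.
    near: n.
    have h : (eta n + m0 * (M * r n + G n)) @[n --> \oo] --> (0 : R).
      rewrite -[X in _ --> X]addr0 -[X in _ + X](mulr0 m0) -[X in m0 * X]addr0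
        -[X in m0 * (X + _)](mulr0 M).
      by apply: cvgD => //; apply: cvgMr; apply: cvgD => //; exact: cvgMr.
    by apply: (cvgr_le _ h); rewrite divr_gt0.
  have gen s : `|s| = M * r n ->
      `|Q n (y0 + tn n + s) + s * l| <= (M * r n) * (l / 2).
    move=> sE; have := Hs n (y0 + tn n) s; rewrite Qt subr0 sE => H.
    apply: le_trans H _; rewrite ler_wpM2l ?(ltW m_0)//; apply: le_trans sm.
    by rewrite lerD2l ler_wpM2l// lerD2l addrAC subrr add0r.
  have := gen (M * r n) (gtr0_norm m_0); have := gen (- (M * r n)).
  rewrite normrN (gtr0_norm m_0) => /(_ erefl); rewrite !ler_norml.
  by move: (M * r n) => m /andP[a1 a2] /andP[b1 b2]; split; lra.
Unshelve. all: by end_near.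
Qed.

End Root.

(** * The expansion *)

Opaque dx dy.

Lemma dominating_biasE (R : realType) (p : R -> R -> R) (mu2 x y g1 g2 l v1 v2 : R) :
  dy (dx (dx p)) x y = v1 -> dy (dy p) x y = - l -> dy (dy (dy p)) x y = v2 ->
  dominating_bias p mu2 x y g1 g2 = `|(mu2 * g1 ^+ 2 * v1 + g2 ^+ 2 * v2) / 2| / l.
Proof.
move=> <- E2 <-; rewrite -(opprK l) -E2 /dominating_bias.
generalize (dy (dx (dx p)) x y) (dy (dy (dy p)) x y) (dy (dy p) x y) => w1 w2 w3.
rewrite normrM (gtr0_norm (x := 2^-1))//.
have -> : w1 * mu2 * g1 ^+ 2 + w2 * g2 ^+ 2 = mu2 * g1 ^+ 2 * w1 + g2 ^+ 2 * w2 by ring.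
have -> : (-2 * w3)^-1 = 2^-1 * (- w3)^-1 by rewrite -invfM mulrN mulNr.
by rewrite mulrA.
Qed.

Lemma Rint_score_sqr_ge0 (R : realType) :
  0 <= \int[@lebesgue_measure R]_v score v ^+ 2.
Proof. by apply: Rintegral_ge0 => v _; exact: sqr_ge0. Qed.

Lemma tail_constant_ge0 (R : realFieldType) (C q k s : R) : 0 <= C -> 0 <= q -> 0 <= s ->
  0 <= C * (q * (2 * k ^+ 2) * s).
Proof.
move=> C0 q0 s0; apply: mulr_ge0 => //; apply: mulr_ge0 => //.
by apply: mulr_ge0 => //; apply: mulr_ge0 => //; exact: sqr_ge0.
Qed.

Lemma tail_constantE (R : realFieldType) (C q k L s n g1 g2 t : R) :
  C * (q * (2 * (k * L) ^+ 2) * s) / (n * g1 * g2 ^+ 3 * t ^+ 2) =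
  C * (q * (2 * k ^+ 2) * s) * (L ^+ 2 / (n * g1 * g2 ^+ 3)) / t ^+ 2.
Proof.
rewrite invfM (exprMn _ k); move: ((n * g1 * g2 ^+ 3)^-1) ((t ^+ 2)^-1) => v1 v2; ring.
Qed.

Lemma invr_ge0_2pi (R : realType) : 0 <= (2 * pi)^-1 :> R.
Proof. by rewrite invr_ge0 mulr_ge0// pi_ge0. Qed.

Lemma abs_moment_ge0 (R : realType) (K1 : R -> R) F : (forall z, 0 <= F z) ->
  0 <= abs_moment K1 F.
Proof.
by move=> F0; apply: Rintegral_ge0 => z _; apply: mulr_ge0; [exact: normr_ge0|exact: F0].
Qed.

Section SmoothedRoot.
Context {R : realType}.
Local Notation leb := (@lebesgue_measure R).
Local Notation K2 := (@gaussian_kernel R).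
Local Notation intble f := (leb.-integrable setT (EFin \o f)).
Variable K1 : R -> R.
Hypotheses (K1i : intble K1) (K1m : intble (fun u => u ^+ 2 * K1 u)).
Hypotheses (K1e : forall u, K1 (- u) = K1 u) (K1_1 : \int[leb]_u K1 u = 1).
Hypotheses (K2i : intble K2) (K2m : intble (fun v => v ^+ 2 * K2 v)).
Hypothesis K2_1 : \int[leb]_v K2 v = 1.
Variables (f fx fy fxx fyy : R -> R -> R) (Cp : R).
Hypothesis Cp0 : 0 <= Cp.
Hypothesis Dx : forall x y : R, is_derive x 1 (fun u => f u y) (fx x y).
Hypothesis Dy : forall x y : R, is_derive y 1 (f x) (fy x y).
Hypothesis Dxx : forall x y : R, is_derive x 1 (fun u => fx u y) (fxx x y).
Hypothesis Dyy : forall x y : R, is_derive y 1 (fy x) (fyy x y).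
Hypothesis Bx : forall x y, `|fx x y| <= Cp.
Hypothesis Bxx : forall x y, `|fxx x y| <= Cp.
Hypothesis Byy : forall x y, `|fyy x y| <= Cp.
Hypothesis cfx : forall x, continuous (fx x).
Hypothesis Lf : forall a b a' b', `|f a b - f a' b'| <= Cp * (`|a - a'| + `|b - b'|).
Hypothesis Lfy : forall a b a' b', `|fy a b - fy a' b'| <= Cp * (`|a - a'| + `|b - b'|).
Hypothesis Lfxx : forall a b a' b', `|fxx a b - fxx a' b'| <= Cp * (`|a - a'| + `|b - b'|).
Hypothesis Lfyy : forall a b a' b', `|fyy a b - fyy a' b'| <= Cp * (`|a - a'| + `|b - b'|).
Hypothesis mf : measurable_fun setT (fun z : R * R => f z.1 z.2).
Variables (h1 h2 : nat -> R) (x y0 l : R).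
Hypotheses (h10 : forall n, 0 < h1 n) (h20 : forall n, 0 < h2 n).
Hypotheses (h1c : h1 n @[n --> \oo] --> (0 : R)) (h2c : h2 n @[n --> \oo] --> (0 : R)).
Hypotheses (f0 : f x y0 = 0) (fyl : fy x y0 = - l) (l0 : 0 < l).
Let mu2 := \int[leb]_t (t ^+ 2 * K1 t).
Let Q n y := smoothed K1 f (h1 n) (h2 n) x y.

Lemma smoothed_root : exists t : nat -> R,
  [/\ t n @[n --> \oo] --> (0 : R),
      \forall n \near \oo, Q n (y0 + t n) = 0,
      (fun n => `|t n| -
         `|(mu2 * h1 n ^+ 2 * fxx x y0 + h2 n ^+ 2 * fyy x y0) / 2| / l)
        =o_\oo (fun n => h1 n ^+ 2 + h2 n ^+ 2) &
      forall M (r : nat -> R), 0 < M -> (\forall n \near \oo, 0 < r n) ->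
        r n @[n --> \oo] --> (0 : R) -> \forall n \near \oo,
        Q n (y0 + t n + M * r n) <= - (l / 2) * (M * r n) /\
        l / 2 * (M * r n) <= Q n (y0 + t n - M * r n)].
Proof.
pose m0 := abs_moment K1 (fun=> 1).
pose m1 := abs_moment K1 (fun z => `|z.1|).
pose m2 := abs_moment K1 (fun z => `|z.2|).
have am F : (forall z, 0 <= F z) -> 0 <= abs_moment K1 F.
  exact: abs_moment_ge0.
have m00 : 0 <= m0 by apply: am => z; exact: ler01.
have m10 : 0 <= m1 by apply: am => z; exact: normr_ge0.
have m20 : 0 <= m2 by apply: am => z; exact: normr_ge0.
pose g n := h1 n ^+ 2 + h2 n ^+ 2.
have g0 n : 0 < g n by rewrite /g addr_gt0 ?exprn_gt0.
pose w n := bias_modulus K1 Cp (h1 n) (h2 n).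
pose B n := (mu2 * h1 n ^+ 2 * fxx x y0 + h2 n ^+ 2 * fyy x y0) / 2.
pose eta n := Cp * (h1 n * m1 + h2 n * m2).
pose Cb := `|mu2 * fxx x y0| + `|fyy x y0|.
have Hb n : `|Q n y0 - B n| <= g n * w n.
  exact: (smoothed_bias K1i K1m K1e K1_1 K2i K2m K2_1 Cp0 Dx Dy Dxx Dyy Bx Bxx Byy cfx
    Lf Lfxx Lfyy mf (ltW (h10 n)) (ltW (h20 n)) f0).
have HB n : `|B n| <= g n * Cb.
  rewrite /B /g /Cb normrM (gtr0_norm (x := 2^-1))// ler_pdivrMr//.
  apply: le_trans (ler_normD _ _) _.
  have e1 : `|mu2 * h1 n ^+ 2 * fxx x y0| = h1 n ^+ 2 * `|mu2 * fxx x y0|.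
    by rewrite mulrAC mulrC normrM ger0_norm// sqr_ge0.
  have e2 : `|h2 n ^+ 2 * fyy x y0| = h2 n ^+ 2 * `|fyy x y0|.
    by rewrite normrM ger0_norm// sqr_ge0.
  rewrite e1 e2; have := sqr_ge0 (h1 n); have := sqr_ge0 (h2 n).
  have := normr_ge0 (mu2 * fxx x y0); have := normr_ge0 (fyy x y0).
  by move: (h1 n ^+ 2) (h2 n ^+ 2) `|_| `|_| => q1 q2 v1 v2; nra.
have Hs n y s : `|Q n (y + s) - Q n y + s * l| <=
    `|s| * (eta n + Cp * m0 * (`|s| + `|y - y0|)).
  have := smoothed_slope K1i K1m K1_1 K2i K2m K2_1 Cp0 Dy Lf Lfy mf
    x (ltW (h10 n)) (ltW (h20 n)) y0 y s.
  rewrite fyl mulrN opprK => H; apply: le_trans H _; rewrite le_eqVlt; apply/orP; left.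
  by apply/eqP; rewrite /eta /m0 /m1 /m2; ring.
have eta0 n : 0 <= eta n.
  by rewrite mulr_ge0// addr_ge0// mulr_ge0// ltW.
have sq0 (h : nat -> R) : h n @[n --> \oo] --> (0 : R) -> h n ^+ 2 @[n --> \oo] --> (0 : R).
  by move=> hc; rewrite -[X in _ --> X](mulr0 (0 : R)); apply: cvgM.
have gc : g n @[n --> \oo] --> (0 : R).
  by rewrite -[X in _ --> X]addr0; apply: cvgD; exact: sq0.
have wc : w n @[n --> \oo] --> (0 : R).
  exact: (bias_modulus_cvg K1i K1m K2i K2m Cp0 (fun n => ltW (h10 n)) (fun n => ltW (h20 n)) h1c h2c).
have etac : eta n @[n --> \oo] --> (0 : R).
  rewrite -[X in _ --> X](mulr0 Cp); apply: cvgMr.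
  have h : (h1 n * m1 + h2 n * m2) @[n --> \oo] --> 0 * m1 + 0 * m2.
    by apply: cvgD; apply: cvgMl.
  by move: h; rewrite !mul0r addr0.
have [t [tc Qt te slope]] :=
  root_expansion l0 (mulr_ge0 Cp0 m00) g0 eta0 gc wc etac Hs Hb HB.
exists t; split.
- exact: tc.
- exact: Qt.
- exact: te.
- exact: slope.
Qed.

End SmoothedRoot.

Section Expansion.
Context d (T : measurableType d) (R : realType) (P : probability T R).
Variables (X Y U : nat -> {RV P >-> R}) (p : R -> R -> R) (fU yM K1 : R -> R).
Variables (h1 h2 : nat -> R) (x Cp : R) (yhat : nat -> {RV P >-> R}).
Local Notation leb := (@lebesgue_measure R).
Local Notation RT := (measurableTypeR R).
Local Notation K2 := (@gaussian_kernel R).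
Local Notation intble f := (leb.-integrable setT (EFin \o f)).
Local Notation cosT := (cos_transform leb idfun).
Let phat n w := density_estimator
  (deconvoluting_kernel (fourier K1) (charfun (U 0%N)) (h1 n)) K2 (h1 n) (h2 n) n
  (fun j => X j w + U j w) (fun j => Y j w).
Let mu2 := \int[leb]_t (t ^+ 2 * K1 t).
Hypothesis HS : contaminated_sample X Y U p fU.
Hypothesis phiUe : forall t, charfun (U 0%N) (- t) = charfun (U 0%N) t.
Hypothesis phiU0 : forall t, charfun (U 0%N) t != 0.
Hypotheses (modeM : is_mode_function p yM) (xS : supportX p x).
Hypotheses (h10 : forall n, 0 < h1 n) (h20 : forall n, 0 < h2 n).
Hypotheses (h1c : h1 n @[n --> \oo] --> (0 : R)) (h2c : h2 n @[n --> \oo] --> (0 : R)).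
Hypotheses (K1i : intble K1) (K1m : intble (fun t => t ^+ 2 * K1 t)).
Hypothesis single : with_probability_tending_to_one P
  (fun n => [set w | is_single_mode_in (supportY p) (phat n w) x (yhat n w)]).
Hypothesis Hp : smooth_bounded 4 Cp p.
Hypotheses (K1e : forall t, K1 (- t) = K1 t) (K1_1 : \int[leb]_t K1 t = 1).
Hypotheses (K2_1 : \int[leb]_t K2 t = 1) (K2m : intble (fun t => t ^+ 2 * K2 t)).
Hypothesis suppK1 : forall t, fourier K1 t != 0 -> `|t| <= 1.
Hypothesis bounded : forall n, exists M : R, forall t,
  cabs (fourier K1 t / charfun (U 0%N) (t / h1 n)) <= M.

Definition error_transform (s : R) : R := \int[P]_w cos (s * U 0%N w).
Local Notation u := error_transform.

Lemma charfunE s : charfun (U 0%N) s = ((u s)%:C)%C.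
Proof. by have [_] := charfun_even phiUe. Qed.

Lemma error_transform_neq0 s : u s != 0.
Proof. by apply: contraNneq (phiU0 s) => us; rewrite charfunE us. Qed.

Lemma error_transformN s : u (- s) = u s.
Proof. by apply: eq_Rintegral => w _; rewrite mulNr cosN. Qed.

Lemma continuous_error_transform : continuous u.
Proof.
rewrite (_ : u = cos_transform P (U 0%N) (fun=> 1)); last first.
  by apply: funext => s; apply: eq_Rintegral => w _; rewrite mulr1.
apply: continuous_cos_transform => //.
exact: finite_measure_integrable_cst.
Qed.

(* L n bounds 1 / |phi_U (s / h1 n)| over the support of phi_K1, and the squared
   rate is 1 / N n. *)
Variables (A : R) (L N : nat -> R).
Hypothesis A0 : 0 <= A.
Hypothesis Nc : N n @[n --> \oo] --> +oo.
Hypothesis HL : \forall n \near \oo, forall s, `|s| <= 1 -> `|u (s / h1 n)|^-1 <= L n.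
Hypothesis LN : \forall n \near \oo,
  L n ^+ 2 / (n%:R * h1 n * h2 n ^+ 3) <= A / N n.

Let r n := Num.sqrt (1 / N n).

Let Npos : \forall n \near \oo, 0 < N n.
Proof. by move/cvgryPgt: Nc; exact. Qed.

Let r0 : \forall n \near \oo, 0 < r n.
Proof. by apply: filterS Npos => n N0; rewrite sqrtr_gt0 divr_gt0. Qed.

Let rc : r n @[n --> \oo] --> (0 : R).
Proof.
apply/cvgrPdist_le => e e0.
have : \forall n \near \oo, (e ^+ 2)^-1 <= N n.
  by move/cvgryPge: Nc; exact.
apply: filterS2 Npos => n N0 He.
rewrite sub0r normrN ger0_norm ?sqrtr_ge0//.
rewrite -(ger0_norm (ltW e0)) -sqrtr_sqr ler_sqrt ?sqr_ge0//.
by rewrite mul1r -[leRHS]invrK lef_pV2 ?posrE ?invr_gt0 ?exprn_gt0.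
Qed.

Let ratio n (s : R) : R := cosT K1 s / u (s / h1 n).

Let mid : measurable_fun setT (idfun : RT -> R). Proof. exact: (@measurable_id _ RT). Qed.

Let k0 s : 1 < `|s| -> cosT K1 s = 0.
Proof.
move=> s1; apply/eqP/negPn/negP => ks; have : fourier K1 s != 0.
  by apply: contra ks; rewrite (fourier_even K1i K1e) => /eqP[->].
by move/suppK1; rewrite leNgt s1.
Qed.

Let km := \int[leb]_t `|K1 t|.

Let k_le s : `|cosT K1 s| <= km.
Proof. exact: (cos_transform_bound (mu := leb) mid K1i). Qed.

Let km0 : 0 <= km. Proof. exact: le_trans (normr_ge0 _) (k_le 0). Qed.

Let mk : measurable_fun setT (cosT K1).
Proof. exact: (measurable_cos_transform (mu := leb) mid K1i). Qed.

Let ki : intble (cosT K1).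
Proof. exact: intble_supported mk k_le k0. Qed.

Let K2i : intble K2.
Proof.
apply: (intble_ge0 (mu := leb)) => [|t|].
- by apply: continuous_measurable_fun; exact: continuous_gaussian.
- exact/ltW/gaussian_gt0.
(* [Rintegral] sends an infinite integral to 0, so a total mass of 1 already forces
   integrability. *)
rewrite ltey; apply/negP => /eqP E; move: K2_1; rewrite /Rintegral E /= => /eqP.
by rewrite eq_sym oner_eq0.
Qed.

Let ratio_support n s : 1 < `|s| -> ratio n s = 0. Proof. by move=> s1; rewrite /ratio k0// mul0r. Qed.

Let a_le n : (forall s, `|s| <= 1 -> `|u (s / h1 n)|^-1 <= L n) ->
  forall s, `|ratio n s| <= km * L n.
Proof.
move=> H s; have L0 : 0 <= L n by apply: le_trans (H 0 _); rewrite ?invr_ge0 ?normr0.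
have [s1|s1] := leP `|s| 1; last by rewrite ratio_support// normr0 mulr_ge0.
by rewrite /ratio normrM normfV ler_pM// ?invr_ge0// H.
Qed.

Let ratio_meas n : measurable_fun setT (ratio n).
Proof.
apply: measurable_funM => //.
apply: continuous_measurable_fun => s.
apply: cvgV; first exact: error_transform_neq0.
apply: (continuous_comp (f := fun s : R => s / h1 n) (g := u)).
  by apply: cvgMl; exact: cvg_id.
exact: continuous_error_transform.
Qed.

Let ratio_bounded n : exists M, forall s, `|ratio n s| <= M.
Proof.
have [M HM] := bounded n; exists M => s; have := HM s.
rewrite (fourier_even K1i K1e) charfunE -(fmorphV (real_complex R)).
by rewrite -(rmorphM (real_complex R)) cabs_real.
Qed.

Let y0 := yM x.
Let f := dy p.
Let l := - dy (dy p) x y0.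
Let S n w y := dy (phat n w) x y.
Let Q n y := smoothed K1 f (h1 n) (h2 n) x y.
(** A single constant for the derivatives and for [p] itself; for [p] it is the bound of
    [density_bounded]. *)
Let C := 2 * Cp + 1.

Let modex : is_conditional_mode p x y0. Proof. by have [] := modeM xS. Qed.
Let l0 : 0 < l. Proof. by have [_ _ h] := modex; rewrite oppr_gt0. Qed.
Let f0 : f x y0 = 0. Proof. by have [_ h _] := modex. Qed.

Let Cp0 : 0 <= Cp. Proof. exact: smooth_bounded_ge0 Hp. Qed.
Let CpC : Cp <= C. Proof. by rewrite /C; have := Cp0; lra. Qed.
Let C0 : 0 <= C. Proof. exact: le_trans Cp0 CpC. Qed.

Let Hx : smooth_bounded 3 Cp (dx p). Proof. by have [_ _ _ _ []] := smooth_boundedS Hp. Qed.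
Let Hf : smooth_bounded 3 Cp f. Proof. by have [_ _ _ _ []] := smooth_boundedS Hp. Qed.
Let Dp : forall a b : R, is_derive b 1 (p a) (f a b).
Proof. by have [] := smooth_boundedS Hp. Qed.
Let Hfx : smooth_bounded 2 Cp (dx f). Proof. by have [_ _ _ _ []] := smooth_boundedS Hf. Qed.
Let Hfy : smooth_bounded 2 Cp (dy f). Proof. by have [_ _ _ _ []] := smooth_boundedS Hf. Qed.
Let Hfxx : smooth_bounded 1 Cp (dx (dx f)).
Proof. by have [_ _ _ _ []] := smooth_boundedS Hfx. Qed.
Let Hfyy : smooth_bounded 1 Cp (dy (dy f)).
Proof. by have [_ _ _ _ []] := smooth_boundedS Hfy. Qed.

Let mf : measurable_fun setT (fun z : R * R => f z.1 z.2).
Proof. by apply: measurable_dy => //; have [/(_ 0%N)[]] := HS. Qed.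

Let p_ge0 a b : 0 <= p a b. Proof. by have [/(_ 0%N)[]] := HS. Qed.

Let p_le a b : `|p a b| <= C.
Proof. exact: (density_bounded HS (lipschitz2 Hp) Cp0). Qed.

Let f_le a b : `|f a b| <= C.
Proof. by have [_ _ _ h _] := smooth_boundedS Hp; exact: le_trans (h a b) CpC. Qed.

Let Lf a b a' b' : `|f a b - f a' b'| <= C * (`|a - a'| + `|b - b'|).
Proof.
apply: le_trans (lipschitz2 Hf a b a' b') _.
by rewrite ler_wpM2r// addr_ge0.
Qed.

Let SE n w y : S n w y = - ((h1 n * h2 n ^+ 2)^-1 * (n%:R^-1 *
  \sum_(j < n) slope_summand (ratio n) (h1 n) (h2 n) x y (X j w, Y j w, U j w))).
Proof.
rewrite /S /phat slope_estimatorE ?gt_eqF//; congr (- (_ * (_ * _))).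
apply: eq_bigr => j _; rewrite /slope_summand /=; congr (_ * _).
apply: deconvoluting_kernel_real => s; [exact: fourier_even|exact: charfunE].
Qed.

Let cS n w : continuous (S n w).
Proof.
rewrite (_ : S n w = fun y => - ((h1 n * h2 n ^+ 2)^-1 * (n%:R^-1 *
  \sum_(j < n) dkernel (ratio n) ((X j w + U j w - x) / h1 n) *
    score ((Y j w - y) / h2 n)))); last by apply: funext => y; exact: SE.
move=> y; apply: cvgN; apply: cvgMr; apply: cvgMr.
exact: (@continuous_score_sum R
  (fun j => dkernel (ratio n) ((X j w + U j w - x) / h1 n)) (fun j => Y j w)).
Qed.

Let tail0 n : (forall s, `|s| <= 1 -> `|u (s / h1 n)|^-1 <= L n) -> (0 < n)%N ->
  forall y t, 0 < t -> (P [set w | (t <= `|S n w y - Q n y|)%R] <=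
  (C * ((2 * pi)^-1 * (2 * (km * L n) ^+ 2) * \int[leb]_v score v ^+ 2) /
     (n%:R * h1 n * h2 n ^+ 3 * t ^+ 2))%:E)%E.
Proof.
move=> HLn n0 y t t0; have aL := a_le HLn.
have ai : intble (ratio n) by exact: intble_supported (ratio_meas n) aL (@ratio_support n).
have [sinU _] := charfun_even phiUe.
have aE s : ratio n s * \int[P]_w cos (s / h1 n * U 0%N w) = cosT K1 s.
  by rewrite /ratio divfK// error_transform_neq0.
have := slope_tail HS K1i K1m K1e ki (h10 n) ai aL sinU aE x y K2i K2m C0 (h20 n)
  Dp f_le p_le Lf mf (@ratio_support n) n0 t0.
by under [X in (P X <= _)%E -> _]eq_set do rewrite -SE.
Qed.

Let mS n y : measurable_fun setT (S n ^~ y).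
Proof.
rewrite (_ : S n ^~ y = fun v => - ((h1 n * h2 n ^+ 2)^-1 * (n%:R^-1 *
  \sum_(j < n) slope_summand (ratio n) (h1 n) (h2 n) x y (X j v, Y j v, U j v)))); last first.
  by apply: funext => v; exact: SE.
(* Measurability is needed for every [n], whereas [HL] controls the ratio only for large [n]. *)
have [M HM] := ratio_bounded n.
have ri := measurable_slope_summand (h1 n)
  (intble_supported (ratio_meas n) HM (@ratio_support n)) (h2 n) x y.
have mV j : measurable_fun setT (fun w => (X j w, Y j w, U j w)).
  by apply: measurable_fun_pair; [exact: measurable_fun_pair|].
apply: measurableT_comp; first exact: oppr_measurable.
apply: measurable_funM; first exact: measurable_cst.
apply: measurable_funM; first exact: measurable_cst.
by apply: measurable_sum => j; exact: (measurableT_comp ri (mV j)).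
Qed.

Let Ct := C * ((2 * pi)^-1 * (2 * km ^+ 2) * \int[leb]_v score v ^+ 2).

Let Ct0 : 0 <= Ct.
Proof. exact: tail_constant_ge0 C0 (invr_ge0_2pi R) (Rint_score_sqr_ge0 R). Qed.

Let tail : \forall n \near \oo, forall y t, 0 < t ->
  (P [set w | (t <= `|S n w y - Q n y|)%R] <= (Ct * A * r n ^+ 2 / t ^+ 2)%:E)%E.
Proof.
near=> n; move=> y s s0.
have HLn : forall v, `|v| <= 1 -> `|u (v / h1 n)|^-1 <= L n by near: n; exact: HL.
have n0 : (0 < n)%N by near: n; exact: nbhs_infty_gt.
have LNn : L n ^+ 2 / (n%:R * h1 n * h2 n ^+ 3) <= A / N n by near: n; exact: LN.
have N0 : 0 < N n by near: n; exact: Npos.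
apply: le_trans (tail0 HLn n0 y s0) _; rewrite lee_fin tail_constantE.
have rE : r n ^+ 2 = (N n)^-1.
  by rewrite /r sqr_sqrtr ?mul1r// invr_ge0 ltW.
have sV : 0 <= (s ^+ 2)^-1 by rewrite invr_ge0 sqr_ge0.
rewrite rE -(mulrA Ct A); apply: (ler_wpM2r sV); exact: (ler_wpM2l Ct0 LNn).
Unshelve. all: by end_near.
Qed.

Lemma mode_expansion : exists (Z : nat -> T -> R) (e : nat -> R),
  [/\ forall n w, `|yhat n w - yM x| =
        dominating_bias p mu2 x (yM x) (h1 n) (h2 n) + Z n w + e n,
      stochastic_bigO P Z r &
      e =o_\oo (fun n => h1 n ^+ 2 + h2 n ^+ 2)].
Proof.
pose fx := dx f; pose fy := dy f; pose fxx := dx (dx f); pose fyy := dy (dy f).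
have [Dx Dy Bx By _] := smooth_boundedS Hf.
have [Dxx Dxy Bxx _ _] := smooth_boundedS Hfx.
have [_ Dyy _ Byy _] := smooth_boundedS Hfy.
have cfx s : continuous (fx s) by exact: der_continuous (Dxy s).
(* The stated bias has the y-derivative outermost, the expansion of [f = dy p] has it innermost;
   [schwarz] moves it past one x-derivative at a time. *)
have mixed : dy (dx (dx p)) x y0 = fxx x y0.
  have E : dy (dx p) = dx f by apply: funext => s; apply: funext => t; exact: (schwarz Hp).
  by rewrite (schwarz Hx x y0) E.
pose B n := (mu2 * h1 n ^+ 2 * fxx x y0 + h2 n ^+ 2 * fyy x y0) / 2.
have fyl : fy x y0 = - l by exact: esym (opprK _).
have [t [tc Qt te slope]] := smoothed_root K1i K1m K1e K1_1 K2i K2m K2_1 Cp0 Dx Dy Dxx Dyy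
  Bx Bxx Byy cfx (lipschitz2 Hf) (lipschitz2 Hfy) (lipschitz2 Hfxx) (lipschitz2 Hfyy) mf
  h10 h20 h1c h2c f0 fyl l0.
(* The two witnesses telescope through the modulus of [t n], leaving the modulus of [B n] over [l],
   which is the dominating bias. *)
exists (fun n v => `|yhat n v - y0| - `|t n|), (fun n => `|t n| - `|B n| / l); split.
- move=> n v.
  have -> : dominating_bias p mu2 x (yM x) (h1 n) (h2 n) = `|B n| / l.
    exact: (dominating_biasE (p := p) mu2 (h1 n) (h2 n) mixed fyl (erefl (fyy x y0))).
  by move: (`|yhat n v - y0|) (`|B n| / l) (`|t n|) => q1 q2 q3; ring.
- have [rho rho0 Hrho] : exists2 rho, 0 < rho &
      forall y', `|y' - y0| < rho -> supportY p y'.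
    by have [yS _ _] := modex; exact: supportY_nbhs p_ge0 (lipschitz2 Hp) yS.
  have l20 : 0 < l / 2 by exact: divr_gt0 l0 (ltr0Sn _ 1).
  have H M : 0 < M -> \forall n \near \oo,
     [/\ Q n (y0 + t n + M * r n) <= - (l / 2) * (M * r n),
         l / 2 * (M * r n) <= Q n (y0 + t n - M * r n) &
         forall y, `|y - (y0 + t n)| <= M * r n -> supportY p y].
    move=> M0; have cM : (M * r n + `|t n|) @[n --> \oo] --> (0 : R).
      have h : (M * r n + `|t n|) @[n --> \oo] --> M * 0 + `|0 : R|.
        by apply: cvgD; [exact: cvgMr|exact: cvg_norm].
      by move: h; rewrite mulr0 normr0 addr0.
    apply: filterS2 (slope M r M0 r0 rc) (cvgr_lt _ cM rho rho0) => n [q1 q2] Mt.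
    split; [exact: q1|exact: q2|move=> y yM'; apply: Hrho; apply: le_lt_trans Mt].
    have -> : y - y0 = (y - (y0 + t n)) + t n by ring.
    by apply: le_trans (ler_normD _ _) _; rewrite lerD2r.
  exact: (@estimated_zero_rate _ _ _ P S Q yhat (supportY p) y0 (l / 2) (Ct * A) t r
    l20 (mulr_ge0 Ct0 A0) cS mS r0 tail H single).
- exact: te.
Qed.

End Expansion.

(** * Rates *)

Section InverseBounds.
Context {R : realType}.
Variables (u : R -> R) (b : R).
Hypotheses (cu : continuous u) (u0 : forall t, u t != 0) (ue : forall t, u (- t) = u t).
Hypothesis b_gt0 : 0 < b.

(** Far out the product of [u] with the power is at least half its limit, whence the constant
    [c / 2]; powers are monotone, so [B0 = 1]. *)
Lemma ordinary_smooth_inverse_bound (c : R) : 0 < c ->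
  `|t `^ b * u t - c| @[t --> +oo] --> (0 : R) ->
  exists2 A, 0 < A & forall r t, 1 <= r -> `|t| <= r -> `|u t|^-1 <= A * r `^ b.
Proof.
move=> c0 lim.
have [M [_ HM]] : \forall t \near +oo, `|t `^ b * u t - c| < c / 2.
  by apply: (cvgr_lt _ lim); rewrite divr_gt0.
have t1 : 1 <= Num.max 1 (M + 1) by rewrite le_max lexx.
apply: (inverse_bound (W := fun t => t `^ b) (B0 := 1) cu u0 ue (divr_gt0 c0 (ltr0Sn _ 1)) t1) => //.
- move=> t; rewrite ge_max => /andP[tge1 tM].
  have Mt : M < t by lra.
  have := HM _ Mt; rewrite /= mulrC => h.
  have := ler_norm (u t * t `^ b); rewrite normrM (ger0_norm (powR_ge0 t b)).
  move: h; rewrite ltr_norml => /andP[h _]; lra.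
- by move=> t t0; rewrite powR_gt0// (lt_le_trans ltr01 t0).
- move=> t r tge1 tr; rewrite mul1r ge0_ler_powR ?nnegrE//; first exact: ltW.
    exact: le_trans ler01 tge1.
  exact: le_trans (le_trans ler01 tge1) tr.
Qed.

Lemma super_smooth_inverse_bound (d2 b0 d0 M : R) : 0 < d2 -> 0 < b0 -> 0 < d0 ->
  (forall t, M < `|t| -> d0 * `|t| `^ b0 * expR (- (`|t| `^ b / d2)) <= `|u t|) ->
  exists2 A, 0 < A & forall r t, 1 <= r -> `|t| <= r ->
    `|u t|^-1 <= A * (r `^ (- b0) * expR (r `^ b / d2)).
Proof.
move=> d20 b00 d00 HM.
have [B B0 HB] := super_smooth_weight_monotone b_gt0 d20 b00.
have t1 : 1 <= Num.max 1 (M + 1) by rewrite le_max lexx.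
apply: (inverse_bound (W := fun t => t `^ (- b0) * expR (t `^ b / d2)) cu u0 ue d00 t1 _ _ B0 HB).
- move=> t; rewrite ge_max => /andP[tge1 tM].
  have tpos : 0 < t by exact: lt_le_trans ltr01 tge1.
  have := HM t; rewrite (gtr0_norm tpos) => /(_ (_ : M < t)) h.
  have {}h : d0 * t `^ b0 * expR (- (t `^ b / d2)) <= `|u t| by apply: h; lra.
  have W0 : 0 <= t `^ (- b0) * expR (t `^ b / d2).
    by rewrite mulr_ge0 ?powR_ge0 ?expR_ge0.
  have := ler_wpM2r W0 h; rewrite mulrACA -(mulrA d0) powRN.
  by rewrite divff ?gt_eqF ?powR_gt0// -expRD addNr expR0 !mulr1.
- by move=> t t0; rewrite mulr_gt0 ?expR_gt0// powR_gt0// (lt_le_trans ltr01 t0).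
Qed.

End InverseBounds.

Section Rates.
Context {R : realType}.

Lemma powR_invl (h b : R) : 0 <= h -> h^-1 `^ b = (h `^ b)^-1.
Proof. by move=> h0; rewrite -powR_inv1// -powRrM mulN1r powRN. Qed.

Lemma powR_1D2 (h b : R) : 0 < h -> h `^ (1 + 2 * b) = h * (h `^ b) ^+ 2.
Proof.
move=> h0; rewrite powRD; last by rewrite (gt_eqF h0) implybT.
by rewrite powRr1 ?ltW// mulrC powRrM -powR_mulrn ?powR_ge0// mulrC -!powRrM (mulrC b).
Qed.

Lemma powR_le1 (h b : R) : 0 < h -> h <= 1 -> 0 <= b -> h `^ b <= 1.
Proof.
move=> h0 h1 b0; rewrite /powR gt_eqF// -expR0 ler_expR mulr_ge0_le0//.
exact: ln_le0.
Qed.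

Lemma ordinary_smooth_rate (A n h k q : R) :
  (A / q) ^+ 2 / (n * h * k ^+ 3) = A ^+ 2 / (n * (h * q ^+ 2) * k ^+ 3).
Proof.
rewrite exprMn exprVn; move: (k ^+ 3) (q ^+ 2) => v s.
by rewrite !invfM; ring.
Qed.

(** Meant for [q0] and [q] the powers of h1 with exponents b0 and b2, and [E] the exponential of
    h1^(-b) / d2; passing from [q0] to the larger [q] is the only loss. *)
Lemma super_smooth_rate (A n h k q0 q E : R) : 0 <= n -> 0 <= h -> 0 <= k -> 0 <= q0 -> q0 <= q ->
  (A * (q0 * E)) ^+ 2 / (n * h * k ^+ 3) <=
  A ^+ 2 / (n * (h * q^-1 ^+ 2) * k ^+ 3 * (E ^+ 2)^-1).
Proof.
move=> n0 h0 k0 q00 q0q.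
have q2 : q0 ^+ 2 <= q ^+ 2 by rewrite lerXn2r ?nnegrE// (le_trans q00).
have k3 : 0 <= k ^+ 3 by exact: exprn_ge0.
rewrite !exprMn exprVn; have := sqr_ge0 A; have := sqr_ge0 E; move: q2 k3.
move: (k ^+ 3) (q0 ^+ 2) (q ^+ 2) (A ^+ 2) (E ^+ 2) => v s0 s a e q2 v0 e0 a0.
have c0 : 0 <= a * e * (n^-1 * h^-1 * v^-1) by rewrite !mulr_ge0// invr_ge0.
rewrite !invfM !invrK; have := ler_wpM2l c0 q2.
by congr (_ <= _); ring.
Qed.

Lemma div_sqrtr (E m : R) : 0 <= E -> 0 <= m ->
  E / Num.sqrt m = Num.sqrt (1 / (m * (E ^+ 2)^-1)).
Proof.
move=> E0 m0; rewrite mul1r invfM invrK sqrtrM ?invr_ge0// sqrtrV// sqrtr_sqr.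
by rewrite ger0_norm// mulrC.
Qed.

(** For [s] in the support of phi_K1 the argument of phi_U has modulus at most [1 / h n], which is
    an admissible [r] as soon as [h n <= 1]. *)
Lemma rescaled_bound (u W : R -> R) (A : R) (h : nat -> R) : (forall n, 0 < h n) ->
  h n @[n --> \oo] --> (0 : R) ->
  (forall r t, 1 <= r -> `|t| <= r -> `|u t|^-1 <= A * W r) ->
  \forall n \near \oo, forall s, `|s| <= 1 -> `|u (s / h n)|^-1 <= A * W (h n)^-1.
Proof.
move=> h0 hc H; apply: filterS (cvgr_le _ hc 1 ltr01) => n hn s s1.
apply: H; first by rewrite -invr1 lef_pV2 ?posrE.
by rewrite normrM (gtr0_norm (x := (h n)^-1)) ?invr_gt0// ler_piMl// invr_ge0 ltW.
Qed.

End Rates.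

Theorem theorem3p1 (R : realType) (d : measure_display) (T : measurableType d)
    (P : probability T R) (X Y U : nat -> {RV P >-> R})
    (p : R -> R -> R) (fU : R -> R) (yM : R -> R)
    (K1 : R -> R) (h1 h2 : nat -> R)
    (x : R) (yhat : nat -> {RV P >-> R}) (b Cp : R) :
  let lambda := @lebesgue_measure R in
  let phiU := charfun (U 0%N) in
  let phiK1 := fourier K1 in
  let K2 := @gaussian_kernel R in
  let KU0 := fun n => deconvoluting_kernel phiK1 phiU (h1 n) in
  let W := fun (j : nat) (w : T) => X j w + U j w in
  let phat := fun (n : nat) (w : T) =>
    density_estimator (KU0 n) K2 (h1 n) (h2 n) n (W ^~ w) (fun j => Y j w) in
  let mu2 := Rintegral lambda setT (fun t : R => t ^+ 2 * K1 t) in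
  let Delta := fun (n : nat) (w : T) => `|yhat n w - yM x| in
  let expansion := fun r : nat -> R =>
    exists (Z : nat -> T -> R) (e : nat -> R),
      [/\ forall n w, Delta n w =
            dominating_bias p mu2 x (yM x) (h1 n) (h2 n) + Z n w + e n,
          stochastic_bigO P Z r &
          e =o_\oo (fun n => h1 n ^+ 2 + h2 n ^+ 2)] in
  contaminated_sample X Y U p fU ->
  (forall t, phiU (- t) = phiU t) -> (forall t, phiU t != 0) ->
  is_mode_function p yM ->
  supportX p x ->
  (forall n, 0 < h1 n) -> (forall n, 0 < h2 n) ->
  h1 n @[n --> \oo] --> (0 : R) -> h2 n @[n --> \oo] --> (0 : R) ->
  lambda.-integrable setT (EFin \o K1) ->
  lambda.-integrable setT (fun t => (t ^+ 2 * K1 t)%:E) ->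
  with_probability_tending_to_one P
    (fun n => [set w | is_single_mode_in (supportY p) (phat n w) x (yhat n w)]) ->
  (* (i) *)
  continuously_differentiable2 4 p -> 0 < Cp -> partials_bounded 4 Cp p ->
  (* (ii) *)
  (forall t, K1 (- t) = K1 t) -> (forall t, K2 (- t) = K2 t) ->
  Rintegral lambda setT K1 = 1 -> Rintegral lambda setT K2 = 1 ->
  (* (iii) *)
  (forall (k : nat) t, (k < 4)%N -> derivable (derive1n k K2) t 1) ->
  continuous (derive1n 4 K2) ->
  (exists C : R, forall (k : nat) t, (k <= 4)%N -> `|derive1n k K2 t| <= C) ->
  (forall k : nat, (k <= 2)%N ->
    (\int[lambda]_t ((derive1n k K2 t) ^+ 2)%:E < +oo)%E /\
    lambda.-integrable setT (fun t => (t ^+ 2 * derive1n k K2 t)%:E)) ->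
  (* (iv) *)
  (forall n, exists C : R, forall t, cabs (phiK1 t / phiU (t / h1 n)) <= C) ->
  (forall (n k : nat), (k <= 2)%N ->
    (\int[lambda]_t (cabs (cderivn k phiK1 t / phiU (t / h1 n)))%:E < +oo)%E) ->
  (* (v) *)
  (exists C : R, forall t, cabs (phiK1 t) <= C) ->
  (exists C : R, forall t, cabs (cderiv phiK1 t) <= C) ->
  (* (vi) *)
  (\int[lambda]_t ((`|t| `^ b + `|t| `^ (b - 1)) *
     (cabs (phiK1 t) + cabs (cderiv phiK1 t)))%:E < +oo)%E ->
  (\int[lambda]_t (`|t| ^+ 4 * cabs (phiK1 t))%:E < +oo)%E ->
  (* (vii) *)
  (forall t, phiK1 t != 0 -> `|t| <= 1) ->
  (* (viii) *)
  (forall n, VC_type (kernel_class4 (KU0 n) K2 (h1 n) (h2 n))) ->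
  (* (ix) *)
  (exists2 delta : R, 0 < delta & delta <= `|dy (dy p) x (yM x)|) ->
  bounded_away_from_zero_in_probability P
    (fun n w => dy (dy (phat n w)) x (yM x)) ->
  (* (a) *)
  (ordinary_smooth phiU b ->
   (exists C : R, forall t, cabs (cderiv phiU t) <= C) ->
   (forall t, phiK1 (- t) = phiK1 t) -> (forall t, complex.Im (phiK1 t) = 0) ->
   n%:R * h1 n `^ (1 + 2 * b) * h2 n ^+ 3 @[n --> \oo] --> +oo ->
   expansion (fun n =>
     Num.sqrt (1 / (n%:R * h1 n `^ (1 + 2 * b) * h2 n ^+ 3))))
  /\
  (* (b) *)
  (forall d2 b0 : R,
   super_smooth phiU b d2 b0 ->
   (forall k : nat, (k <= 2)%N -> exists t, cderivn k phiK1 t != 0) ->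
   let b2 := if b0 < 1 / 2 then b0 else 0 in
   n%:R * h1 n `^ (1 - 2 * b2) * h2 n ^+ 3 * expR (- (2 * h1 n `^ (- b) / d2))
     @[n --> \oo] --> +oo ->
   expansion (fun n =>
     expR (h1 n `^ (- b) / d2) /
     Num.sqrt (n%:R * h1 n `^ (1 - 2 * b2) * h2 n ^+ 3))).
Proof.
move=> lambda phiU phiK1 K2 KU0 W phat mu2 Delta expansion HS phiUe phiU0 modeM xS
  h10 h20 h1c h2c K1i K1m single c4 Cp0 pb K1e K2e K1_1 K2_1 _ _ _ iii iv _ _ _ _ _ supp _ _ _.
have K2m : lambda.-integrable setT (EFin \o (fun t => t ^+ 2 * K2 t)).
  by have [] := iii 0%N isT.
have Hp : smooth_bounded 4 Cp p by split.
have core := mode_expansion HS phiUe phiU0 modeM xS h10 h20 h1c h2c K1i K1m single Hp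
  K1e K1_1 K2_1 K2m supp iv.
pose u := error_transform (P := P) U.
have cu : continuous u by exact: continuous_error_transform.
have u0 : forall t, u t != 0 by exact: error_transform_neq0.
have ue : forall t, u (- t) = u t by exact: error_transformN.
have uE t : phiU t = ((u t)%:C)%C by exact: charfunE.
split.
- move=> [b0 _ [c c0 [lim _]]] _ _ _ Nc.
  have lim' : `|t `^ b * u t - c| @[t --> +oo] --> (0 : R).
    move: lim; rewrite (_ : (fun t => _) = (fun t : R => `|t `^ b * u t - c|))//.
    apply: funext => t; rewrite uE -(rmorphM (real_complex R)) -(rmorphB (real_complex R)).
    exact: cabs_real.
  have [A A0 HA] := ordinary_smooth_inverse_bound cu u0 ue b0 c0 lim'.
  have HL := rescaled_bound h10 h1c HA.
  apply: (core (A ^+ 2) _ _ (sqr_ge0 A) Nc HL).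
  near=> n; rewrite (powR_invl _ (ltW (h10 n))) (powR_1D2 _ (h10 n)).
  by rewrite ordinary_smooth_rate.
- move=> d2 b0 [b_gt0 d20 b00 [d0 [d1 [b1 [d00 _ _ [M HM]]]]]] _ b2 Nc.
  have HM' t : M < `|t| -> d0 * `|t| `^ b0 * expR (- (`|t| `^ b / d2)) <= `|u t|.
    by move=> Mt; have [h _] := HM t Mt; rewrite uE cabs_real in h.
  have [A A0 HA] := super_smooth_inverse_bound cu u0 ue b_gt0 d20 b00 d00 HM'.
  have HL := rescaled_bound h10 h1c HA.
  have EV (q : R) : expR (- (2 * q)) = (expR q ^+ 2)^-1.
    by rewrite expRN -expRM_natl mulr_natl.
  have hb n : h1 n `^ (1 - 2 * b2) = h1 n * (h1 n `^ b2)^-1 ^+ 2.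
    by rewrite -mulrN (powR_1D2 _ (h10 n)) powRN.
  (* The rate is brought to the form [Num.sqrt (1 / N n)], where [N] is the sequence assumed to
     diverge. *)
  have -> : (fun n => expR (h1 n `^ (- b) / d2) /
      Num.sqrt (n%:R * h1 n `^ (1 - 2 * b2) * h2 n ^+ 3)) =
    (fun n => Num.sqrt (1 / (n%:R * h1 n `^ (1 - 2 * b2) * h2 n ^+ 3 *
      expR (- (2 * h1 n `^ (- b) / d2))))).
    apply: funext => n; rewrite -(mulrA 2) EV.
    rewrite div_sqrtr ?expR_ge0//.
    apply: mulr_ge0; last by apply: exprn_ge0; exact: ltW.
    by apply: mulr_ge0 => //; exact: powR_ge0.
  apply: (core (A ^+ 2) _ _ (sqr_ge0 A) Nc HL).
  near=> n; have h1n : h1 n <= 1 by near: n; exact: (cvgr_le _ h1c 1 ltr01).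
  rewrite !(powR_invl _ (ltW (h10 n))) !powRN invrK hb -(mulrA 2) EV.
  apply: super_smooth_rate; [by []|exact: ltW|exact: ltW|exact: powR_ge0|].
  (* Either b2 equals b0, or b2 is 0 and the power of [h1 n] with exponent b0 is at most 1 because
     [h1 n <= 1]. *)
  by rewrite /b2; case: ifP => // _; rewrite powRr0; exact: powR_le1 (h10 n) h1n (ltW b00).
Unshelve. all: by end_near.
Qed.
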